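(* Let $(M,\Omega,\mathbb{T},\mu)$ be a compact toric symplectic manifold of dimension $2n$, let $I_0\in K_\Omega^{\mathbb{T}}(M)$ have symplectic potential $\tau$ with Hessian $\phi_s$, and let $C,F$ be two $n\times n$ anti-symmetric constant real matrices with $F\in\mathcal{A}_\tau$. Let $\zeta$ be the flat connection on $\mathring M$ associated to $I_0$, put $\phi=\phi_s+C$, and for $t\in[0,1]$ put $\zeta^{+t}=\zeta-\frac t2F\,d\mu$ and define $J_+^t\in GK_\Omega^{\mathbb{T}}(\mathring M)$ by $$J_+^{t*}\zeta^{+t}=\phi^T d\mu,\qquad J_+^{t*}d\mu=-(\phi^{-1})^T\zeta^{+t}.$$ Then $J_+^t\in GK_\Omega^{\mathbb{T}}(M)$ for each $t\in[0,1]$; that is, $J_+^t$ extends smoothly to $M$ and the extension is an element of $GK_\Omega^{\mathbb{T}}(M)$.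
   Context: Setting. A compact toric symplectic manifold $(M,\Omega,\mathbb{T},\mu)$ of dimension $2n$ is a compact symplectic manifold with an effective Hamiltonian action of $\mathbb{T}=\mathbb{T}^n$ (Lie algebra $\mathfrak{t}$) and moment map $\mu:M\to\mathfrak{t}^*$. $\Delta=\mu(M)$ is the moment polytope, $\mathring{\Delta}$ its interior, $\mathring{M}=\mu^{-1}(\mathring{\Delta})$. Fix a basis $\{e_j\}$ of $\mathfrak{t}$; $X_j$ is the fundamental vector field of $e_j$, $\mu_j$ the components of $\mu$. The sign convention is such that $\Omega=\sum_j d\mu_j\wedge d\theta_j$ in local Darboux coordinates on $\mathring M$ with $X_j=\partial_{\theta_j}$. Two-forms are regarded as maps $TM\to T^*M$, $X\mapsto\Omega(X,\cdot)$; $A^*\alpha=\alpha\circ A$ for an endomorphism $A$ of the tangent bundle; $\zeta$, $d\mu$ are columns of 1-forms. $K_\Omega^{\mathbb{T}}(M)$ is the set of $\mathbb{T}$-invariant complex structures on $M$ compatible with $\Omega$ (toric K\''ahler structures). For $I_0\in K_\Omega^{\mathbb{T}}(M)$, let $\{\zeta_j,\vartheta_j\}$ be the coframe on $\mathring M$ dual to $\{X_j,I_0X_j\}$; $\zeta=(\zeta_j)$ is the flat connection associated to $I_0$, it satisfies $\Omega=\sum_jd\mu_j\wedge\zeta_j$, and $I_0^*\zeta=\phi_s\,d\mu$ where $\phi_s$ is the Hessian of a strictly convex function $\tau$ on $\mathring\Delta$, the symplectic potential. The matrix function $(\phi_s)^{-1}$ extends smoothly to $M$ as a nonnegative-definite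 matrix, so its square root $(\phi_s)^{-1/2}$ is continuous on $\Delta$. $\mathcal{A}_\tau$ is the set of anti-symmetric real $n\times n$ matrices $F$ such that $$\mathrm{I}+\tfrac14\big[(\phi_s)^{-1/2}F(\phi_s)^{-1/2}\big]^2\ \text{ is positive-definite at every point of }\Delta .$$ For $U=M$ or $U=\mathring M$, $GK_\Omega^{\mathbb{T}}(U)$ (toric generalized K\''ahler structures of symplectic type) is the set of $\mathbb{T}$-invariant integrable complex structures $J_+$ on $U$ that are tamed by $\Omega$ ($\Omega(X,J_+X)>0$ for $X\ne0$) and whose symplectic adjoint $J_-:=-\Omega^{-1}J_+^*\Omega$ is also integrable. (It is known that $J_+^t$ in the claim belongs to $GK_\Omega^{\mathbb{T}}(\mathring M)$.) *)

(* Defs.v *)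
From HB Require Import structures.
From mathcomp Require Import all_boot all_order all_algebra.
From mathcomp Require Import all_classical all_reals all_analysis.
Import Order.TTheory GRing.Theory Num.Theory numFieldNormedType.Exports.
Set Implicit Arguments.
Unset Strict Implicit.
Unset Printing Implicit Defensive.
Local Open Scope classical_set_scope.
Local Open Scope ring_scope.

(* Points of R^m are row vectors; tangent vectors are column vectors and
   covectors are row vectors, so that a column of k 1-forms is a k x m matrix
   and alpha \o A is the matrix product alpha *m A. *)

Definition pd (R : realType) m (j : 'I_m) (f : 'rV[R]_m -> R) : 'rV[R]_m -> R :=
  fun x => 'D_(delta_mx 0 j) f x.

(* C^infinity on the open set U: all iterated partial derivatives exist and are
   (Frechet) differentiable at every point of U. *)
Definition smooth_on (R : realType) m (U : set 'rV[R]_m) (f : 'rV[R]_m -> R) :=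
  forall (s : seq 'I_m) x, U x -> differentiable (foldr (@pd R m) f s) x.

Definition smooth_map_on (R : realType) m k (U : set 'rV[R]_m)
    (f : 'rV[R]_m -> 'rV[R]_k) :=
  forall i, smooth_on U (fun x => f x 0 i).

(* The library's jacobian acts on row vectors from the right. *)
Definition jac (R : realType) m k (f : 'rV[R]_m -> 'rV[R]_k) (x : 'rV[R]_m) :
  'M[R]_(k, m) := (jacobian f x)^T.

Record chart (R : realType) (m : nat) (T : Type) := Chart {
  dom : set T;
  coord : T -> 'rV[R]_m;
  param : 'rV[R]_m -> T }.

Definition cod (R : realType) m T (c : chart R m T) : set 'rV[R]_m :=
  coord c @` dom c.

Definition chart_axiom (R : realType) m (T : topologicalType)
    (c : chart R m T) :=
  [/\ open (dom c), open (cod c),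
      forall p, dom c p -> param c (coord c p) = p,
      {within dom c, continuous (coord c)} &
      {within cod c, continuous (param c)}].

(* A smooth atlas on a Hausdorff space; second countability is automatic for
   the compact manifolds considered below. *)
Record manifold (R : realType) (m : nat) := Manifold {
  carrier :> topologicalType;
  atlas : set (chart R m carrier);
  atlas_chart : forall c, atlas c -> chart_axiom c;
  atlas_cover : forall p, exists2 c, atlas c & dom c p;
  atlas_smooth : forall c c', atlas c -> atlas c' ->
    smooth_map_on (coord c @` (dom c `&` dom c')) (coord c' \o param c);
  manifold_hausdorff : hausdorff_space carrier }.

Definition around (R : realType) m (M : manifold R m) (c : chart R m M) (p : M) :=
  atlas c /\ dom c p.

(* The components, at each point and with respect to each chart around it, of a
   field of k x l matrices. *)
Definition tensor (R : realType) m (M : manifold R m) (k l : nat) :=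
  chart R m M -> M -> 'M[R]_(k, l).

(* A c in the coordinates of c *)
Definition in_chart (R : realType) m (M : manifold R m) k l (A : tensor M k l)
    (c : chart R m M) : 'rV[R]_m -> 'M[R]_(k, l) := fun x => A c (param c x).

Definition smooth_field (R : realType) m (M : manifold R m) k l
    (U : set M) (A : tensor M k l) :=
  forall c, atlas c -> forall i j,
    smooth_on (coord c @` (dom c `&` U)) (fun x => in_chart A c x i j).

(* The differential at p of f : M -> M, read in charts c around p and c' around
   f p; for f = id this is the change of coordinates. *)
Definition tangent (R : realType) m (M : manifold R m) (f : M -> M)
    (c c' : chart R m M) (p : M) : 'M[R]_m :=
  jac (coord c' \o f \o param c) (coord c p).

(* f^* w = w on U, for a field w of bilinear forms; for f = id this is the
   transformation law of a covariant 2-tensor. *)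
Definition form2_invariant (R : realType) m (M : manifold R m) (U : set M)
    (f : M -> M) (w : tensor M m m) :=
  forall c c' p, U p -> around c p -> around c' (f p) ->
    w c p = (tangent f c c' p)^T *m w c' (f p) *m tangent f c c' p.

(* f_* A = A on U, for a field A of endomorphisms; for f = id this is the
   transformation law of a (1,1)-tensor. *)
Definition endo_invariant (R : realType) m (M : manifold R m) (U : set M)
    (f : M -> M) (A : tensor M m m) :=
  forall c c' p, U p -> around c p -> around c' (f p) ->
    tangent f c c' p *m A c p = A c' (f p) *m tangent f c c' p.

Definition endo_field (R : realType) m (M : manifold R m) (U : set M)
    (A : tensor M m m) :=
  smooth_field U A /\ endo_invariant U id A.

Definition symplectic (R : realType) m (M : manifold R m) (w : tensor M m m) :=
  [/\ smooth_field setT w,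
      form2_invariant setT id w,
      forall c p, around c p -> (w c p)^T = - w c p,
      forall c p, around c p -> w c p \in unitmx &
      forall c x, atlas c -> cod c x -> forall i j k,
        pd i (fun y => in_chart w c y j k) x + pd j (fun y => in_chart w c y k i) x
        + pd k (fun y => in_chart w c y i j) x = 0].

Definition lie_bracket (R : realType) m (X Y : 'rV[R]_m -> 'cV[R]_m) :
    'rV[R]_m -> 'cV[R]_m := fun x =>
  \col_k \sum_l (X x l 0 * pd l (fun y => Y y k 0) x
                 - Y x l 0 * pd l (fun y => X y k 0) x).

Definition nijenhuis (R : realType) m (A : 'rV[R]_m -> 'M[R]_m)
    (X Y : 'rV[R]_m -> 'cV[R]_m) : 'rV[R]_m -> 'cV[R]_m := fun x =>
  let AX y := A y *m X y in let AY y := A y *m Y y in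
  lie_bracket AX AY x - A x *m (lie_bracket AX Y x + lie_bracket X AY x)
  + A x *m A x *m lie_bracket X Y x.

(* Integrable almost complex structures on the open set U. Since the Nijenhuis
   tensor is tensorial, it suffices to evaluate it on coordinate fields. *)
Definition complex_structure (R : realType) m (M : manifold R m) (U : set M)
    (J : tensor M m m) :=
  [/\ endo_field U J,
      forall c p, around c p -> U p -> J c p *m J c p = - 1%:M &
      forall c p, around c p -> U p -> forall i j,
        nijenhuis (in_chart J c) (cst (delta_mx i 0)) (cst (delta_mx j 0))
          (coord c p) = 0].

(* The basis (e_j) identifies the Lie algebra t with R^n, and an n-torus is the
   quotient of t by the lattice ker exp; hence an effective action of the torus
   is an action of R^n whose kernel is exactly a lattice. Here
   act theta = exp (\sum_j theta_j e_j). *)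
Definition smooth_action (R : realType) n m (M : manifold R m)
    (act : 'rV[R]_n -> M -> M) :=
  [/\ forall p, act 0 p = p,
      forall a b p, act (a + b) p = act a (act b p),
      continuous (fun z : 'rV[R]_n * M => act z.1 z.2) &
      forall c c', atlas c -> atlas c' ->
        smooth_map_on
          [set z : 'rV[R]_(n + m) | cod c (rsubmx z) /\
             dom c' (act (lsubmx z) (param c (rsubmx z)))]
          (fun z => coord c' (act (lsubmx z) (param c (rsubmx z))))].

Definition effective_torus_action (R : realType) n m (M : manifold R m)
    (act : 'rV[R]_n -> M -> M) :=
  smooth_action act /\
  exists2 B : 'M[R]_n, B \in unitmx &
    forall a, (forall p, act a p = p) <->
              exists k : 'rV[int]_n, a = map_mx intr k *m B.

(* The columns are the fundamental vector fields X_j. *)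
Definition fundamental (R : realType) n m (M : manifold R m)
    (act : 'rV[R]_n -> M -> M) : tensor M m n := fun c p =>
  \matrix_(i, j) derive1 (fun s : R => coord c (act (s *: delta_mx 0 j) p) 0 i) 0.

(* The rows are the differentials of the components of mu. *)
Definition differential (R : realType) n m (M : manifold R m)
    (mu : M -> 'rV[R]_n) : tensor M n m := fun c p =>
  jac (mu \o param c) (coord c p).

(* With X_j = d/dtheta_j, the form \sum_j dmu_j /\ dtheta_j satisfies
   Omega(X_j, .) = - dmu_j. *)
Definition moment_map (R : realType) n m (M : manifold R m) (w : tensor M m m)
    (act : 'rV[R]_n -> M -> M) (mu : M -> 'rV[R]_n) :=
  [/\ forall c, atlas c -> smooth_map_on (cod c) (mu \o param c),
      forall a p, mu (act a p) = mu p &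
      forall c p, around c p ->
        (fundamental act c p)^T *m w c p = - differential mu c p].

Record toric (R : realType) (n : nat) := Toric {
  toric_manifold :> manifold R (2 * n);
  Omega : tensor toric_manifold (2 * n) (2 * n);
  act : 'rV[R]_n -> toric_manifold -> toric_manifold;
  mu : toric_manifold -> 'rV[R]_n;
  toric_compact : compact [set: toric_manifold];
  toric_connected : connected [set: toric_manifold];
  Omega_symplectic : symplectic Omega;
  act_effective : effective_torus_action act;
  act_symplectic : forall a, form2_invariant setT (act a) Omega;
  mu_moment_map : moment_map Omega act mu }.

Arguments Omega {R n} M : rename.
Arguments act {R n} M : rename.
Arguments mu {R n} M : rename.

Definition moment_polytope (R : realType) n (M : toric R n) : set 'rV[R]_n :=
  range (mu M).

Definition open_part (R : realType) n (M : toric R n) : set M :=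
  mu M @^-1` (moment_polytope M)°.

Definition dmu (R : realType) n (M : toric R n) : tensor M n (2 * n) :=
  differential (mu M).

Arguments dmu {R n} M : rename.

(* X |-> Omega(X, .) as a map from tangent vectors to transposed covectors *)
Definition flat (R : realType) n (M : toric R n) : tensor M (2 * n) (2 * n) :=
  fun c p => (Omega M c p)^T.

Arguments flat {R n} M : rename.

(* - Omega^-1 A^* Omega *)
Definition symplectic_adjoint (R : realType) n (M : toric R n)
    (A : tensor M (2 * n) (2 * n)) : tensor M (2 * n) (2 * n) := fun c p =>
  - (invmx (flat M c p) *m (A c p)^T *m flat M c p).

Definition torus_invariant (R : realType) n (M : toric R n) (U : set M)
    (A : tensor M (2 * n) (2 * n)) :=
  forall a, endo_invariant U (act M a) A.

Definition tamed (R : realType) n (M : toric R n) (U : set M)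
    (A : tensor M (2 * n) (2 * n)) :=
  forall c p, around c p -> U p -> forall v : 'cV[R]_(2 * n), v != 0 ->
    0 < (v^T *m Omega M c p *m (A c p *m v)) 0 0.

Definition toric_kahler (R : realType) n (M : toric R n)
    (I : tensor M (2 * n) (2 * n)) :=
  [/\ complex_structure setT I, torus_invariant setT I, tamed setT I &
      forall c p, around c p -> (I c p)^T *m Omega M c p *m I c p = Omega M c p].

Definition toric_gen_kahler (R : realType) n (M : toric R n) (U : set M)
    (J : tensor M (2 * n) (2 * n)) :=
  [/\ complex_structure U J, torus_invariant U J, tamed U J &
      complex_structure U (symplectic_adjoint J)].

Definition dual_coframe (R : realType) n (M : toric R n)
    (I : tensor M (2 * n) (2 * n)) (zeta vartheta : tensor M n (2 * n)) :=
  forall c p, around c p -> open_part p ->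
    let X := fundamental (act M) c p in
    [/\ zeta c p *m X = 1%:M, zeta c p *m (I c p *m X) = 0,
        vartheta c p *m X = 0 & vartheta c p *m (I c p *m X) = 1%:M].

Definition hessian (R : realType) n (f : 'rV[R]_n -> R) (x : 'rV[R]_n) : 'M[R]_n :=
  \matrix_(i, j) pd i (pd j f) x.

Definition strictly_convex_on (R : realType) n (U : set 'rV[R]_n)
    (f : 'rV[R]_n -> R) :=
  forall x y (s : R), U x -> U y -> x != y -> 0 < s < 1 ->
    f (s *: x + (1 - s) *: y) < s * f x + (1 - s) * f y.

Definition symplectic_potential (R : realType) n (M : toric R n)
    (I : tensor M (2 * n) (2 * n)) (zeta : tensor M n (2 * n))
    (tau : 'rV[R]_n -> R) :=
  [/\ smooth_on (moment_polytope M)° tau,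
      strictly_convex_on (moment_polytope M)° tau &
      forall c p, around c p -> open_part p ->
        zeta c p *m I c p = hessian tau (mu M p) *m dmu M c p].

Definition posdef (R : realType) n (A : 'M[R]_n) :=
  A^T = A /\ forall v : 'cV[R]_n, v != 0 -> 0 < (v^T *m A *m v) 0 0.

Definition possemidef (R : realType) n (A : 'M[R]_n) :=
  A^T = A /\ forall v : 'cV[R]_n, 0 <= (v^T *m A *m v) 0 0.

Definition antisym (R : realType) n (A : 'M[R]_n) := A^T = - A.

(* S is the continuous extension to D of P^(-1/2), P being defined on the
   interior of D. *)
Definition inverse_sqrt (R : realType) n (D : set 'rV[R]_n)
    (P S : 'rV[R]_n -> 'M[R]_n) :=
  [/\ {within D, continuous S},
      forall x, D x -> possemidef (S x) &
      forall x, D° x -> S x *m S x = invmx (P x) /\ P x \in unitmx].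

Definition A_tau (R : realType) n (M : toric R n) (tau : 'rV[R]_n -> R)
    (F : 'M[R]_n) :=
  antisym F /\
  exists2 S, inverse_sqrt (moment_polytope M) (hessian tau) S &
    forall x, moment_polytope M x ->
      posdef (1%:M + 4^-1 *: ((S x *m F *m S x) *m (S x *m F *m S x))).

Definition zeta_plus (R : realType) n (M : toric R n) (zeta : tensor M n (2 * n))
    (F : 'M[R]_n) (t : R) : tensor M n (2 * n) := fun c p =>
  zeta c p - (t / 2) *: (F *m dmu M c p).

Definition is_J_plus (R : realType) n (M : toric R n) (zeta : tensor M n (2 * n))
    (tau : 'rV[R]_n -> R) (C F : 'M[R]_n) (t : R) (J : tensor M (2 * n) (2 * n)) :=
  forall c p, around c p -> open_part p ->
    let phi := hessian tau (mu M p) + C in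
    zeta_plus zeta F t c p *m J c p = phi^T *m dmu M c p /\
    dmu M c p *m J c p = - ((invmx phi)^T *m zeta_plus zeta F t c p).

(* Main.v *)
Require Import Defs.
From HB Require Import structures.
From mathcomp Require Import all_boot all_order all_algebra.
From mathcomp Require Import all_classical all_reals all_analysis.
From mathcomp Require Import ring lra.
(* Repeated so that coord and other homonyms keep their meaning for charts. *)
Require Import Defs.
Import Order.TTheory GRing.Theory Num.Theory numFieldNormedType.Exports.
Set Implicit Arguments.
Unset Strict Implicit.
Unset Printing Implicit Defensive.
Local Open Scope classical_set_scope.
Local Open Scope ring_scope.

(** Over the interior of the polytope the pair (zeta^+, dmu) is a coframe, so the
    two equations determine J_+^t there. What has to be explained is its behaviour
    over the boundary, where zeta and phi_s blow up.

    The symmetric matrix H = X^T Omega I_0 X = - dmu I_0 X of the inner products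
    of the fundamental fields is smooth on M, and equals phi_s^-1 over the
    interior. It is positive semidefinite everywhere and C is antisymmetric, so
    1 - C H and 1 - H C have inverses K and L on all of M, and
    (phi_s - C)^-1 = L H. Eliminating zeta and phi_s from the equations gives
      D = L (dmu I_0 + t/2 H F dmu)                      (this is dmu J)
      J = I_0 - X C dmu + t/2 X F D - I_0 X K (C dmu I_0 + t/2 F dmu),
    which is smooth and invariant on M because X, I_0 and dmu are (dmuJ, Jmx,
    Jmx_unique, smooth_J, J_transform).

    The set of points over the interior is dense (open_part_dense). If the
    differentials of the components of mu are dependent at p, the stabilizer of p
    contains a line and the period lattice, hence, by Dirichlet approximation, one
    of the finitely many elements of order two of the torus. If such points filled
    an open set, one of these involutions would be the identity on an open set,
    hence on the connected manifold M, and the action would not be effective. At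
    all other points mu is a submersion, so that mu p is interior.

    By density and continuity the identities that involve no inequality need only
    be checked over the interior: J^2 = -1; the symplectic adjoint of J is the
    same expression for (- C, - F) (Omega_Jmx), so that it needs no separate
    treatment; and the Nijenhuis tensor of J vanishes. For the last one, let beta
    and gamma be rows of closed 1-forms with beta J = gamma and gamma J = - beta;
    then beta and gamma annihilate the Nijenhuis tensor (nijenhuis_closed). This
    applies to beta = zeta - t/2 F dmu and gamma = (phi_s - C) dmu: the form
    phi_s dmu is the differential of grad tau o mu, and zeta is closed
    (curl_zeta) because I_0 is integrable and zeta is invariant with constant
    values on the fundamental fields.

    Positivity does not pass to limits, so tameness is proved directly at each
    point (tamed_Jmx). On the orthogonal complement of the span of X and I_0 X the
    endomorphism J is I_0. On the span, write S for the continuous extension of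
    phi_s^(-1/2); then S^2 = H on M by density, and in suitable coordinates (c, b)
    the form is |p|^2 + |r|^2 + t r^T G p with p = S c, r = S b and G = S F S.
    Since |t| <= 1, completing the square in r bounds it below by
    p^T (1 + G^2/4) p, which is positive for nonzero p by the hypothesis on F. *)

(** * Smooth functions and smooth matrix fields *)

Lemma near_eq_differentiable (R : numFieldType) (V W : normedModType R)
    (f g : V -> W) (x : V) :
  (\near x, f x = g x) -> differentiable f x -> differentiable g x.
Proof.
move=> fg df; have e0 := nbhs_singleton fg.
have [dc dE] := (diff_locallyP x f).1 df.
have gE : g \o shift x = cst (g x) + 'd f x +o_ 0 id.
  apply/eqaddoP => e egt0; have /eqaddoP /(_ e egt0) := dE.
  apply: filter_app; near=> y.
  have -> : (f \o shift x - (cst (f x) + 'd f x)) y =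
           (g \o shift x - (cst (g x) + 'd f x)) y.
    rewrite ![in LHS]fctE /= ![in RHS]fctE /= e0; congr (_ - _).
    by near: y; move: fg; rewrite (near_shift 0) subr0.
  by [].
apply/diff_locallyP; rewrite (diff_unique dc gE); split => //.
Unshelve. all: by end_near. Qed.

Lemma pd_near (R : realType) m (j : 'I_m) (f g : 'rV[R]_m -> R) x :
  (\near x, f x = g x) -> pd j f x = pd j g x.
Proof. by move=> fg; rewrite /pd; exact: near_eq_derive. Qed.

Lemma open_near_eq (T : topologicalType) (S : Type) (U : set T) (f g : T -> S) x :
  open U -> U x -> {in U, f =1 g} -> \near x, f x = g x.
Proof.
move=> oU Ux fg; have := open_nbhs_nbhs (conj oU Ux).
by apply: filterS => y Uy; apply: fg; rewrite inE.
Qed.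

Lemma smooth_onP (R : realType) m (U : set 'rV[R]_m) (f : 'rV[R]_m -> R) :
  smooth_on U f <-> (forall x, U x -> differentiable f x) /\
                    forall j, smooth_on U (pd j f).
Proof.
split=> [sf|[df sf]].
  split=> [x Ux|j s x Ux]; first exact: sf [::] x Ux.
  by have := sf (rcons s j) x Ux; rewrite foldr_rcons.
move=> s x Ux; case/lastP: s => [|s j]; first exact: df.
by rewrite foldr_rcons; exact: sf.
Qed.

Lemma foldr_pd_ext (R : realType) m (U : set 'rV[R]_m) (f g : 'rV[R]_m -> R) s :
  open U -> {in U, f =1 g} ->
  {in U, foldr (@pd R m) f s =1 foldr (@pd R m) g s}.
Proof.
move=> oU fg; elim: s => //= j s IH y; rewrite inE => Uy; apply: pd_near.
exact: open_near_eq IH.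
Qed.

Lemma smooth_ext (R : realType) m (U : set 'rV[R]_m) (f g : 'rV[R]_m -> R) :
  open U -> {in U, f =1 g} -> smooth_on U f -> smooth_on U g.
Proof.
move=> oU fg sf s x Ux.
by apply: (near_eq_differentiable (open_near_eq oU Ux (foldr_pd_ext s oU fg))); exact: sf.
Qed.

(** Coinduction: smoothness is the largest property that implies
    differentiability and is stable under partial derivatives. Closure
    properties follow without any formula for iterated derivatives of sums,
    products or quotients. *)
Lemma smooth_on_coind (R : realType) m (U : set 'rV[R]_m)
    (P : set ('rV[R]_m -> R)) :
  open U -> (forall f x, P f -> U x -> differentiable f x) ->
  (forall f j, P f -> exists2 g, P g & {in U, pd j f =1 g}) ->
  forall f, P f -> smooth_on U f.
Proof.
move=> oU Pd Pj f Pf s; elim/last_ind: s f Pf => [|s j IH] f Pf x Ux.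
  exact: Pd.
have [g Pg fg] := Pj f j Pf; rewrite foldr_rcons.
apply: near_eq_differentiable (IH g Pg x Ux).
apply: (open_near_eq oU Ux) => y Uy.
by rewrite (foldr_pd_ext s oU fg).
Qed.

(** The functions obtained from smooth ones by sums, products and inverses. The
    partial derivatives of such a function are again of this form, so the whole
    class serves as the invariant of the coinduction. *)
Inductive smooth_alg (R : realType) m (U : set 'rV[R]_m) :
    ('rV[R]_m -> R) -> Prop :=
| SmoothBase f : smooth_on U f -> smooth_alg U f
| SmoothAdd f g : smooth_alg U f -> smooth_alg U g -> smooth_alg U (f \+ g)
| SmoothMul f g : smooth_alg U f -> smooth_alg U g -> smooth_alg U (f \* g)
| SmoothInv f : (forall x, U x -> f x != 0) -> smooth_alg U f ->
    smooth_alg U (fun x => (f x)^-1).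

Lemma smooth_on_cst (R : realType) m (U : set 'rV[R]_m) (c : R) :
  open U -> smooth_on U (cst c).
Proof.
move=> oU; pose P := [set f : 'rV[R]_m -> R | exists c, f = cst c].
apply: (@smooth_on_coind _ _ _ P) => //; last by exists c.
  by move=> f x [d ->] _.
move=> f j [d ->]; exists (cst 0); first by exists 0.
by move=> x _; rewrite /pd derive_cst.
Qed.

Lemma smooth_alg_differentiable (R : realType) m (U : set 'rV[R]_m)
  (f : 'rV[R]_m -> R) x : smooth_alg U f -> U x -> differentiable f x.
Proof.
move=> sf Ux; elim: sf => [g sg|g h _ dg _ dh|g h _ dg _ dh|g g0 _ dg].
- exact: (sg [::]).
- exact: differentiableD.
- exact: differentiableM.
- exact: differentiableV (g0 _ Ux).
Qed.

Lemma smooth_algP (R : realType) m (U : set 'rV[R]_m) (f : 'rV[R]_m -> R) :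
  open U -> smooth_alg U f -> smooth_on U f.
Proof.
move=> oU; apply: (@smooth_on_coind _ _ _ (smooth_alg U)) => // {f}.
  by move=> f x sf Ux; exact: smooth_alg_differentiable sf Ux.
move=> f j; elim=> {f} [f /smooth_onP[_ sf]|f g sf [f' sf' ff'] sg [g' sg' gg']|
  f g sf [f' sf' ff'] sg [g' sg' gg']|f f0 sf [f' sf' ff']].
- by exists (pd j f) => //; exact: SmoothBase.
- exists (f' \+ g'); first exact: SmoothAdd.
  move=> x Ux; rewrite /= -ff' // -gg' // /pd deriveD //;
    by apply/diff_derivable/smooth_alg_differentiable; [eassumption|rewrite -inE].
- exists ((f \* g') \+ (g \* f')); first by apply: SmoothAdd; apply: SmoothMul.
  move=> x Ux; rewrite /= -ff' // -gg' // /pd deriveM //;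
    by apply/diff_derivable/smooth_alg_differentiable; [eassumption|rewrite -inE].
- exists (cst (-1) \* (((fun x => (f x)^-1) \* (fun x => (f x)^-1)) \* f')).
    apply: SmoothMul; first by apply: SmoothBase; exact: smooth_on_cst.
    by apply: SmoothMul => //; apply: SmoothMul; exact: SmoothInv.
  move=> x; rewrite inE => Ux; have xU : x \in U by rewrite inE.
  rewrite /= -ff' // /pd deriveV; last 2 first.
  + exact: f0.
  + by apply/diff_derivable/smooth_alg_differentiable; eassumption.
  by rewrite mulN1r -invfM -expr2 scaleNr.
Qed.

Section SmoothOps.
Context {R : realType} {m : nat} {U : set 'rV[R]_m} (oU : open U).
Implicit Types f g : 'rV[R]_m -> R.

Lemma smooth_onD f g : smooth_on U f -> smooth_on U g -> smooth_on U (fun x => f x + g x).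
Proof. by move=> sf sg; apply: (smooth_algP oU); apply: SmoothAdd; apply: SmoothBase. Qed.

Lemma smooth_onM f g : smooth_on U f -> smooth_on U g -> smooth_on U (fun x => f x * g x).
Proof. by move=> sf sg; apply: (smooth_algP oU); apply: SmoothMul; apply: SmoothBase. Qed.

Lemma smooth_onV f : (forall x, U x -> f x != 0) -> smooth_on U f ->
  smooth_on U (fun x => (f x)^-1).
Proof. by move=> f0 sf; apply: (smooth_algP oU); apply: SmoothInv => //; apply: SmoothBase. Qed.

Lemma smooth_onN f : smooth_on U f -> smooth_on U (fun x => - f x).
Proof.
move=> sf; have := smooth_onM (smooth_on_cst (-1) oU) sf.
by apply: smooth_ext => // x _; rewrite mulN1r.
Qed.

Lemma smooth_on_sum I (r : seq I) (P : pred I) (F : I -> 'rV[R]_m -> R) :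
  (forall i, P i -> smooth_on U (F i)) ->
  smooth_on U (fun x => \sum_(i <- r | P i) F i x).
Proof.
move=> sF; elim: r => [|i r IH].
  by apply: smooth_ext (smooth_on_cst 0 oU) => // x _; rewrite big_nil.
have [Pi|nPi] := boolP (P i).
  apply: smooth_ext (smooth_onD (sF i Pi) IH) => // x _.
  by rewrite big_cons Pi.
by apply: smooth_ext IH => // x _; rewrite big_cons (negPf nPi).
Qed.

Lemma smooth_on_prod I (r : seq I) (P : pred I) (F : I -> 'rV[R]_m -> R) :
  (forall i, P i -> smooth_on U (F i)) ->
  smooth_on U (fun x => \prod_(i <- r | P i) F i x).
Proof.
move=> sF; elim: r => [|i r IH].
  by apply: smooth_ext (smooth_on_cst 1 oU) => // x _; rewrite big_nil.
have [Pi|nPi] := boolP (P i).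
  apply: smooth_ext (smooth_onM (sF i Pi) IH) => // x _.
  by rewrite big_cons Pi.
by apply: smooth_ext IH => // x _; rewrite big_cons (negPf nPi).
Qed.

Definition smooth_mx k l (A : 'rV[R]_m -> 'M[R]_(k, l)) :=
  forall i j, smooth_on U (fun x => A x i j).

Lemma smooth_mx_ext k l (A B : 'rV[R]_m -> 'M[R]_(k, l)) :
  {in U, A =1 B} -> smooth_mx A -> smooth_mx B.
Proof. by move=> AB sA i j; apply: smooth_ext (sA i j) => // x /AB ->. Qed.

Lemma smooth_mx_cst k l (A : 'M[R]_(k, l)) : smooth_mx (fun=> A).
Proof. by move=> i j; exact: smooth_on_cst. Qed.

Lemma smooth_mxD k l (A B : 'rV[R]_m -> 'M[R]_(k, l)) :
  smooth_mx A -> smooth_mx B -> smooth_mx (fun x => A x + B x).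
Proof.
by move=> sA sB i j; apply: smooth_ext (smooth_onD (sA i j) (sB i j)) => // x _;
  rewrite mxE.
Qed.

Lemma smooth_mxN k l (A : 'rV[R]_m -> 'M[R]_(k, l)) :
  smooth_mx A -> smooth_mx (fun x => - A x).
Proof.
by move=> sA i j; apply: smooth_ext (smooth_onN (sA i j)) => // x _; rewrite mxE.
Qed.

Lemma smooth_mxB k l (A B : 'rV[R]_m -> 'M[R]_(k, l)) :
  smooth_mx A -> smooth_mx B -> smooth_mx (fun x => A x - B x).
Proof. by move=> sA sB; apply: smooth_mxD => //; exact: smooth_mxN. Qed.

Lemma smooth_mxZ k l a (A : 'rV[R]_m -> 'M[R]_(k, l)) :
  smooth_mx A -> smooth_mx (fun x => a *: A x).
Proof.
move=> sA i j; apply: smooth_ext (smooth_onM (smooth_on_cst a oU) (sA i j)) => //.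
by move=> x _; rewrite mxE.
Qed.

Lemma smooth_mxM k l p (A : 'rV[R]_m -> 'M[R]_(k, l)) (B : 'rV[R]_m -> 'M[R]_(l, p)) :
  smooth_mx A -> smooth_mx B -> smooth_mx (fun x => A x *m B x).
Proof.
move=> sA sB i j; pose F q x := A x i q * B x q j.
apply: (smooth_ext (f := fun x => \sum_q F q x)) => //.
  by move=> x _; rewrite mxE.
by apply: smooth_on_sum => q _; exact: smooth_onM.
Qed.

Lemma smooth_mxT k l (A : 'rV[R]_m -> 'M[R]_(k, l)) :
  smooth_mx A -> smooth_mx (fun x => (A x)^T).
Proof. by move=> sA i j; apply: smooth_ext (sA j i) => // x _; rewrite mxE. Qed.

Lemma smooth_det k (A : 'rV[R]_m -> 'M[R]_k) :
  smooth_mx A -> smooth_on U (fun x => \det (A x)).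
Proof.
move=> sA; apply: smooth_on_sum => s _; apply: smooth_onM.
  exact: smooth_on_cst.
by apply: smooth_on_prod => i _; exact: sA.
Qed.

(** Cramer's rule makes the entries of the inverse smooth. *)
Lemma smooth_mx_inv k (A : 'rV[R]_m -> 'M[R]_k) :
  (forall x, U x -> A x \in unitmx) -> smooth_mx A ->
  smooth_mx (fun x => invmx (A x)).
Proof.
move=> uA sA; apply: (@smooth_mx_ext _ _ (fun x => \matrix_(i, j) ((\det (A x))^-1 *
    ((-1) ^+ (j + i) * \det (row' j (col' i (A x))))))).
  move=> x; rewrite inE => Ux; rewrite /invmx uA //.
  by apply/matrixP => i j; rewrite !mxE.
move=> i j; apply: (smooth_ext (f := fun x => (\det (A x))^-1 *
    ((-1) ^+ (j + i) * \det (row' j (col' i (A x)))))) => //.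
  by move=> x _; rewrite mxE.
apply: smooth_onM.
  apply: smooth_onV; last exact: smooth_det.
  by move=> x Ux; have := uA x Ux; rewrite unitmxE unitfE.
apply: smooth_onM; first exact: smooth_on_cst.
apply: smooth_det => a b.
by apply: smooth_ext (sA (lift j a) (lift i b)) => // x _; rewrite !mxE.
Qed.

Lemma smooth_on_pd f j : smooth_on U f -> smooth_on U (pd j f).
Proof. by move/smooth_onP => []. Qed.

End SmoothOps.

(** * Jacobians, the mean value theorem and the symmetry of second derivatives *)

Lemma differentiable_rV (R : realType) (V : normedModType R) k (f : V -> 'rV[R]_k) x :
  (forall i, differentiable (fun y => f y 0 i) x) -> differentiable f x.
Proof.
move=> df.
have -> : f = \sum_(i < k) (fun y => f y 0 i *: (delta_mx 0 i : 'rV[R]_k)).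
  apply/funext => y; rewrite fct_sumE; apply/rowP => j; rewrite summxE.
  rewrite (bigD1 j) //= big1 => [|i ij]; rewrite !mxE ?eqxx ?mulr1 ?addr0 //.
  by rewrite eq_sym (negPf ij) mulr0.
by apply: differentiable_sum => i; exact: differentiableZl.
Qed.

Lemma jacE (R : realType) m k (f : 'rV[R]_m -> 'rV[R]_k) x i j :
  differentiable f x -> jac f x i j = pd j (fun y => f y 0 i) x.
Proof.
move=> df; rewrite !mxE -deriveE // derive_mx; last exact: diff_derivable.
by rewrite mxE.
Qed.

Lemma jac_comp (R : realType) m k l (f : 'rV[R]_m -> 'rV[R]_k)
    (g : 'rV[R]_k -> 'rV[R]_l) x :
  differentiable f x -> differentiable g (f x) ->
  jac (g \o f) x = jac g (f x) *m jac f x.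
Proof.
move=> df dg; rewrite /jac -trmx_mul; congr (_^T); apply/row_matrixP => i.
rewrite !rowE mulmxA /jacobian !mul_rV_lin1 /=.
by have -> := diff_comp df dg.
Qed.

Lemma jac_near (R : realType) m k (f g : 'rV[R]_m -> 'rV[R]_k) x :
  differentiable f x -> (\near x, f x = g x) -> jac f x = jac g x.
Proof.
move=> df fg; have dg : differentiable g x by exact: near_eq_differentiable df.
apply/matrixP => i j.
apply: (etrans (jacE i j df)); apply/esym/(etrans (jacE i j dg))/esym.
by apply: pd_near; apply: filterS fg => y ->.
Qed.

Lemma jac_id (R : realType) m (x : 'rV[R]_m) : jac id x = 1%:M.
Proof.
apply/matrixP => i j; have did : differentiable (id : 'rV[R]_m -> 'rV[R]_m) x by exact: ex_diff.
apply: (etrans (jacE i j did)).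
have := derive_mx (@derivable_id _ _ x (delta_mx 0 j : 'rV[R]_m)).
rewrite derive_id => /(congr1 (fun A : 'rV_m => A 0 i)); rewrite !mxE eqxx.
by move=> e; rewrite /pd -e.
Qed.

Lemma derive_pd (R : realType) m (f : 'rV[R]_m -> R) x v :
  differentiable f x -> 'D_v f x = \sum_i v 0 i * pd i f x.
Proof.
move=> df; rewrite deriveE // {1}[v]row_sum_delta linear_sum /=.
by apply: eq_bigr => i _; rewrite linearZ /= /pd deriveE.
Qed.

Lemma is_derive_line (R : realType) (V : normedModType R) (f : V -> R) x v (s : R) :
  differentiable f (s *: v + x) ->
  is_derive s 1 (fun r => f (r *: v + x)) ('D_v f (s *: v + x)).
Proof.
move=> df; have e : (fun h : R => h^-1 *: (((fun r => f (r *: v + x)) \o shift s) (h *: 1)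
    - f (s *: v + x))) =
   (fun h => h^-1 *: ((f \o shift (s *: v + x)) (h *: v) - f (s *: v + x))).
  by apply/funext => h /=; rewrite scalerDl -addrA [h *: 1]mulr1.
apply: DeriveDef; first by rewrite /derivable e; exact: diff_derivable.
by rewrite /derive e.
Qed.

Lemma mean_value (R : realType) (V : normedModType R) (f : V -> R) x v (h : R) :
  0 < h -> (forall s, 0 <= s <= h -> differentiable f (s *: v + x)) ->
  exists2 c, 0 < c < h & f (h *: v + x) - f x = h * 'D_v f (c *: v + x).
Proof.
move=> h0 df; pose g r := f (r *: v + x).
have dg s : 0 <= s <= h -> is_derive s 1 g ('D_v f (s *: v + x)).
  by move=> sh; apply: is_derive_line; exact: df.
have [||c ch] := @MVT R g (fun s => 'D_v f (s *: v + x)) 0 h h0.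
- by move=> s /[!in_itv] /= /andP[s0 sh]; apply: dg; rewrite !ltW.
- apply: continuous_in_subspaceT => s /[!inE] /=; rewrite in_itv /= => sh.
  by apply: differentiable_continuous; apply/derivable1_diffP; have [] := dg s sh.
rewrite /g scale0r add0r subr0 mulrC => gE; exists c => //.
Qed.

Lemma nbhs_normball (R : realType) (V : normedModType R) (x : V) (P : set V) :
  nbhs x P -> exists2 e : R, 0 < e & forall y, `|y - x| < e -> P y.
Proof.
move=> /nbhs_normP[e /= e0 eP]; exists e => // y yx; apply: eP => /=.
by rewrite distrC.
Qed.

Lemma normball_nbhs (R : realType) (V : normedModType R) (x : V) (P : set V) (e : R) :
  0 < e -> (forall y, `|y - x| < e -> P y) -> nbhs x P.
Proof.
by move=> e0 eP; apply/nbhs_normP; exists e => //= y /=; rewrite distrC => /eP.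
Qed.

Lemma ler_mx_norm (R : realType) m n (A : 'M[R]_(m, n)) i j : `|A i j| <= `|A|.
Proof.
rewrite [leRHS]/Num.Def.normr /= mx_normrE; exact: (le_bigmax _ _ (i, j)).
Qed.

Lemma mx_norm_le (R : realType) m n (A : 'M[R]_(m, n)) e :
  0 <= e -> (forall i j, `|A i j| <= e) -> `|A| <= e.
Proof.
move=> e0 Ae; rewrite [leLHS]/Num.Def.normr /= mx_normrE.
by apply: bigmax_le => // -[i j] _; exact: Ae.
Qed.

Lemma normball_convex (R : realType) (V : normedModType R) (x y z : V) (e s : R) :
  `|y - x| < e -> `|z - x| < e -> 0 <= s <= 1 -> `|s *: (z - y) + y - x| < e.
Proof.
move=> yx zx /andP[s0 s1].
have -> : s *: (z - y) + y - x = s *: (z - x) + (1 - s) *: (y - x).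
  by rewrite scalerBl scale1r addrCA -scalerBr opprB addrA subrK -addrA addrC.
apply: (le_lt_trans (ler_normD _ _)); rewrite !normrZ !ger0_norm ?subr_ge0 //.
have [->|sn1] := eqVneq s 1; first by rewrite subrr mul0r addr0 mul1r.
have lt1 : (1 - s) * `|y - x| < (1 - s) * e.
  by rewrite ltr_pM2l // subr_gt0 lt_neqAle sn1.
have le1 : s * `|z - x| <= s * e by rewrite ler_wpM2l // ltW.
by have := ler_ltD le1 lt1; rewrite -mulrDl subrKC mul1r.
Qed.

Lemma lipschitz_of_pd (R : realType) m (f : 'rV[R]_m -> R) x (r eps : R) :
  (forall y, `|y - x| < r -> differentiable f y) ->
  (forall y i, `|y - x| < r -> `|pd i f y| <= eps) ->
  forall y z, `|y - x| < r -> `|z - x| < r -> `|f z - f y| <= m%:R * eps * `|z - y|.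
Proof.
move=> df pf y z yr zr.
have cvx s : 0 <= s <= 1 -> `|s *: (z - y) + y - x| < r by exact: normball_convex.
have [|c /andP[c0 c1]] := @mean_value R _ f y (z - y) 1 ltr01.
  by move=> s s01; apply/df/cvx.
rewrite scale1r subrK mul1r => ->.
have cc : `|c *: (z - y) + y - x| < r by apply: cvx; rewrite !ltW.
rewrite derive_pd; last exact: df.
apply: (le_trans (ler_norm_sum _ _ _)).
have -> : m%:R * eps * `|z - y| = \sum_(i < m) `|z - y| * eps.
  by rewrite sumr_const card_ord -mulr_natl; ring.
apply: ler_sum => i _; rewrite normrM ler_pM //; first exact: ler_mx_norm.
exact: pf.
Qed.

Lemma continuous_dist (R : realFieldType) (T : topologicalType) (V : normedModType R) (f : T -> V) x e :
  {for x, continuous f} -> 0 < e -> nbhs x [set y | `|f x - f y| < e].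
Proof. by move=> /cvgrPdist_lt fc e0; exact: fc. Qed.

Lemma derive_translate (R : numFieldType) (V W : normedModType R) (f : V -> W) a x v :
  'D_v (fun y => f (a + y)) x = 'D_v f (a + x).
Proof.
rewrite /derive; set F := fun h => _; set G := fun h => _.
suff -> : F = G by [].
by apply/funext => h; rewrite /F /G /= addrCA.
Qed.

(** Two applications of the mean value theorem, first in the direction i to the
    difference of f in the direction j. The left side is symmetric in i and j,
    whence the symmetry of mixed derivatives. *)
Lemma second_difference (R : realType) m (U : set 'rV[R]_m) (f : 'rV[R]_m -> R)
    x i j (r h : R) :
  smooth_on U f -> (forall y, `|y - x| < r -> U y) -> 0 < h -> 2 * h < r ->
  exists2 y, `|y - x| < r &
    f (h *: delta_mx 0 i + (h *: delta_mx 0 j + x)) - f (h *: delta_mx 0 i + x)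
    - (f (h *: delta_mx 0 j + x) - f x) = h * (h * pd j (pd i f) y).
Proof.
move=> sf rU h0 hr.
have dn k : `|delta_mx 0 k : 'rV[R]_m| <= 1.
  by apply: mx_norm_le => // a b; rewrite mxE; case: andP; rewrite ?normr1 ?normr0.
have near2 s1 s2 : 0 <= s1 <= h -> 0 <= s2 <= h ->
    `|s1 *: delta_mx 0 i + (s2 *: delta_mx 0 j + x) - x| < r.
  move=> /andP[s10 s1h] /andP[s20 s2h]; rewrite addrA addrK.
  apply: le_lt_trans hr; apply: (le_trans (ler_normD _ _)).
  rewrite !normrZ !ger0_norm // mulr2n mulrDl !mul1r.
  by apply: lerD; rewrite -[leRHS]mulr1 ler_pM.
have h0h : 0 <= h <= h by rewrite lexx ltW.
have z0h : 0 <= (0 : R) <= h by apply/andP; split; [|exact: ltW].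
pose g y := f (h *: delta_mx 0 j + y) - f y.
have dfU y : U y -> differentiable f y by exact: (sf [::]).
have dsh y : differentiable (fun z => h *: delta_mx 0 j + z) (y : 'rV[R]_m).
  exact: differentiableD.
have dfsh s : 0 <= s <= h ->
    differentiable (fun y => f (h *: delta_mx 0 j + y)) (s *: delta_mx 0 i + x).
  move=> sh; apply: (@differentiable_comp _ _ _ _ (fun z => h *: delta_mx 0 j + z) f) => //.
  by apply: dfU; apply: rU; rewrite addrCA; exact: near2.
have dfs s : 0 <= s <= h -> differentiable f (s *: delta_mx 0 i + x).
  move=> sh; apply: dfU; apply: rU.
  by have := near2 s 0 sh z0h; rewrite scale0r add0r.
have [s1 s1h gE] : exists2 c, 0 < c < h &
    g (h *: delta_mx 0 i + x) - g x = h * 'D_(delta_mx 0 i) g (c *: delta_mx 0 i + x).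
  by apply: mean_value => // s sh; apply: differentiableB; [exact: dfsh|exact: dfs].
have s1h' : 0 <= s1 <= h by case/andP: s1h => *; rewrite !ltW.
have [s2 s2h fE] := @mean_value R _ (pd i f) (s1 *: delta_mx 0 i + x) (delta_mx 0 j) h h0
  (fun s sh => let: conj d _ := (smooth_onP U (pd i f)).1 (smooth_on_pd i sf) in
    d _ (rU _ (eq_ind_r (fun z => `|z - x| < r) (near2 s1 s s1h' sh) (addrCA _ _ _)))).
have s2h' : 0 <= s2 <= h by case/andP: s2h => *; rewrite !ltW.
exists (s2 *: delta_mx 0 j + (s1 *: delta_mx 0 i + x)).
  by rewrite addrCA; exact: near2.
rewrite -[h * pd j _ _]fE.
have gd : 'D_(delta_mx 0 i) g (s1 *: delta_mx 0 i + x) =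
    pd i f (h *: delta_mx 0 j + (s1 *: delta_mx 0 i + x)) - pd i f (s1 *: delta_mx 0 i + x).
  rewrite deriveB; last 2 first.
  - by apply: diff_derivable; exact: dfsh.
  - by apply: diff_derivable; exact: dfs.
  by rewrite derive_translate.
by rewrite -gd -gE /g addrCA.
Qed.

Lemma dist_through (R : realFieldType) (V : normedModType R) (a b c d : V) (e : R) :
  c = d -> `|a - d| < e / 2 -> `|b - c| < e / 2 -> `|a - b| < e.
Proof.
move=> <- ac bc; rewrite -(subrK c a) -addrA [e]splitr.
by apply: (le_lt_trans (ler_normD _ _)); apply: ltrD => //; rewrite distrC.
Qed.

Lemma schwarz (R : realType) m (U : set 'rV[R]_m) (f : 'rV[R]_m -> R) x i j :
  open U -> U x -> smooth_on U f -> pd i (pd j f) x = pd j (pd i f) x.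
Proof.
move=> oU Ux sf.
have ct a b : {for x, continuous (pd a (pd b f))}.
  by apply: differentiable_continuous; exact: (sf [:: a; b]).
apply/eqP; rewrite -subr_eq0 -normr_le0; apply/ler_addgt0Pr => e e0; rewrite add0r.
have e20 : 0 < e / 2 by rewrite divr_gt0.
have /nbhs_normball[r r0 rP] : nbhs x [set y | [/\ U y,
    `|pd i (pd j f) x - pd i (pd j f) y| < e / 2 &
    `|pd j (pd i f) x - pd j (pd i f) y| < e / 2]].
  have U1 := open_nbhs_nbhs (conj oU Ux).
  have U2 := continuous_dist (ct i j) e20; have U3 := continuous_dist (ct j i) e20.
  by apply: filterS (filterI U1 (filterI U2 U3)) => y [u1 [u2 u3]];
     split; [exact: u1|exact: u2|exact: u3].
have rU y : `|y - x| < r -> U y by move=> /rP[].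
(* Both points of second_difference for the side r / 4 lie in the ball of radius r. *)
have h0 : 0 < r / 4 by rewrite divr_gt0.
have hr : 2 * (r / 4) < r by lra.
have [y yr yE] := second_difference i j sf rU h0 hr.
have [z zr zE] := second_difference j i sf rU h0 hr.
have [_ _ yc] := rP y yr; have [_ zc _] := rP z zr.
have yz : pd j (pd i f) y = pd i (pd j f) z.
  have h' : r / 4 != 0 by rewrite gt_eqF.
  apply: (mulfI h'); apply: (mulfI h'); apply: (etrans (esym yE)).
  apply: (etrans _ zE); rewrite (addrCA ((r / 4) *: delta_mx 0 i)).
  rewrite !opprB; move: (f _) (f _) (f _) (f _) => p q u v.
  by ring.
exact: ltW (dist_through yz zc yc).
Qed.

(** * Contractions: involutions near a fixed point and submersions *)

(* Banach's fixed point theorem is applied in the complete normed module of row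
   vectors. *)
HB.instance Definition _ (R : realType) m n := Complete.on 'M[R]_(m, n).

Lemma filter_forall2 (T : Type) (I J : finType) (P : I -> J -> set T) (F : set_system T) :
  Filter F -> (forall i j, F (P i j)) -> F [set y | forall i j, P i j y].
Proof.
move=> FF FP; exact: (@filter_forall _ _ (fun i => [set y | forall j, P i j y]) F FF
  (fun i => @filter_forall _ _ (P i) F FF (FP i))).
Qed.

(** The mean value theorem bounds the Lipschitz constant by m times a bound for
    the partial derivatives, and m / (2 (m + 1)) < 1 / 2. *)
Lemma near_lipschitz (R : realType) m k (g : 'rV[R]_m -> 'rV[R]_k) x :
  (\forall y \near x, forall i, differentiable (fun z => g z 0 i) y) ->
  (forall e, 0 < e ->
     \forall y \near x, forall i j, `|pd j (fun z => g z 0 i) y| <= e) ->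
  exists2 r : R, 0 < r & forall y z, `|y - x| < r -> `|z - x| < r ->
    `|g z - g y| <= 2^-1 * `|z - y|.
Proof.
move=> dg pg; pose e : R := (2 * m.+1%:R)^-1.
have e0 : 0 < e by rewrite invr_gt0 mulr_gt0.
have [r r0 rP] := nbhs_normball (filterI dg (pg e e0)).
exists r => // y z yr zr; apply: mx_norm_le => [|a i]; first by rewrite mulr_ge0.
rewrite !mxE ord1; apply: (@le_trans _ _ (m%:R * e * `|z - y|)).
  apply: (@lipschitz_of_pd R m (fun z => g z 0 i) x r e) => //.
  - by move=> w /rP[].
  - by move=> w j /rP[_]; apply.
rewrite ler_wpM2r // /e invfM mulrCA ler_piMr // ler_pdivrMr // mul1r ler_nat.
exact: leqnSn.
Qed.

Lemma smooth_pd_near (R : realType) m (U : set 'rV[R]_m) (f : 'rV[R]_m -> R) x j e :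
  open U -> U x -> smooth_on U f -> 0 < e ->
  \forall y \near x, `|pd j f x - pd j f y| < e.
Proof.
move=> oU Ux sf e0; apply: continuous_dist => //.
exact: differentiable_continuous (sf [:: j] x Ux).
Qed.

Lemma pd_coord (R : realType) m (x : 'rV[R]_m) i j :
  pd j (fun y : 'rV[R]_m => y 0 i) x = (i == j)%:R.
Proof.
have did : differentiable (id : 'rV[R]_m -> 'rV[R]_m) x by exact: ex_diff.
by apply: (etrans (esym (jacE i j did))); rewrite jac_id mxE.
Qed.

(** The derivative of g = s - id vanishes at x, so g is 1/2-Lipschitz near x. As
    s is an involution, g (s y) - g y = - 2 g y, and therefore 2 |g y| <= |s y -
    y| / 2 = |g y| / 2. *)
Lemma near_involution (R : realType) m (U : set 'rV[R]_m)
    (s : 'rV[R]_m -> 'rV[R]_m) x :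
  open U -> U x -> smooth_map_on U s -> s x = x ->
  (forall i j, pd j (fun y => s y 0 i) x = (i == j)%:R) ->
  (\forall y \near x, s (s y) = y) ->
  \forall y \near x, s y = y.
Proof.
move=> oU Ux ss sx ps ssK.
pose g y := s y - y.
have nU : \forall y \near x, U y by exact: open_nbhs_nbhs.
have ds y i : U y -> differentiable (fun z => s z 0 i) y by exact: (ss i [::]).
have gE i : (fun z => g z 0 i) = (fun z => s z 0 i) - (fun z : 'rV_m => z 0 i).
  by apply/funext => z; rewrite !mxE.
have dc y i : differentiable (fun z : 'rV[R]_m => z 0 i) y by exact: differentiable_coord.
have [r r0 rP] : exists2 r : R, 0 < r & forall y z, `|y - x| < r -> `|z - x| < r ->
    `|g z - g y| <= 2^-1 * `|z - y|.
  apply: near_lipschitz.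
    by apply: filterS nU => y Uy i; rewrite gE; apply: differentiableB => //; exact: ds.
  move=> e e0; have nP i j := smooth_pd_near j oU Ux (ss i) e0.
  have nP' : \forall y \near x, forall i j,
      `|pd j (fun z => s z 0 i) x - pd j (fun z => s z 0 i) y| < e.
    exact: filter_forall2 nP.
  apply: filterS (filterI nU nP') => y [Uy Py] i j.
  rewrite gE /pd deriveB; [|exact/diff_derivable/ds|exact/diff_derivable].
  have := pd_coord y i j; rewrite /pd => ->; rewrite -ps distrC.
  exact: ltW (Py i j).
have sc : {for x, continuous s}.
  by apply: differentiable_continuous; apply: differentiable_rV => i; exact: ds.
have n1 : \forall y \near x, `|y - x| < r by apply: normball_nbhs r0 _.
have n2 : \forall y \near x, `|s y - x| < r.
  have := continuous_dist sc r0; rewrite sx.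
  by apply: filterS => y /=; rewrite distrC.
apply: filterS (filterI ssK (filterI n1 n2)) => y [yK [y1 y2]].
have := rP _ _ y1 y2; rewrite /g yK.
have -> : y - s y - (s y - y) = - 2 *: (s y - y).
  by rewrite scaleNr -scalerN opprB -[2]/(1 + 1) scalerDl scale1r.
rewrite normrZ normrN ger0_norm // => le.
apply/eqP; rewrite -subr_eq0 -normr_le0.
by have := normr_ge0 (s y - y); move: le; set a := `|_|; lra.
Qed.

Lemma differentiable_mulmxr (R : realType) m n (A : 'M[R]_(m, n)) (y : 'rV[R]_m) :
  differentiable (fun v : 'rV[R]_m => v *m A) y.
Proof.
apply: differentiable_rV => i.
have -> : (fun v : 'rV[R]_m => (v *m A) 0 i) =
          \sum_(j < m) (fun v : 'rV[R]_m => v 0 j * A j i).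
  by apply/funext => v; rewrite fct_sumE mxE.
apply: differentiable_sum => j; apply: differentiableM => //.
exact: differentiable_coord.
Qed.

Lemma derive_mulmxr (R : realType) m n (A : 'M[R]_(m, n)) (y v : 'rV[R]_m) :
  'D_v (fun w : 'rV[R]_m => w *m A) y = v *m A.
Proof.
rewrite deriveE; last exact: differentiable_mulmxr.
rewrite (@diff_lin R _ _ (mulmxr A)) // => z.
by apply: differentiable_continuous; exact: differentiable_mulmxr.
Qed.

Lemma fixed_point_normball (R : realType) m (T : 'rV[R]_m -> 'rV[R]_m) (r : R) :
  0 < r -> (forall y, `|y| <= r -> `|T y| <= r) ->
  (forall y z, `|y| <= r -> `|z| <= r -> `|T z - T y| <= 2^-1 * `|z - y|) ->
  exists2 y, `|y| <= r & T y = y.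
Proof.
move=> r0 Tr Tl; pose B : set 'rV[R]_m := closed_ball 0 r.
have BE y : B y <-> `|y| <= r.
  by rewrite /B closed_ballE // /closed_ball_ /= sub0r normrN.
have TB : {homo T : y / B y >-> B y} by move=> y /BE yr; apply/BE/Tr.
have [|||y By yE] := @banach_fixed_point R 'rV[R]_m B (mkfun_fun TB).
- exists (2^-1)%:nng; split => /=; first by rewrite invf_lt1 // ltr1n.
  by move=> [y z] [/= /BE yr /BE zr]; exact: Tl.
- exact: closed_ball_closed.
- by exists 0; apply/BE; rewrite normr0 ltW.
by exists y; [exact/BE|rewrite {2}yE].
Qed.

(** Restrict f to the affine space h y = x + y N^T, on which its derivative at x
    is the identity. The equation f (h y) = z is then a fixed point equation for
    the contraction y |-> z - (f (h y) - y). *)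
Lemma submersion_open (R : realType) m n (U : set 'rV[R]_m)
    (f : 'rV[R]_m -> 'rV[R]_n) x (N : 'M[R]_(m, n)) :
  open U -> U x -> smooth_map_on U f -> jac f x *m N = 1%:M ->
  nbhs (f x) (f @` U).
Proof.
move=> oU Ux sf JN.
have nU : nbhs x U by exact: open_nbhs_nbhs.
pose h (y : 'rV[R]_n) := x + y *m N^T.
have dh y : differentiable h y.
  by apply: differentiableD => //; exact: differentiable_mulmxr.
have hc : {for (0 : 'rV[R]_n), continuous h} by exact: differentiable_continuous.
have h0 : h 0 = x by rewrite /h mul0mx addr0.
have hU : \forall y \near (0 : 'rV[R]_n), U (h y) by apply: hc; rewrite h0.
pose g y := f (h y) - y.
have df y i : U y -> differentiable (fun z => f z 0 i) y by exact: (sf i [::]).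
have dfh y i : U (h y) -> differentiable (fun z => f (h z) 0 i) y.
  move=> Uhy; apply: (@differentiable_comp _ _ _ _ h (fun z => f z 0 i)) => //.
  exact: df.
have dc y i : differentiable (fun z : 'rV[R]_n => z 0 i) y by exact: differentiable_coord.
have gE i : (fun z => g z 0 i) = (fun z => f (h z) 0 i) - (fun z : 'rV_n => z 0 i).
  by apply/funext => z; rewrite !mxE.
pose p i j z := \sum_k N k j * pd k (fun w => f w 0 i) z.
have sp i j : smooth_on U (p i j).
  apply: smooth_on_sum => // k _; apply: smooth_onM => //.
    exact: smooth_on_cst.
  exact: smooth_on_pd.
have pfh i j y : U (h y) -> pd j (fun z => f (h z) 0 i) y = p i j (h y).
  move=> Uhy; rewrite /pd deriveE; last exact: dfh.
  have -> := @diff_comp R _ _ _ h (fun w => f w 0 i) y (dh y) (df _ i Uhy).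
  rewrite /= -deriveE; last exact: df.
  rewrite derive_pd; last exact: df.
  apply: eq_bigr => k _; congr (_ * _); rewrite -deriveE //.
  rewrite /h deriveD; [|exact: derivable_cst|exact/diff_derivable/differentiable_mulmxr].
  by rewrite derive_cst add0r derive_mulmxr -rowE !mxE.
have px i j : p i j x = (i == j)%:R.
  transitivity ((jac f x *m N) i j); last by rewrite JN mxE.
  rewrite mxE; apply: eq_bigr => k _; rewrite mulrC; congr (_ * _).
  by apply/esym/jacE; apply: differentiable_rV => l; exact: df.
have [r r0 rP] : exists2 r : R, 0 < r & forall y z, `|y - 0| < r -> `|z - 0| < r ->
    `|g z - g y| <= 2^-1 * `|z - y|.
  apply: near_lipschitz.
    by apply: filterS hU => y Uy i; rewrite gE; apply: differentiableB => //; exact: dfh.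
  move=> e e0.
  have nP i j : \forall y \near (0 : 'rV[R]_n), `|p i j x - p i j (h y)| < e.
    have pc : {for x, continuous (p i j)}.
      by apply: differentiable_continuous; exact: (sp i j [::]).
    apply: (hc [set z | `|p i j x - p i j z| < e]).
    by rewrite h0; exact: continuous_dist.
  have nP' : \forall y \near (0 : 'rV[R]_n), forall i j,
      `|p i j x - p i j (h y)| < e.
    exact: filter_forall2 nP.
  apply: filterS (filterI hU nP') => y [Uy Py] i j.
  rewrite gE /pd deriveB; [|exact/diff_derivable/dfh|exact/diff_derivable].
  have := pd_coord y i j; rewrite /pd => ->.
  have := pfh i j y Uy; rewrite /pd => ->; rewrite -px distrC.
  exact: ltW (Py i j).
have [r' r'0 r'U] := nbhs_normball hU.
pose d := Num.min r r' / 2.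
have d0 : 0 < d by rewrite divr_gt0 // lt_min r0.
have [dr dr'] : d < r /\ d < r'.
  have : d < Num.min r r' by rewrite ltr_pdivrMr // ltr_pMr ?ltr1n // lt_min r0.
  by rewrite lt_min => /andP.
have d20 : 0 < d / 2 by rewrite divr_gt0.
apply: (normball_nbhs d20) => z zd.
have gl y w : `|y| <= d -> `|w| <= d -> `|g w - g y| <= 2^-1 * `|w - y|.
  by move=> yd wd; apply: rP; rewrite subr0; [apply: le_lt_trans yd _|apply: le_lt_trans wd _].
have [||y yd yE] := @fixed_point_normball R n (fun y => z - g y) d d0.
- move=> y yd; have -> : z - g y = (z - f x) - (g y - g 0).
    have -> : g 0 = f x by rewrite /g h0 subr0.
    by rewrite (opprB (g y)) addrA subrK.
  apply: (le_trans (ler_normB _ _)); rewrite [d]splitr; apply: lerD; first exact: ltW.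
  apply: (le_trans (gl _ _ _ yd)); first by rewrite normr0 ltW.
  by rewrite subr0 mulrC ler_pM2r ?invr_gt0.
- move=> y w yd wd; have -> : z - g w - (z - g y) = g y - g w.
    by rewrite (opprB z) addrC addrA subrK.
  by rewrite distrC; exact: gl.
exists (h y).
  by apply: r'U; rewrite subr0; exact: le_lt_trans yd _.
by move: yE; rewrite /g opprB addrA addrAC => /eqP; rewrite -subr_eq0 addrK subr_eq0 => /eqP.
Qed.

(** * Elements of order two in the closure of a one-parameter subgroup *)

(** Pigeonhole principle for the fractional parts of i b, with i at most (N + 1)
    ^ n, in the cubes of side 1 / (N + 1). *)
Lemma dirichlet (R : realType) n (b : 'I_n -> R) (N : nat) :
  exists2 q : nat, (0 < q)%N &
    exists k : 'I_n -> int, forall j, `|q%:R * b j - (k j)%:~R| < N.+1%:R^-1.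
Proof.
pose u i j : R := i%:R * b j - (Num.floor (i%:R * b j))%:~R.
have u01 i j : 0 <= u i j < 1.
  have /andP[fl fr] := floor_itv (i%:R * b j).
  by rewrite subr_ge0 fl ltrBlDl; move: fr; rewrite intrD.
pose d (i : 'I_(N.+1 ^ n).+1) : {ffun 'I_n -> 'I_N.+1} :=
  [ffun j => inord (Num.truncn (N.+1%:R * u i j))].
have /injectivePn[i [i' ii' dii']] : ~~ injectiveb d.
  apply/injectiveP => /leq_card; rewrite card_ffun !card_ord.
  by rewrite ltnn.
wlog lt_ii' : i i' ii' dii' / (i < i')%N.
  move=> W; case: (ltngtP i i') => [/W|/W|/val_inj /eqP]; first exact.
    by apply; rewrite 1?eq_sym.
  by rewrite (negPf ii').
exists (i' - i)%N; first by rewrite subn_gt0.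
exists (fun j => Num.floor (i'%:R * b j) - Num.floor (i%:R * b j)) => j.
have -> : (i' - i)%:R * b j -
    (Num.floor (i'%:R * b j) - Num.floor (i%:R * b j))%:~R = u i' j - u i j.
  by rewrite natrB ?(ltnW lt_ii') // mulrBl rmorphB /= /u; ring.
have N0 : 0 < N.+1%:R :> R by [].
have tr (l : 'I_(N.+1 ^ n).+1) : (Num.truncn (N.+1%:R * u l j) < N.+1)%N.
  have /andP[u0 u1] := u01 l j.
  rewrite -(ltr_nat R); apply: (@le_lt_trans _ _ (N.+1%:R * u l j)).
    by have /andP[] := truncn_itv (mulr_ge0 (ltW N0) u0).
  by rewrite gtr_pMr.
have tt : Num.truncn (N.+1%:R * u i j) = Num.truncn (N.+1%:R * u i' j).
  have := congr1 (fun f : {ffun 'I_n -> 'I_N.+1} => val (f j)) dii'.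
  by rewrite !ffunE /= !inordK.
have /andP[/(mulr_ge0 (ltW N0)) /truncn_itv /andP[l1 l2] _] := u01 i j.
have /andP[/(mulr_ge0 (ltW N0)) /truncn_itv /andP[l3 l4] _] := u01 i' j.
rewrite -(ltr_pM2l N0) mulfV ?gt_eqF // -[X in X * _]ger0_norm ?(ltW N0) //.
rewrite -normrM mulrBr ltr_norml; move: l1 l2 l3 l4; rewrite -tt.
set a := N.+1%:R * u i j; set a' := N.+1%:R * u i' j.
by rewrite -natr1; set t := _%:R => *; apply/andP; split; lra.
Qed.

(** Halve s and k together, which also halves the error. As long as all entries
    of k are even, k / 2 is integral, nonzero and smaller; when an entry is odd,
    k / 2 is half-integral and not integral. *)
Lemma near_half_vector (R : realType) n (b : 'I_n -> R) (K : nat) (s e : R)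
    (k : 'I_n -> int) j0 :
  k j0 != 0 -> (`|k j0| <= K)%N -> (forall j, `|s * b j - (k j)%:~R| < e) ->
  exists s' : R, exists m : 'I_n -> int, exists h : {ffun 'I_n -> bool},
    (exists j, h j) /\
    forall j, `|s' * b j - ((h j)%:R / 2 + (m j)%:~R)| < e.
Proof.
elim: K s k => [|K IH] s k k0; first by rewrite leqn0 absz_eq0 (negPf k0).
move=> kK sk.
have e0 : 0 < e by apply: le_lt_trans (sk j0).
pose h : {ffun 'I_n -> bool} := [ffun j => (k j %% 2)%Z == 1].
pose m j := (k j %/ 2)%Z.
have km j : k j = (h j)%:Z + 2 * m j.
  rewrite {1}(divz_eq (k j) 2) addrC mulrC /m ffunE; congr (_ + _).
  have := ltz_pmod (k j) (isT : 0 < 2 :> int); have := modz_ge0 (k j) (isT : 2 != 0 :> int).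
  by case: (k j %% 2)%Z => // -[|[|]].
have smh j : `|(s / 2) * b j - ((h j)%:R / 2 + (m j)%:~R)| < e / 2.
  have -> : (s / 2) * b j - ((h j)%:R / 2 + (m j)%:~R) = (s * b j - (k j)%:~R) / 2.
    rewrite [in RHS]km intrD intrM -[(h j)%:Z%:~R]/((h j)%:R).
    by field.
  by rewrite normrM [X in _ * X]ger0_norm ?invr_ge0 // ltr_pM2r ?invr_gt0.
have [/existsP[j hj]|] := boolP [exists j, h j].
  exists (s / 2), m, h; split; first by exists j.
  by move=> l; apply: (lt_trans (smh l)); rewrite ltr_pdivrMr // ltr_pMr ?ltr1n.
rewrite negb_exists => /forallP h0.
apply: (IH (s / 2) m).
- by apply: contraNneq k0 => m0; rewrite km m0 (negPf (h0 j0)).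
- move: kK; rewrite km (negPf (h0 j0)) add0r abszM /= mul2n -addnn => kK.
  have m0 : m j0 != 0 by apply: contraNneq k0 => m0; rewrite km m0 (negPf (h0 j0)).
  have := absz_gt0 (m j0); rewrite m0 => m1.
  by rewrite -ltnS; apply: leq_trans kK; rewrite -addn1 leq_add2l.
- move=> l; apply: (le_lt_trans _ (lt_trans (smh l) _)).
    by rewrite (negPf (h0 l)) mul0r add0r.
  by rewrite ltr_pdivrMr // ltr_pMr ?ltr1n.
Qed.

(** The closure of a nontrivial one-parameter subgroup of the torus contains an
    element of order two. Indeed some multiple of b is close to a nonzero
    integral vector by Dirichlet's theorem, hence another one is close to a
    half-integral vector that is not integral; modulo the lattice there are
    finitely many of these, so that one of them is a limit of points of A. *)
Lemma half_vector_in_closed (R : realType) n (b : 'rV[R]_n) (A : set 'rV[R]_n) :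
  b != 0 -> closed A ->
  (forall (s : R) (m : 'rV[int]_n), A (s *: b + map_mx intr m)) ->
  exists2 h : {ffun 'I_n -> bool}, (exists j, h j) &
    A (\row_j ((h j)%:R / 2)).
Proof.
move=> b0 Acl Ab; apply: contrapT => nA.
pose p (h : {ffun 'I_n -> bool}) : 'rV[R]_n := \row_j ((h j)%:R / 2).
have dist (h : {ffun 'I_n -> bool}) : exists2 e : R, 0 < e & (exists j, h j) ->
    forall y, `|y - p h| < e -> ~ A y.
  have [hj|nh] := pselect (exists j, h j); last by exists 1.
  have nAp : ~ A (p h) by move=> Ap; apply: nA; exists h.
  have : nbhs (p h) (~` A).
    by apply: open_nbhs_nbhs; split => //; rewrite openC.
  by move=> /nbhs_normball[e e0 eP]; exists e.
pose e h := sval (cid2 (dist h)).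
have e0 h : 0 < e h by rewrite /e; case: cid2.
have eP (h : {ffun 'I_n -> bool}) : (exists j, h j) -> forall y, `|y - p h| < e h -> ~ A y.
  by rewrite /e; case: cid2.
have [d d0 dP] : exists2 d : R, 0 < d & forall h, d <= e h.
  exists (\big[Num.min/1]_h e h); last by move=> h; exact: bigmin_le.
  by apply: lt_bigmin => // h _; exact: e0.
have [j0 bj0] : exists j, b 0 j != 0.
  apply: contrapT => nb; move/eqP: b0; apply; apply/rowP => j.
  by rewrite mxE; apply/eqP/negP => /negP bj; apply: nb; exists j.
(* With this scaling the j0-th entry of the integral vector approximating
   q (c b) is q itself, which is not zero. *)
pose c : R := (b 0 j0)^-1.
pose N := Num.truncn (d^-1).
have [q q0 [k kP]] := dirichlet (fun j => c * b 0 j) N.+1.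
have Nd : N.+2%:R^-1 < d.
  rewrite -[d]invrK ltf_pV2 ?posrE ?invr_gt0 //.
  apply: (@lt_trans _ _ N.+1%:R); last by rewrite ltr_nat.
  have dV0 : 0 <= d^-1 by rewrite invr_ge0 ltW.
  by have /andP[] := truncn_itv dV0.
have k0 : k j0 != 0.
  apply/eqP => kj0; have := kP j0; rewrite /c mulVf // mulr1 kj0 subr0.
  rewrite ger0_norm // => /lt_le_trans.
  move/(_ 1); rewrite invf_le1 // ler1n => /(_ isT).
  by rewrite ltNge ler1n q0.
have [s [m [h [hj hP]]]] := near_half_vector k0 (leqnn _)
  (fun j => eq_ind _ (fun x => `|x - _| < _) (kP j) _ (mulrA q%:R c (b 0 j))).
apply: (eP h hj (s *: b - map_mx intr (\row_j m j))).
  apply: lt_le_trans (dP h); apply: le_lt_trans Nd.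
  apply: mx_norm_le; first by rewrite invr_ge0.
  move=> i j; rewrite !mxE ord1 -addrA -opprD [_%:~R + _]addrC.
  exact: ltW (hP j).
by rewrite -map_mxN; exact: Ab.
Qed.

(** * Charts *)

Section Charts.
Context {R : realType} {m : nat} {M : manifold R m}.
Implicit Types (c : chart R m M) (p : M) (x : 'rV[R]_m).

Lemma coordK c p : around c p -> param c (coord c p) = p.
Proof. by move=> [ac dp]; have [_ _ cK _ _] := atlas_chart ac; exact: cK. Qed.

Lemma cod_coord c p : around c p -> cod c (coord c p).
Proof. by move=> [_ dp]; exists p. Qed.

Lemma around_param c x : atlas c -> cod c x -> around c (param c x).
Proof. by move=> ac [p dp <-]; rewrite coordK. Qed.

Lemma paramK c x : atlas c -> cod c x -> coord c (param c x) = x.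
Proof. by move=> ac [p dp <-]; rewrite coordK. Qed.

Lemma open_dom c : atlas c -> open (dom c).
Proof. by move=> ac; have [] := atlas_chart ac. Qed.

Lemma open_cod c : atlas c -> open (cod c).
Proof. by move=> ac; have [] := atlas_chart ac. Qed.

Lemma nbhs_dom c p : around c p -> nbhs p (dom c).
Proof. by move=> [ac dp]; apply: open_nbhs_nbhs; split => //; exact: open_dom. Qed.

Lemma nbhs_cod c x : atlas c -> cod c x -> nbhs x (cod c).
Proof. by move=> ac cx; apply: open_nbhs_nbhs; split => //; exact: open_cod. Qed.

Lemma continuous_coord c p : around c p -> {for p, continuous (coord c)}.
Proof.
move=> [ac dp]; have [od _ _ cc _] := atlas_chart ac.
by move: cc; rewrite continuous_open_subspace // => /(_ p); apply; rewrite inE.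
Qed.

Lemma continuous_param c x : atlas c -> cod c x -> {for x, continuous (param c)}.
Proof.
move=> ac cx; have [_ oc _ _ pc] := atlas_chart ac.
by move: pc; rewrite continuous_open_subspace // => /(_ x); apply; rewrite inE.
Qed.

Lemma exists_chart p : exists c, around c p.
Proof. by have [c ac dp] := atlas_cover p; exists c. Qed.

Lemma coord_image_setT c : coord c @` (dom c `&` setT) = cod c.
Proof. by rewrite setIT. Qed.

(** This carries to all of M the identities between continuous fields that are
    established over the interior of the polytope. *)
Lemma dense_chart_eq c (P : set M) (V : normedModType R) (f g : 'rV[R]_m -> V) x :
  dense P -> atlas c -> cod c x ->
  {for x, continuous f} -> {for x, continuous g} ->
  (forall y, cod c y -> P (param c y) -> f y = g y) -> f x = g x.
Proof.
move=> dP ac cx fc gc fg; apply/eqP; rewrite -subr_eq0 -normr_le0.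
apply/ler_addgt0Pr => e e0; rewrite add0r.
have e20 : 0 < e / 2 by rewrite divr_gt0.
have nx := filterI (nbhs_cod ac cx)
  (filterI (continuous_dist fc e20) (continuous_dist gc e20)).
have ap := around_param ac cx.
have np : nbhs (param c x) (dom c `&` coord c @^-1` (cod c `&`
   ([set y | `|f x - f y| < e / 2] `&` [set y | `|g x - g y| < e / 2]))).
  apply: filterI; first exact: nbhs_dom.
  by apply: (continuous_coord ap); rewrite paramK //; exact: nx.
have [q [Iq Pq]] := dP _ (ex_intro _ _ (nbhs_singleton (nbhs_interior np)))
  (@open_interior _ _).
have [dq [cq [fq gq]]] := interior_subset Iq.
have fgq : f (coord c q) = g (coord c q).
  by apply: fg => //; rewrite coordK.
exact: ltW (dist_through (esym fgq) fq gq).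
Qed.

End Charts.

(** * Smooth actions in charts *)

Section Maps.
Context {R : realType} {m : nat} {M : manifold R m}.
Implicit Types (c : chart R m M) (p : M).

Lemma near_in_charts (f : M -> M) c c' p :
  {for p, continuous f} -> around c p -> around c' (f p) ->
  \forall x \near coord c p, cod c x /\ around c' (f (param c x)).
Proof.
move=> fc cp [ac' dc'].
have pc := continuous_param cp.1 (cod_coord cp).
have n1 : \forall x \near coord c p, dom c' (f (param c x)).
  apply: (pc (f @^-1` dom c')); rewrite coordK //.
  by apply: fc; exact: nbhs_dom.
apply: filterS (filterI (nbhs_cod cp.1 (cod_coord cp)) n1) => x [cx dx].
by split.
Qed.

Lemma differential_pullback n (mu : M -> 'rV[R]_n) (f : M -> M) c c' p :
  (forall c, atlas c -> smooth_map_on (cod c) (mu \o param c)) ->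
  (forall q, mu (f q) = mu q) ->
  {for p, continuous f} -> around c p -> around c' (f p) ->
  differentiable (coord c' \o f \o param c) (coord c p) ->
  differential mu c p = differential mu c' (f p) *m tangent f c c' p.
Proof.
move=> smu fmu fc cp cfp df.
have pK : param c (coord c p) = p by exact: coordK.
have fpE : (coord c' \o f \o param c) (coord c p) = coord c' (f p) by rewrite /= pK.
have dmu' : differentiable (mu \o param c') ((coord c' \o f \o param c) (coord c p)).
  rewrite fpE; apply: differentiable_rV => i.
  exact: (smu c' cfp.1 i [::] _ (cod_coord cfp)).
rewrite /differential /tangent -fpE -(jac_comp df dmu').
apply: jac_near.
  by apply: differentiable_rV => i; exact: (smu c cp.1 i [::] _ (cod_coord cp)).
apply: filterS (near_in_charts fc cp cfp) => x [cx fx] /=.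
by rewrite coordK // fmu.
Qed.

Lemma differentiable_transition c c' p :
  around c p -> around c' p -> differentiable (coord c' \o id \o param c) (coord c p).
Proof.
move=> cp cp'; apply: differentiable_rV => i.
apply: (atlas_smooth cp.1 cp'.1 i [::]); exists p => //.
by split; [exact: cp.2|exact: cp'.2].
Qed.

End Maps.

Section Slices.
Context {R : realType} {n m : nat}.
Implicit Types (G : 'rV[R]_(n + m) -> R) (a b : 'rV[R]_n) (x : 'rV[R]_m).

Lemma pd_slice G a x k :
  pd k (fun y => G (row_mx a y)) x = pd (rshift n k) G (row_mx a x).
Proof.
rewrite /pd /derive; set F := fun h => _; set H := fun h => _.
suff -> : F = H by [].
apply/funext => h; rewrite /F /H /=; congr (_ *: (G _ - _)).
have -> : delta_mx 0 (rshift n k) = row_mx 0 (delta_mx 0 k) :> 'rV[R]_(n + m).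
  apply/rowP => i; rewrite !mxE; case: split_ordP => j ->.
    by rewrite !mxE eq_lrshift andbF.
  by rewrite !mxE eq_rshift.
by rewrite scale_row_mx add_row_mx scaler0 add0r.
Qed.

Lemma delta_lshift j : delta_mx 0 (lshift m j) = row_mx (delta_mx 0 j) 0 :> 'rV[R]_(n + m).
Proof.
apply/rowP => i; rewrite !mxE; case: split_ordP => k ->.
  by rewrite !mxE eq_lshift.
by rewrite !mxE eq_rlshift andbF.
Qed.

Lemma differentiable_row_mx a x : differentiable (fun y : 'rV[R]_m => row_mx a y) x.
Proof.
apply: differentiable_rV => i.
have -> : (fun y : 'rV[R]_m => row_mx a y 0 i) =
   fun y => match fintype.split i with inl j => a 0 j | inr j => y 0 j end.
  by apply/funext => y; rewrite mxE.
by case: (fintype.split i) => j //; exact: differentiable_coord.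
Qed.

(** The derivatives of a slice are slices of derivatives, which is an invariant
    for the coinduction. *)
Lemma smooth_slice (W : set 'rV[R]_(n + m)) G a :
  open W -> smooth_on W G ->
  smooth_on [set y | W (row_mx a y)] (fun y => G (row_mx a y)).
Proof.
move=> oW sG.
have oV : open [set y | W (row_mx a y)].
  apply: (@open_comp _ _ (fun y : 'rV[R]_m => row_mx a y)) => // y _.
  exact/differentiable_continuous/differentiable_row_mx.
pose P := [set f : 'rV[R]_m -> R | exists2 H, smooth_on W H &
  f = fun y => H (row_mx a y)].
apply: (@smooth_on_coind _ _ _ P oV); last by exists G.
- move=> f y [H sH ->] Wy.
  apply: (@differentiable_comp _ _ _ _ (fun y : 'rV[R]_m => row_mx a y) H).
    exact: differentiable_row_mx.
  exact: (sH [::]).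
- move=> f j [H sH ->]; exists (fun y => pd (rshift n j) H (row_mx a y)).
    by exists (pd (rshift n j) H) => //; exact: smooth_on_pd.
  by move=> y _; rewrite pd_slice.
Qed.

End Slices.

Lemma continuous_pair (T U V : topologicalType) (f : T -> U) (g : T -> V) x :
  {for x, continuous f} -> {for x, continuous g} ->
  {for x, continuous (fun y => (f y, g y))}.
Proof. by move=> fc gc; exact: (cvg_pair fc gc). Qed.

Section Action.
Context {R : realType} {n m : nat} {M : manifold R m} {act : 'rV[R]_n -> M -> M}.
Hypothesis sact : smooth_action act.
Implicit Types (c : chart R m M) (p : M) (a b : 'rV[R]_n).

(** Time and space variables are joined into one vector, so that derivatives of
    the action in both kinds of variables are partial derivatives of one
    function. *)
Definition flow c c' (z : 'rV[R]_(n + m)) : 'rV[R]_m :=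
  coord c' (act (lsubmx z) (param c (rsubmx z))).

Definition flow_dom c c' : set 'rV[R]_(n + m) :=
  [set z | cod c (rsubmx z) /\ dom c' (act (lsubmx z) (param c (rsubmx z)))].

Lemma act0 p : act 0 p = p. Proof. by case: sact. Qed.

Lemma actD a b p : act (a + b) p = act a (act b p). Proof. by case: sact. Qed.

Lemma continuous_act a : continuous (act a).
Proof.
have [_ _ ac _] := sact => p.
apply: (@continuous_comp _ _ _ (fun q : M => (a, q)) (fun z => act z.1 z.2)).
  by apply: continuous_pair; [exact: cst_continuous|by move=> ?].
exact: ac.
Qed.

Lemma continuous_orbit p : continuous (act^~ p).
Proof.
have [_ _ ac _] := sact => a.
apply: (@continuous_comp _ _ _ (fun b => (b, p)) (fun z => act z.1 z.2)).
  by apply: continuous_pair; [by move=> ?|exact: cst_continuous].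
exact: ac.
Qed.

Lemma open_flow_dom c c' : atlas c -> atlas c' -> open (flow_dom c c').
Proof.
move=> ac ac'; rewrite openE => z [cz dz]; rewrite /interior.
have rc : {for z, continuous (rsubmx : 'rV[R]_(n + m) -> 'rV[R]_m)}.
  exact/differentiable_continuous/differentiable_rsubmx.
have lc : {for z, continuous (lsubmx : 'rV[R]_(n + m) -> 'rV[R]_n)}.
  exact/differentiable_continuous/differentiable_lsubmx.
apply: filterI; first by apply: rc; exact: nbhs_cod.
have [_ _ jc _] := sact.
apply: (@continuous_comp _ _ _ (fun w : 'rV[R]_(n + m) => (lsubmx w, param c (rsubmx w)))
   (fun z => act z.1 z.2) z).
- apply: continuous_pair => //; apply: (@continuous_comp _ _ _ _ (param c)) => //.
  exact: continuous_param.
- exact: jc.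
- by apply: open_nbhs_nbhs; split => //=; exact: open_dom.
Qed.

Lemma smooth_flow c c' i : atlas c -> atlas c' ->
  smooth_on (flow_dom c c') (fun z => flow c c' z 0 i).
Proof. by have [_ _ _ sm] := sact => ac ac'; exact: sm. Qed.

Lemma flow_domE c c' a x : flow_dom c c' (row_mx a x) =
  (cod c x /\ dom c' (act a (param c x))).
Proof. by rewrite /flow_dom /= row_mxKr row_mxKl. Qed.

Lemma flowE c c' a x : flow c c' (row_mx a x) = coord c' (act a (param c x)).
Proof. by rewrite /flow row_mxKr row_mxKl. Qed.

Lemma flow_dom_around c c' a p : around c p -> around c' (act a p) ->
  flow_dom c c' (row_mx a (coord c p)).
Proof.
by move=> cp cap; rewrite flow_domE coordK //; split; [exact: cod_coord|exact: cap.2].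
Qed.

Lemma open_act_dom c c' a : atlas c -> atlas c' ->
  open [set x | cod c x /\ dom c' (act a (param c x))].
Proof.
move=> ac ac'.
have -> : [set x | cod c x /\ dom c' (act a (param c x))] =
    (fun x : 'rV[R]_m => row_mx a x) @^-1` flow_dom c c'.
  by apply/seteqP; split => x /=; rewrite flow_domE.
apply: open_comp; last exact: open_flow_dom.
by move=> x _; exact/differentiable_continuous/differentiable_row_mx.
Qed.

Lemma smooth_act c c' a : atlas c -> atlas c' ->
  smooth_map_on [set x | cod c x /\ dom c' (act a (param c x))]
    (coord c' \o act a \o param c).
Proof.
move=> ac ac' i.
have := smooth_slice (a := a) (open_flow_dom ac ac') (smooth_flow i ac ac').
rewrite (_ : [set y | _] = [set x | cod c x /\ dom c' (act a (param c x))]).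
  by under [X in smooth_on _ X -> _]funext do rewrite flowE.
by apply/seteqP; split => x /=; rewrite flow_domE.
Qed.

Lemma differentiable_act c c' a p : around c p -> around c' (act a p) ->
  differentiable (coord c' \o act a \o param c) (coord c p).
Proof.
move=> cp cap; apply: differentiable_rV => i.
apply: (smooth_act (a := a) cp.1 cap.1 i [::]); split; first exact: cod_coord.
by rewrite coordK //; exact: cap.2.
Qed.

Lemma fundamentalE c p i j : around c p ->
  fundamental act c p i j = pd (lshift m j) (fun z => flow c c z 0 i) (row_mx 0 (coord c p)).
Proof.
move=> cp; rewrite mxE /pd /derive1 /derive; set F := fun h => _; set H := fun h => _.
suff -> : F = H by [].
apply/funext => h; rewrite /F /H /= delta_lshift scale_row_mx add_row_mx !flowE.
by rewrite scaler0 add0r !addr0 coordK // scale0r.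
Qed.

(** By the group law, the derivative at time a is the derivative at time 0 at
    the point act a p. *)
Lemma flow_direction c p a b i : around c p -> around c (act a p) ->
  'D_(row_mx b 0) (fun z => flow c c z 0 i) (row_mx a (coord c p)) =
  (fundamental act c (act a p) *m b^T) i 0.
Proof.
move=> cp cap.
have a0p : around c (act 0 (act a p)) by rewrite act0.
have -> : 'D_(row_mx b 0) (fun z => flow c c z 0 i) (row_mx a (coord c p)) =
    'D_(row_mx b 0) (fun z => flow c c z 0 i) (row_mx 0 (coord c (act a p))).
  rewrite /derive; set F := fun h => _; set H := fun h => _.
  suff -> : F = H by [].
  apply/funext => h; rewrite /F /H /= !scale_row_mx !add_row_mx !flowE.
  by rewrite scaler0 !add0r addr0 !coordK // actD act0.
rewrite derive_pd; last first.
  apply: (smooth_flow i cp.1 cp.1 [::]); exact: flow_dom_around.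
rewrite big_split_ord /= [X in _ + X]big1 ?addr0; last first.
  by move=> k _; rewrite row_mxEr mxE mul0r.
rewrite mxE; apply: eq_bigr => k _.
by rewrite row_mxEl fundamentalE // mxE mulrC.
Qed.

(** In a chart, the mean value theorem applied to the coordinates of the orbit
    shows that p does not move for small times; the group law extends this to
    all times. *)
Lemma act_fixed_of_fundamental0 p b :
  (forall c s, around c (act (s *: b) p) -> fundamental act c (act (s *: b) p) *m b^T = 0) ->
  forall s : R, act (s *: b) p = p.
Proof.
move=> Xb; have [c cp] := exists_chart p.
have oc : {for (0 : R), continuous (fun s : R => act (s *: b) p)}.
  apply: (@continuous_comp _ _ _ (fun s : R => s *: b) (act^~ p)).
    exact: scalel_continuous.
  exact: continuous_orbit.
have nc : nbhs (0 : R) [set s : R | dom c (act (s *: b) p)].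
  by apply: oc; rewrite scale0r act0; exact: nbhs_dom.
have [d d0 dP] := nbhs_normball nc.
have local s : 0 < s -> s < d -> act (s *: b) p = p.
  move=> s0 sd.
  have cs r : 0 <= r <= s -> around c (act (r *: b) p).
    move=> /andP[r0 rs]; split; first exact: cp.1.
    by apply: dP; rewrite subr0 ger0_norm //; exact: le_lt_trans rs sd.
  have ss : 0 <= s <= s by rewrite lexx ltW.
  rewrite -[LHS](coordK (cs s ss)) -[RHS](coordK cp); congr (param c _).
  apply/rowP => i.
  have lE r : r *: row_mx b 0 + row_mx 0 (coord c p) = row_mx (r *: b) (coord c p) :> 'rV[R]_(n + m).
    by rewrite scale_row_mx add_row_mx scaler0 add0r addr0.
  have [||r /andP[r0 rs]] := @mean_value R _ (fun z => flow c c z 0 i)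
    (row_mx 0 (coord c p)) (row_mx b 0) s.
  - exact: s0.
  - move=> r rs; rewrite lE; apply: (smooth_flow i cp.1 cp.1 [::]).
    by apply: flow_dom_around => //; exact: cs.
  have rs' : 0 <= r <= s by rewrite !ltW.
  rewrite !lE !flowE coordK // act0 flow_direction //; last exact: cs.
  by rewrite Xb ?mxE ?mulr0 => [/eqP|]; [rewrite subr_eq0 => /eqP|exact: cs].
have pos s : 0 < s -> act (s *: b) p = p.
  move=> s0; pose N := Num.truncn (s / d).
  have sd0 : 0 <= s / d by rewrite divr_ge0 // ltW.
  have rE : act ((s / N.+1%:R) *: b) p = p.
    apply: local; first by rewrite divr_gt0.
    have /andP[_] := truncn_itv sd0.
    by rewrite ltr_pdivrMr // ltr_pdivrMr // mulrC.
  have it k : act ((k%:R * (s / N.+1%:R)) *: b) p = p.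
    elim: k => [|k IH]; first by rewrite mul0r scale0r act0.
    by rewrite -natr1 mulrDl mul1r scalerDl actD rE IH.
  by have := it N.+1; rewrite mulrC divfK.
move=> s; case: (ltgtP s 0) => [s0|s0|->]; last by rewrite scale0r act0.
  rewrite -{1}[p](pos (- s)) ?oppr_gt0 // -actD scaleNr subrr.
  exact: act0.
exact: pos.
Qed.

End Action.

(** * Density of the points over the interior of the polytope *)

(** Either the first set contains U, or its complement cuts out of U a nonempty
    open set that the remaining sets cover. *)
Lemma closed_cover_interior (T : topologicalType) (I : eqType) (s : seq I)
    (F : I -> set T) (U : set T) :
  (forall i, closed (F i)) -> open U -> U !=set0 ->
  (forall x, U x -> exists2 i, i \in s & F i x) ->
  exists i, i \in s /\ (F i)° !=set0.
Proof.
move=> Fc; elim: s U => [|i s IH] U oU [x Ux] UF.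
  by have [i] := UF x Ux; rewrite in_nil.
have [sub|nsub] := pselect (U `<=` F i).
  exists i; split; first exact: mem_head.
  by exists x; move: sub; rewrite open_subsetE // => /(_ x Ux).
have [y Uy nFy] : exists2 y, U y & ~ F i y.
  apply: contrapT => ny; apply: nsub => y Uy; apply: contrapT => nFy.
  by apply: ny; exists y.
have [|||j [js jF]] := IH (U `&` ~` F i).
- by apply: openI => //; rewrite openC.
- by exists y.
- move=> z [Uz nFz]; have [j] := UF z Uz; rewrite in_cons => /orP[/eqP ->//|js Fz].
  by exists j.
by exists j; split => //; rewrite in_cons js orbT.
Qed.

Section Toric.
Context {R : realType} {n : nat} {M : toric R n}.
Implicit Types (c : chart R (2 * n) M) (p : M) (a b : 'rV[R]_n).

Lemma toric_smooth_action : smooth_action (act M).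
Proof. by have [] := act_effective M. Qed.
Let sact := toric_smooth_action.

Lemma Omega_unit c p : around c p -> Omega M c p \in unitmx.
Proof. by have [_ _ _ + _] := Omega_symplectic M; apply. Qed.

Lemma Omega_antisym c p : around c p -> (Omega M c p)^T = - Omega M c p.
Proof. by have [_ _ + _ _] := Omega_symplectic M; apply. Qed.

Lemma tangent_act_unit c c' p a : around c p -> around c' (act M a p) ->
  tangent (act M a) c c' p \in unitmx.
Proof.
move=> cp cap; have := Omega_unit cp.
rewrite (act_symplectic I cp cap) !unitmx_mul => /andP[_ //].
Qed.

Lemma smooth_mu c : atlas c -> smooth_map_on (cod c) (mu M \o param c).
Proof. by have [+ _ _] := mu_moment_map M; apply. Qed.

Lemma mu_act a p : mu M (act M a p) = mu M p.
Proof. by have [_ + _] := mu_moment_map M; apply. Qed.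

Lemma dmu_act c c' p a : around c p -> around c' (act M a p) ->
  dmu M c p = dmu M c' (act M a p) *m tangent (act M a) c c' p.
Proof.
move=> cp cap; apply: differential_pullback => //.
- exact: smooth_mu.
- exact: mu_act.
- exact: continuous_act.
- exact: differentiable_act.
Qed.

Lemma fundamental_Omega c p : around c p ->
  (fundamental (act M) c p)^T *m Omega M c p = - dmu M c p.
Proof. by have [_ _ +] := mu_moment_map M; apply. Qed.

Lemma fundamental0 c p b : around c p ->
  b *m dmu M c p = 0 -> fundamental (act M) c p *m b^T = 0.
Proof.
move=> cp b0; apply: trmx_inj; rewrite trmx_mul trmxK trmx0.
apply: (can_inj (mulmxK (Omega_unit cp))).
by rewrite -mulmxA fundamental_Omega // mulmxN b0 mul0mx oppr0.
Qed.

(** The differentials of the components of mu are linearly independent at p. *)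
Definition regular p := forall c b, around c p -> b *m dmu M c p = 0 -> b = 0.

(** As Omega is nondegenerate, b dmu = 0 says that the field of b vanishes at p.
    The relation propagates along the orbit of p because mu is invariant. *)
Lemma act_fixed_of_dmu0 c p b : around c p -> b *m dmu M c p = 0 ->
  forall s : R, act M (s *: b) p = p.
Proof.
move=> cp b0; apply: act_fixed_of_fundamental0 => // c' s cs.
apply: (fundamental0 cs).
apply: (can_inj (mulmxK (tangent_act_unit cp cs))).
by rewrite -mulmxA -(dmu_act cp cs) b0 mul0mx.
Qed.

Lemma closed_point p : closed [set p].
Proof.
by apply: accessible_closed_set1; apply: hausdorff_accessible; exact: manifold_hausdorff.
Qed.

(** The stabilizer of p contains the period lattice and, since p is not regular,
    a line; it is closed, so half_vector_in_closed applies in the basis of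
    periods. *)
Lemma fixed_by_half_period (B : 'M[R]_n) p : B \in unitmx ->
  (forall k : 'rV[int]_n, act M (map_mx intr k *m B) p = p) -> ~ regular p ->
  exists2 h : {ffun 'I_n -> bool}, (exists j, h j) &
    act M ((\row_j ((h j)%:R / 2)) *m B) p = p.
Proof.
move=> uB kB nreg.
have [c [b [cp b0 bn0]]] : exists c b, [/\ around c p, b *m dmu M c p = 0 & b <> 0].
  apply: contrapT => nb; apply: nreg => c b cp b0; apply: contrapT => bn0.
  by apply: nb; exists c, b.
have bfix := act_fixed_of_dmu0 cp b0.
pose A := [set y : 'rV[R]_n | act M (y *m B) p = p].
apply: (@half_vector_in_closed R n (b *m invmx B) A).
- apply/eqP => e; apply: bn0; rewrite -[b](mulmxKV uB) e; exact: mul0mx.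
- apply: (@preimage_closed _ _ (fun y : 'rV[R]_n => act M (y *m B) p) [set p]).
    move=> y _; apply: (@continuous_comp _ _ _ (fun y : 'rV[R]_n => y *m B) ((act M)^~ p)).
      exact/differentiable_continuous/differentiable_mulmxr.
    exact: continuous_orbit.
  exact: closed_point.
- move=> s m; rewrite /A /= mulmxDl scalemxAl mulmxKV // actD // kB.
  exact: bfix.
Qed.

Lemma closed_fixed a : closed [set p : M | act M a p = p].
Proof.
move=> p pcl; apply/esym; apply: (@manifold_hausdorff _ _ M) => A B nA nB.
have [q [qE [Aq Bq]]] := pcl _ (filterI nA (continuous_act sact nB)).
by exists q; split => //; rewrite -qE.
Qed.

(** The interior of the fixed point set is closed: at a limit p of interior
    fixed points the derivative of the involution is the identity by continuity,
    so that the involution is the identity near p. Then connectedness applies. *)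
Lemma involution_trivial a : (forall p, act M a (act M a p) = p) ->
  [set p : M | act M a p = p]° !=set0 -> forall p, act M a p = p.
Proof.
move=> aK V0; pose V := [set p : M | act M a p = p]°.
have oV : open V by exact: open_interior.
suff cV : closed V.
  have VT : V = setT.
    apply: (toric_connected (t := M)) => //; first by exists V; rewrite ?setTI.
    by exists V; rewrite ?setTI.
  move=> p; have Vp : V p by rewrite VT.
  exact: (interior_subset Vp).
move=> p pV.
have ap : act M a p = p.
  by apply: closed_fixed => B /pV [q [Vq Bq]]; exists q; split => //; exact: interior_subset Vq.
have [c cp] := exists_chart p.
have cap : around c (act M a p) by rewrite ap.
pose D := [set x | cod c x /\ dom c (act M a (param c x))].
pose s := coord c \o act M a \o param c.
have oD : open D by exact: open_act_dom cp.1 cp.1.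
have ss : smooth_map_on D s by exact: smooth_act cp.1 cp.1.
have Dx : D (coord c p) by split; [exact: cod_coord|rewrite coordK // ap; exact: cp.2].
have sx : s (coord c p) = coord c p by rewrite /s /= coordK // ap.
have sV q : V q -> dom c q -> \forall y \near coord c q, s y = y.
  move=> Vq dq; have cq : around c q by split; [exact: cp.1|].
  have nV : nbhs (coord c q) [set y | V (param c y)].
    apply: (continuous_param cp.1 (cod_coord cq)); rewrite coordK //.
    exact: open_nbhs_nbhs.
  apply: filterS (filterI nV (nbhs_cod cp.1 (cod_coord cq))) => y [Vy cy].
  by rewrite /s /= (interior_subset Vy) paramK //; exact: cp.1.
have ps i j : pd j (fun y => s y 0 i) (coord c p) = (i == j)%:R.
  apply/eqP; rewrite -subr_eq0 -normr_le0; apply/ler_addgt0Pr => e e0; rewrite add0r.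
  have nB : nbhs p (coord c @^-1` [set y | `|pd j (fun y => s y 0 i) (coord c p) -
      pd j (fun y => s y 0 i) y| < e]).
    apply: (continuous_coord cp).
    exact: (smooth_pd_near j oD Dx (ss i) e0).
  have [q [Vq [Bq dq]]] := pV _ (filterI nB (nbhs_dom cp)).
  have cq : around c q by split; [exact: cp.1|].
  have e1 : pd j (fun y => s y 0 i) (coord c q) = (i == j)%:R.
    rewrite -(pd_coord (coord c q)); apply: pd_near.
    by apply: filterS (sV q Vq dq) => y ->.
  by rewrite -e1; exact: ltW.
have ssK : \forall y \near coord c p, s (s y) = y.
  have ac := @continuous_act _ _ _ _ _ sact a p.
  apply: filterS (near_in_charts ac cp cap) => y [cy ay].
  by rewrite /s /= coordK // aK paramK //; exact: cp.1.
have ns := near_involution oD Dx ss sx ps ssK.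
have nd : nbhs p [set q | dom c (act M a q)].
  by apply: continuous_act => //; rewrite ap; exact: nbhs_dom.
have nc : nbhs p (coord c @^-1` [set y | s y = y]).
  by apply: (continuous_coord cp); exact: ns.
apply: filterS (filterI nc (filterI (nbhs_dom cp) nd)).
move=> q [sq [dq daq]].
have cq : around c q by split; [exact: cp.1|].
have caq : around c (act M a q) by split; [exact: cp.1|].
move: sq; rewrite /= /s /= coordK // => e.
by rewrite -[LHS](coordK caq) e coordK.
Qed.

(** Otherwise the fixed point sets of the elements of order two cover an open
    set, so one of them has an interior point; that element then acts trivially,
    although half an odd period is not a period. *)
Lemma regular_dense : dense [set p | regular p].
Proof.
move=> U U0 oU; apply: contrapT => nU.
have [_ [B uB kerB]] := act_effective M.
have kB (k : 'rV[int]_n) q : act M (map_mx intr k *m B) q = q.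
  by have [_ +] := kerB (map_mx intr k *m B); apply; exists k.
pose half (h : {ffun 'I_n -> bool}) : 'rV[R]_n := (\row_j ((h j)%:R / 2)) *m B.
pose s := [seq h : {ffun 'I_n -> bool} <- enum predT | [exists j, h j]].
have [||h [hs hF]] := @closed_cover_interior M _ s (fun h => [set p : M | act M (half h) p = p]) U _ oU U0.
- by move=> h; exact: closed_fixed.
- move=> p Up; have [] : exists2 h : {ffun 'I_n -> bool}, (exists j, h j) & act M (half h) p = p.
    apply: fixed_by_half_period => // rp; apply: nU; by exists p.
  move=> h [j hj] hp; exists h => //.
  by rewrite mem_filter mem_enum andbT; apply/existsP; exists j.
have hK p : act M (half h) (act M (half h) p) = p.
  rewrite -actD // -mulmxDl.
  have -> : \row_j ((h j)%:R / 2) + \row_j ((h j)%:R / 2) =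
     map_mx intr (\row_j (h j)%:Z) :> 'rV[R]_n.
    by apply/rowP => j; rewrite !mxE -splitr.
  exact: kB.
have hid := involution_trivial hK hF.
have [k kE] := (kerB (half h)).1 hid.
have {}kE : \row_j ((h j)%:R / 2) = map_mx intr k :> 'rV[R]_n.
  exact: (can_inj (mulmxK uB)).
move: hs; rewrite mem_filter => /andP[/existsP[j hj] _].
have := congr1 (fun v : 'rV[R]_n => v 0 j) kE; rewrite !mxE hj => e.
(* An integral entry equal to 1 / 2 would make 1 even. *)
have : (2 * k 0 j)%:~R = 1%:~R :> R by rewrite intrM -e mulrCA mulfV ?mulr1.
move=> /intr_inj /(congr1 (fun z : int => (z %% 2)%Z)).
by rewrite mulrC modzMl.
Qed.

(** At a regular point mu is a submersion, and the image of a submersion is a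
    neighbourhood of its values. *)
Lemma regular_open_part p : regular p -> open_part p.
Proof.
move=> rp; have [c cp] := exists_chart p.
have /row_freeP[N dN] : row_free (dmu M c p).
  rewrite -kermx_eq0; apply/eqP/row_matrixP => i; rewrite row0.
  by apply: (rp c _ cp); rewrite -row_mul mulmx_ker row0.
have := submersion_open (open_cod cp.1) (cod_coord cp) (smooth_mu cp.1) dN.
rewrite /= coordK // => nm; rewrite /open_part /=.
by apply: filterS nm => y [x cx <-]; exists (param c x).
Qed.

Lemma open_part_dense : dense (@open_part R n M).
Proof.
move=> U U0 oU; have [p [Up rp]] := regular_dense U0 oU.
by exists p; split => //; exact: regular_open_part.
Qed.

End Toric.

(** * Pointwise linear algebra of the extension *)

Section PointwiseAlgebra.
Context {R : realFieldType} {m n : nat}.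
Implicit Types (I w : 'M[R]_m) (X : 'M[R]_(m, n)) (d : 'M[R]_(n, m)) (C F H : 'M[R]_n).

(** The inner products of the fields X_j in the metric Omega (., I .), see
    gramE. It is locked so that rewriting treats it as an atom. *)
Definition gram d I X : 'M[R]_n := locked (- (d *m I *m X)).

Lemma gramN d I X : gram d I X = - (d *m I *m X).
Proof. by rewrite /gram -lock. Qed.

(** The composite of dmu and Jmx, see dmu_Jmx. *)
Definition dmuJ C F (t : R) X I d : 'M[R]_(n, m) :=
  let H := gram d I X in
  invmx (1%:M - H *m C) *m (d *m I + (t / 2) *: (H *m F *m d)).

(** The solution J of the equations that define J_+^t, after elimination of zeta
    and of the Hessian P by means of P^-1 = gram and zeta I = P dmu. The
    inverses that remain exist wherever the metric is positive. *)
Definition Jmx C F (t : R) X I d : 'M[R]_m :=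
  let K := invmx (1%:M - C *m gram d I X) in
  I - X *m C *m d + (t / 2) *: (X *m F *m dmuJ C F t X I d)
  - I *m X *m K *m (C *m d *m I + (t / 2) *: (F *m d)).

(** The formula is natural: a linear map that intertwines I, X and dmu
    intertwines J. *)
Lemma Jmx_transform (T I I' : 'M[R]_m) (X X' : 'M[R]_(m, n)) (d d' : 'M[R]_(n, m)) C F t :
  T *m I = I' *m T -> X' = T *m X -> d = d' *m T ->
  T *m Jmx C F t X I d = Jmx C F t X' I' d' *m T.
Proof.
move=> TI XT dT.
have HH : gram d I X = gram d' I' X'.
  by rewrite !gramN XT dT -!mulmxA (mulmxA T) TI -!mulmxA.
have dI : d *m I = d' *m I' *m T by rewrite dT -!mulmxA TI.
have dJ : dmuJ C F t X I d = dmuJ C F t X' I' d' *m T.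
  by rewrite /dmuJ HH dI dT -!mulmxA mulmxDl -!mulmxA -scalemxAl -!mulmxA.
have dE : C *m d *m I + (t / 2) *: (F *m d) =
    (C *m d' *m I' + (t / 2) *: (F *m d')) *m T.
  by rewrite -mulmxA dI dT mulmxDl -scalemxAl !mulmxA.
rewrite /Jmx /= dJ HH dE dT XT (mulmxBr T) (mulmxDr T) (mulmxBr T) -scalemxAr.
rewrite [in RHS]mulmxBl [in RHS](mulmxDl (_ - _)) [in RHS]mulmxBl -scalemxAl.
by congr (_ - _ + _ *: _ - _); rewrite ?mulmxA ?TI ?mulmxA.
Qed.

Lemma antisym_form C (v : 'cV[R]_n) : C^T = - C -> (v^T *m C *m v) 0 0 = 0.
Proof.
move=> Ca; have : (v^T *m C *m v)^T = - (v^T *m C *m v).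
  by rewrite !trmx_mul trmxK Ca !(mulNmx, mulmxN) mulmxA.
move=> /(congr1 (fun A : 'M[R]_1 => A 0 0)); rewrite !mxE => e.
by lra.
Qed.

(** Here pp = |p|^2, rr = |r|^2, g = t r^T G p, bb = |G p|^2 and s = (t / 2)^2,
    in the notation of square_completion. *)
Lemma completed_square_gt0 (pp rr g bb s : R) :
  0 < pp - 4^-1 * bb -> s * bb <= 4^-1 * bb -> 0 <= rr + g + s * bb ->
  0 < pp + rr + g.
Proof. lra. Qed.

Section Kahler.
Variables (w I : 'M[R]_m) (X : 'M[R]_(m, n)) (d : 'M[R]_(n, m)).
Hypotheses (II : I *m I = - 1%:M) (wI : I^T *m w *m I = w) (wa : w^T = - w).
Hypotheses (Xw : X^T *m w = - d) (dX : d *m X = 0).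
Hypothesis pos : forall v : 'cV[R]_m, v != 0 -> 0 < (v^T *m w *m (I *m v)) 0 0.

Lemma trI_w : I^T *m w = - (w *m I).
Proof. by rewrite -{2}wI -!mulmxA II mulmxN mulmx1 mulmxN opprK. Qed.

Lemma metric_sym : (w *m I)^T = w *m I.
Proof. by rewrite trmx_mul wa mulmxN trI_w opprK. Qed.

Lemma gramE : gram d I X = X^T *m (w *m I) *m X.
Proof. by rewrite gramN -mulNmx -mulNmx -Xw !mulmxA. Qed.

Lemma dIX : d *m I *m X = - gram d I X.
Proof. by rewrite gramN opprK. Qed.

Lemma frame_dmu (a b : 'cV[R]_n) : d *m (X *m a + I *m X *m b) = - (gram d I X *m b).
Proof. by rewrite mulmxDr !mulmxA dX mul0mx add0r dIX mulNmx. Qed.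

Lemma frame_dmuI (a b : 'cV[R]_n) :
  d *m I *m (X *m a + I *m X *m b) = - (gram d I X *m a).
Proof.
rewrite mulmxDr !mulmxA dIX -(mulmxA d) II mulmxN mulmx1 !mulNmx dX mul0mx.
by rewrite oppr0 addr0.
Qed.

Lemma gram_sym : (gram d I X)^T = gram d I X.
Proof. by rewrite gramE trmx_mul [in LHS]trmx_mul metric_sym trmxK !mulmxA. Qed.

Lemma metric_ge0 (v : 'cV[R]_m) : 0 <= (v^T *m (w *m I) *m v) 0 0.
Proof.
have [->|v0] := eqVneq v 0; first by rewrite mulmx0 mxE.
by rewrite -!mulmxA mulmxA ltW // pos.
Qed.

Lemma metric_eq0 (v : 'cV[R]_m) : (v^T *m (w *m I) *m v) 0 0 = 0 -> v = 0.
Proof.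
move=> v0; apply/eqP; apply/negPn/negP => vn0.
by have := pos vn0; rewrite mulmxA -(mulmxA _ w) v0 ltxx.
Qed.

Lemma gram_form (v : 'cV[R]_n) :
  (v^T *m gram d I X *m v) = (X *m v)^T *m (w *m I) *m (X *m v).
Proof. by rewrite gramE trmx_mul !mulmxA. Qed.

(** The metric is definite, so the null vectors of the possibly degenerate
    matrix gram are exactly the linear relations between the fields X_j. *)
Lemma gram_eq0 (v : 'cV[R]_n) : (v^T *m gram d I X *m v) 0 0 = 0 -> X *m v = 0.
Proof. by rewrite gram_form => /metric_eq0. Qed.

Lemma gram_kernel (v : 'cV[R]_n) : gram d I X *m v = 0 -> X *m v = 0.
Proof. by move=> Hv; apply: gram_eq0; rewrite -mulmxA Hv mulmx0 mxE. Qed.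

(** If v = C H v, then v^T H v = (H v)^T C^T (H v) = 0 since C is antisymmetric;
    hence X v = 0, H v = 0 and v = 0. No invertibility of H is involved, so that
    the boundary of the polytope is covered. *)
Lemma unit_subCH C : C^T = - C -> 1%:M - C *m gram d I X \in unitmx.
Proof.
move=> Ca; rewrite -unitmx_tr -row_free_unit -kermx_eq0.
set A := _^T; apply/eqP/row_matrixP => i; rewrite row0.
have : row i (kermx A) *m A = 0 by rewrite -row_mul mulmx_ker row0.
move: (row i (kermx A)) => u; rewrite /A => /(congr1 trmx).
rewrite trmx_mul trmxK trmx0 mulmxBl mul1mx => /eqP; rewrite subr_eq0 => /eqP uE.
apply: trmx_inj; rewrite trmx0; move: uE; set v := u^T => vE.
have Hv : X *m v = 0.
  have vT : v^T = - ((gram d I X *m v)^T *m C).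
    by rewrite {1}vE -mulmxA trmx_mul Ca mulmxN.
  by apply: gram_eq0; rewrite -mulmxA vT mulNmx mxE antisym_form // oppr0.
by rewrite vE gramE -!mulmxA Hv !mulmx0.
Qed.

Lemma unit_subHC C : C^T = - C -> 1%:M - gram d I X *m C \in unitmx.
Proof.
move=> Ca; rewrite -unitmx_tr linearB /= trmx1 trmx_mul gram_sym.
by apply: unit_subCH; rewrite Ca linearN /= Ca opprK.
Qed.

Lemma gram_mul_inv C : C^T = - C ->
  gram d I X *m invmx (1%:M - C *m gram d I X) =
  invmx (1%:M - gram d I X *m C) *m gram d I X.
Proof.
move=> Ca; set H := gram d I X.
apply: (can_inj (mulKmx (unit_subHC Ca))); apply: (can_inj (mulmxK (unit_subCH Ca))).
rewrite -/H mulKVmx ?unit_subHC // -!mulmxA mulVmx ?unit_subCH // mulmx1.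
by rewrite mulmxBl mulmxBr mul1mx mulmx1 mulmxA.
Qed.

Section Derived.
Variables (C F : 'M[R]_n) (t : R).
Hypotheses (Ca : C^T = - C) (Fa : F^T = - F).
Let H := gram d I X.
Let K := invmx (1%:M - C *m H).
Let L := invmx (1%:M - H *m C).
Let J := Jmx C F t X I d.
Let D := dmuJ C F t X I d.

Lemma invHC : L = 1%:M + L *m H *m C.
Proof.
have := mulVmx (unit_subHC Ca); rewrite -/H -/L mulmxBr mulmx1 mulmxA => <-.
by rewrite subrK.
Qed.

(** The terms in X vanish since dmu X = 0, and dmu I X = - H turns the last term
    into H K (C dmu I + t/2 F dmu) = L H (C dmu I + t/2 F dmu), with L H C = L -
    1. *)
Lemma dmu_Jmx : d *m J = D.
Proof.
rewrite /J /Jmx -/H -/K -/D; move EE : (C *m d *m I + _) => E.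
rewrite !(mulmxDr, mulmxN) -scalemxAr !mulmxA dX !mul0mx scaler0 oppr0 !addr0.
have HK : H *m K = L *m H := gram_mul_inv Ca.
rewrite dIX -/H !mulNmx opprK HK -EE.
have LdI : L *m (d *m I) = d *m I + L *m H *m C *m (d *m I).
  by rewrite {1}invHC mulmxDl mul1mx.
rewrite /D /dmuJ -/H -/L !(mulmxDr L) mulmxDr LdI -addrA.
congr (_ + (_ + _)); first by rewrite !mulmxA.
by rewrite -[LHS]scalemxAr -[RHS]scalemxAr !mulmxA.
Qed.

Lemma dmuI_Jmx : d *m I *m J = - d + H *m C *m d - (t / 2) *: (H *m F *m D).
Proof.
have dIIX (Y : 'M[R]_(n, m)) : d *m I *m (X *m Y) = - (H *m Y).
  by rewrite mulmxA dIX -/H mulNmx.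
have dII : d *m I *m I = - d by rewrite -mulmxA II mulmxN mulmx1.
rewrite /J /Jmx -/H -/K -/D; move: (C *m d *m I + _) => E.
have dIX0 : d *m I *m (I *m X *m K *m E) = 0.
  by rewrite !mulmxA dII !mulNmx dX !mul0mx oppr0.
rewrite !(mulmxDr, mulmxN) -scalemxAr dII dIX0 oppr0 addr0 -!(mulmxA X) !dIIX.
by rewrite opprK scalerN !mulmxA.
Qed.

(* The frame (X, I X) with dual coframe (zeta, vartheta) over the open orbits. *)
Section Frame.
Variables (z v : 'M[R]_(n, m)) (P : 'M[R]_n).
Hypotheses (mE : m = (n + n)%N) (zX : z *m X = 1%:M) (zIX : z *m (I *m X) = 0).
Hypotheses (vX : v *m X = 0) (vIX : v *m (I *m X) = 1%:M).
Hypothesis zI : z *m I = P *m d.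

(** Only here does the dimension 2n enter: a left inverse of a square matrix is
    a right inverse. *)
Lemma coframe_resolution : X *m z + I *m X *m v = 1%:M.
Proof.
rewrite -mul_row_col.
have : col_mx z v *m row_mx X (I *m X) = 1%:M.
  by rewrite mul_col_row zX zIX vX vIX -scalar_mx_block.
move: (col_mx z v) (row_mx X (I *m X)); rewrite -mE => A B; exact: mulmx1C.
Qed.

(** zeta I = P dmu, applied to I X. *)
Lemma hessian_gram : P *m H = 1%:M.
Proof.
rewrite -[H]opprK -dIX mulmxN !mulmxA -zI -!mulmxA (mulmxA I) II mulNmx mul1mx.
by rewrite mulmxN zX opprK.
Qed.

Lemma gram_hessian : H *m P = 1%:M. Proof. exact: mulmx1C hessian_gram. Qed.

Lemma hessian_sym : P^T = P.
Proof.
have := congr1 trmx hessian_gram; rewrite trmx_mul trmx1 (gram_sym) => HP.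
by rewrite -[P^T]mul1mx -hessian_gram -mulmxA HP mulmx1.
Qed.

Lemma dE : d = - (H *m v).
Proof.
by rewrite -[LHS]mulmx1 -coframe_resolution mulmxDr !mulmxA dX mul0mx add0r dIX mulNmx.
Qed.

Lemma dIE : d *m I = - (H *m z).
Proof.
rewrite -[LHS]mulmx1 -coframe_resolution mulmxDr !mulmxA dIX -(mulmxA d) II.
by rewrite mulmxN mulmx1 !mulNmx dX mul0mx oppr0 addr0.
Qed.

(** The Darboux form Omega = sum of dmu_j /\ zeta_j, tested on the frame (X, I
    X). *)
Lemma OmegaE : w = d^T *m z - z^T *m d.
Proof.
have wX : w *m X = d^T.
  apply: trmx_inj; rewrite trmx_mul trmxK wa mulmxN Xw opprK //.
have wIX : w *m I *m X = z^T *m H.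
  rewrite -[w *m I]opprK -trI_w mulNmx -mulmxA wX -trmx_mul dIE linearN opprK /=.
  by rewrite trmx_mul gram_sym.
rewrite -[LHS]mulmx1 -coframe_resolution mulmxDr !mulmxA wX wIX -mulmxA.
by congr (_ + _); rewrite dE mulmxN opprK.
Qed.

Lemma coframe_inj k (A B : 'M[R]_(m, k)) : z *m A = z *m B -> d *m A = d *m B -> A = B.
Proof.
move=> zAB dAB; have vAB : v *m A = v *m B.
  rewrite -[v]mul1mx -hessian_gram -(mulmxA P) -[H *m v]opprK -dE.
  by rewrite !mulmxN !mulNmx -!mulmxA dAB.
rewrite -[A]mul1mx -[B]mul1mx -coframe_resolution !mulmxDl -!mulmxA zAB.
by rewrite vAB.
Qed.

Definition zplus : 'M[R]_(n, m) := z - (t / 2) *: (F *m d).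

(** L H = (1 - H C)^-1 H is a form of (P - C)^-1 that makes sense where P does
    not. *)
Lemma LH_inv : L *m H *m (P - C) = 1%:M.
Proof.
rewrite -mulmxA mulmxBr gram_hessian.
exact: mulVmx (unit_subHC Ca).
Qed.

Lemma LH_invr : (P - C) *m (L *m H) = 1%:M. Proof. exact: mulmx1C LH_inv. Qed.

Lemma dmuJE : D = - (L *m H *m zplus).
Proof.
rewrite /D /dmuJ -/H -/L dIE /zplus -(mulmxA L) -(mulmxN L); congr (L *m _).
by rewrite mulmxBr opprB addrC -scalemxAr mulmxA.
Qed.

Lemma z_Jmx : z *m J = (P - C) *m d + (t / 2) *: (F *m D).
Proof.
rewrite /J /Jmx -/H -/K -/D; move: (C *m d *m I + _) => E.
have zIX' : z *m I *m X = 0 by rewrite -mulmxA.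
rewrite !(mulmxDr, mulmxN) -scalemxAr !mulmxA zIX' !mul0mx oppr0 addr0.
by rewrite zX !mul1mx zI mulmxBl.
Qed.

Lemma zplus_Jmx : zplus *m J = (P - C) *m d.
Proof. by rewrite /zplus mulmxBl -scalemxAl -mulmxA dmu_Jmx z_Jmx addrK. Qed.

Lemma dmu_Jmx_zplus : d *m J = - (L *m H *m zplus).
Proof. by rewrite dmu_Jmx dmuJE. Qed.

(** dmu and zeta^+ form a coframe, since zeta^+ differs from zeta by multiples
    of dmu. *)
Lemma coframe_plus_inj k (A B : 'M[R]_(m, k)) :
  zplus *m A = zplus *m B -> d *m A = d *m B -> A = B.
Proof.
move=> zAB dAB; apply: coframe_inj => //.
have zE (Y : 'M[R]_(m, k)) : z *m Y = zplus *m Y + (t / 2) *: (F *m (d *m Y)).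
  by rewrite /zplus mulmxBl -scalemxAl mulmxA subrK.
by rewrite !zE zAB dAB.
Qed.

Lemma Jmx_unique A : zplus *m A = (P - C) *m d -> d *m A = - (L *m H *m zplus) -> A = J.
Proof. by move=> zA dA; apply: coframe_plus_inj; rewrite ?zA ?dA ?zplus_Jmx ?dmu_Jmx_zplus. Qed.

Lemma Jmx_sqr : J *m J = - 1%:M.
Proof.
apply: coframe_plus_inj.
  rewrite mulmxA zplus_Jmx -mulmxA dmu_Jmx_zplus !mulmxN mulmxA LH_invr.
  by rewrite mul1mx mulmx1.
rewrite mulmxA dmu_Jmx_zplus mulNmx -(mulmxA (L *m H)) zplus_Jmx mulmxA LH_inv.
by rewrite mul1mx mulmxN mulmx1.
Qed.

End Frame.

End Derived.

Section Adjoint.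
Variables (C F : 'M[R]_n) (t : R).
Hypotheses (Ca : C^T = - C) (Fa : F^T = - F).
Variables (z v : 'M[R]_(n, m)) (P : 'M[R]_n).
Hypotheses (mE : m = (n + n)%N) (zX : z *m X = 1%:M) (zIX : z *m (I *m X) = 0).
Hypotheses (vX : v *m X = 0) (vIX : v *m (I *m X) = 1%:M).
Hypothesis zI : z *m I = P *m d.

(** Expand both sides with OmegaE: they are determined by zeta J and dmu J,
    where passing to the transpose turns P - C into P + C and F into - F. *)
Lemma Omega_Jmx :
  w *m Jmx (- C) (- F) t X I d = - ((Jmx C F t X I d)^T *m w).
Proof.
have Ca' : (- C)^T = - - C by rewrite linearN /= Ca.
have PT : P^T = P by apply: hessian_sym zX zI.
have wE : w = d^T *m z - z^T *m d by apply: OmegaE mE zX zIX vX vIX.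
set J := Jmx C F t X I d; set A := Jmx _ _ _ _ _ _.
have dJ := dmu_Jmx_zplus F t Ca mE zX zIX vX vIX.
have zJ := z_Jmx C F t zX zIX zI.
have dA := dmu_Jmx_zplus (- F) t Ca' mE zX zIX vX vIX.
have zA := z_Jmx (- C) (- F) t zX zIX zI.
rewrite -(dmu_Jmx F t Ca) -/J in zJ; rewrite -(dmu_Jmx (- F) t Ca') -/A in zA.
set Q := invmx (1%:M - gram d I X *m C) *m gram d I X in dJ.
have QA : invmx (1%:M - gram d I X *m (- C)) *m gram d I X = Q^T.
  rewrite -(gram_mul_inv Ca') /Q trmx_mul gram_sym trmx_inv linearB /= trmx1.
  by rewrite trmx_mul gram_sym Ca.
rewrite QA in dA.
set zp := zplus F t z in dJ; set zm := zplus (- F) t z in dA.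
have wA : w *m A = d^T *m (z *m A) - z^T *m (d *m A) by rewrite {1}wE mulmxBl !mulmxA.
have Jw : J^T *m w = (d *m J)^T *m z - (z *m J)^T *m d.
  by rewrite {1}wE mulmxBr !mulmxA -!trmx_mul.
have zpT : zp^T = z^T + (t / 2) *: (d^T *m F).
  by rewrite /zp /zplus linearB linearZ /= trmx_mul Fa mulmxN scalerN opprK.
have zmE : zm = z + (t / 2) *: (F *m d).
  by rewrite /zm /zplus mulNmx scalerN opprK.
have h1 : w *m A = d^T *m (P + C) *m d - zp^T *m (d *m A).
  rewrite wA zA opprK zpT; move: (P + C) => PC; rewrite mulmxDr mulmxDl opprD -scalemxAr -scalemxAl !mulmxA.
  by rewrite mulmxN !mulNmx scalerN addrA addrAC.
have h2 : - (J^T *m w) = d^T *m (P + C) *m d - (d *m J)^T *m zm.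
  rewrite Jw zJ opprB zmE linearD linearZ /= !trmx_mul linearB /= PT Ca opprK Fa.
  move: (P + C) => PC; rewrite mulmxDl mulmxDr opprD -scalemxAr -scalemxAl !mulmxA.
  by rewrite mulmxN !mulNmx scalerN -addrA [- _ + - _]addrC.
rewrite h1 h2 dA dJ; congr (_ - _).
have -> : (- (Q *m zp))^T = - (zp^T *m Q^T) by rewrite linearN /= trmx_mul.
by rewrite mulmxN mulNmx mulmxA.
Qed.

End Adjoint.

(** The components X_j . y define a vector orthogonal to the kernel of gram,
    which consists of the relations between the X_j, hence in the range of the
    symmetric matrix gram. This gives orthogonal projections onto the span of X
    at points where the X_j are dependent. *)
Lemma gram_range (y : 'cV[R]_m) : exists a, gram d I X *m a = X^T *m (w *m I) *m y.
Proof.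
set H := gram d I X.
have XZ : X *m cokermx H = 0.
  have kern j : X *m (cokermx H *m delta_mx j (0 : 'I_1)) = 0.
    by apply: gram_kernel; rewrite mulmxA mulmx_coker mul0mx.
  apply/matrixP => i j; have := congr1 (fun A : 'cV[R]_m => A i 0) (kern j).
  by rewrite mulmxA -colE !mxE.
have /submxP[a aE] : (y^T *m (w *m I) *m X <= H)%MS.
  by rewrite submxE -(mulmxA _ X) XZ mulmx0.
have HT : H^T = H by exact: gram_sym.
exists a^T; rewrite -[in LHS]HT -trmx_mul -aE.
by rewrite trmx_mul [in LHS]trmx_mul metric_sym trmxK mulmxA.
Qed.

Section Tamed.
Variables (C F S : 'M[R]_n) (t : R).
Hypotheses (Ca : C^T = - C) (Fa : F^T = - F) (ST : S^T = S).
Hypotheses (SS : S *m S = gram d I X) (t01 : 0 <= t <= 1).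
Let G := S *m F *m S.
Hypothesis Gpos : forall p : 'cV[R]_n, p != 0 ->
  0 < (p^T *m (1%:M + 4^-1 *: (G *m G)) *m p) 0 0.
Let H := gram d I X.
Let J := Jmx C F t X I d.

Lemma dot_ge0 k (a : 'cV[R]_k) : 0 <= (a^T *m a) 0 0.
Proof. by rewrite mxE; apply: sumr_ge0 => i _; rewrite mxE -expr2 sqr_ge0. Qed.

Lemma dot_eq0 k (a : 'cV[R]_k) : (a^T *m a) 0 0 = 0 -> a = 0.
Proof.
rewrite mxE => /eqP; rewrite psumr_eq0 => [/allP a0|i _]; last first.
  by rewrite mxE -expr2 sqr_ge0.
apply/colP => i; have := a0 i (mem_index_enum i).
by rewrite !mxE mulf_eq0 orbb => /eqP.
Qed.

(** |r + t/2 G p|^2 = |r|^2 + t r^T G p + t^2/4 |G p|^2 and p^T G^2 p = - |G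
    p|^2; the hypothesis on G says that |p|^2 > |G p|^2 / 4. *)
Lemma square_completion (p r : 'cV[R]_n) :
  0 <= (p^T *m p) 0 0 + (r^T *m r) 0 0 + t * (r^T *m G *m p) 0 0 /\
  ((p^T *m p) 0 0 + (r^T *m r) 0 0 + t * (r^T *m G *m p) 0 0 = 0 -> p = 0 /\ r = 0).
Proof.
have GT : G^T = - G by rewrite /G !trmx_mul ST Fa mulNmx mulmxN mulmxA.
have [b bE] : {b | b = G *m p} by exists (G *m p).
have pGp : (p^T *m (1%:M + 4^-1 *: (G *m G)) *m p) 0 0 =
    (p^T *m p) 0 0 - 4^-1 * (b^T *m b) 0 0.
  rewrite mulmxDr mulmx1 mulmxDl -scalemxAr -scalemxAl mulmxA.
  have -> : p^T *m G = - b^T by rewrite bE trmx_mul GT mulmxN opprK.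
  by rewrite !mulNmx -mulmxA -bE !mxE mulrN.
have sq : ((r + (t / 2) *: b)^T *m (r + (t / 2) *: b)) 0 0 =
   (r^T *m r) 0 0 + t * (r^T *m G *m p) 0 0 + (t / 2) ^+ 2 * (b^T *m b) 0 0.
  have -> : r^T *m G *m p = r^T *m b by rewrite bE mulmxA.
  have br : b^T *m r = r^T *m b.
    have -> : b^T *m r = (r^T *m b)^T by rewrite [RHS]trmx_mul trmxK.
    by apply/matrixP => i j; rewrite !ord1 mxE.
  have -> : (r + (t / 2) *: b)^T = r^T + (t / 2) *: b^T by rewrite linearD /= linearZ.
  rewrite mulmxDl !mulmxDr -!scalemxAl -!scalemxAr br.
  by rewrite !mxE; field.
have := dot_ge0 (r + (t / 2) *: b); rewrite sq => sq0.
have b0 := dot_ge0 b.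
have t2 : (t / 2) ^+ 2 <= 4^-1.
  have -> : 4^-1 = 2^-1 ^+ 2 :> R by field.
  case/andP: t01 => t0 t1; rewrite lerXn2r ?nnegrE ?divr_ge0 ?invr_ge0 //.
  by rewrite ler_pdivrMr // mulVf.
have tb : (t / 2) ^+ 2 * (b^T *m b) 0 0 <= 4^-1 * (b^T *m b) 0 0 by rewrite ler_wpM2r.
have [p0|pn0] := eqVneq p 0.
  have rGp : (r^T *m G *m p) 0 0 = 0 by rewrite p0 mulmx0 mxE.
  have pp : (p^T *m p) 0 0 = 0 by rewrite p0 mulmx0 mxE.
  rewrite rGp pp mulr0 addr0 add0r; split; first exact: dot_ge0.
  by move=> /dot_eq0.
have := Gpos pn0; rewrite pGp => ppos; clear pn0; split.
  exact: ltW (completed_square_gt0 ppos tb sq0).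
by move=> q0; have := completed_square_gt0 ppos tb sq0; rewrite q0 ltxx.
Qed.

(** The change of variable from a to c is chosen so that dmu J y = - H c; the
    terms in C then become antisymmetric forms evaluated on the diagonal, and
    vanish. *)
Lemma frame_form (a b : 'cV[R]_n) (y := X *m a + I *m X *m b)
    (c := invmx (1%:M - C *m H) *m (a + (t / 2) *: (F *m H *m b))) :
  (y^T *m w *m (J *m y)) 0 0 =
  (c^T *m H *m c) 0 0 + (b^T *m H *m b) 0 0 + t * (b^T *m H *m F *m H *m c) 0 0.
Proof.
have HT : H^T = H by exact: gram_sym.
have dy : d *m y = - (H *m b) := frame_dmu a b.
have dIy : d *m I *m y = - (H *m a) := frame_dmuI a b.
have HK : H *m invmx (1%:M - C *m H) = invmx (1%:M - H *m C) *m H := gram_mul_inv Ca.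
have aE : a = c - C *m (H *m c) - (t / 2) *: (F *m H *m b).
  rewrite mulmxA -{1}[c]mul1mx -mulmxBl /c mulKVmx ?addrK //.
  exact: unit_subCH.
have dJy : d *m J *m y = - (H *m c).
  have e : (d *m I + (t / 2) *: (H *m F *m d)) *m y =
      - (H *m (a + (t / 2) *: (F *m H *m b))).
    rewrite mulmxDl -scalemxAl -(mulmxA _ d) dIy dy (mulmxDr H) opprD.
    by rewrite mulmxN scalerN -scalemxAr !mulmxA.
  rewrite dmu_Jmx // /dmuJ -/H -(mulmxA (invmx _)) e /c mulmxN; congr (- _).
  by rewrite mulmxA -HK -(mulmxA H).
have dIJy : d *m I *m J *m y = H *m b - H *m C *m (H *m b) + (t / 2) *: (H *m F *m (H *m c)).
  rewrite dmuI_Jmx // -/H -(dmu_Jmx F t Ca) // -/J !(mulmxDl, mulNmx) -scalemxAl.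
  by rewrite -(mulmxA (H *m C)) -(mulmxA (H *m F)) dJy dy !mulmxN scalerN !opprK.
have yw : y^T *m w = b^T *m (d *m I) - a^T *m d.
  have -> : y^T = a^T *m X^T + b^T *m X^T *m I^T.
    by rewrite /y linearD /= !trmx_mul mulmxA.
  have XIw : X^T *m (I^T *m w) = d *m I by rewrite trI_w mulmxN mulmxA Xw mulNmx opprK.
  by rewrite mulmxDl -!mulmxA Xw XIw mulmxN addrC.
have -> : y^T *m w *m (J *m y) = b^T *m (d *m I *m J *m y) - a^T *m (d *m J *m y).
  by rewrite yw mulmxBl !mulmxA.
rewrite dIJy dJy mulmxN opprK {1}aE; clear dJy dIJy aE; clearbody c.
have cCc : (c^T *m H *m C *m H *m c) 0 0 = 0.
  have -> : c^T *m H *m C *m H *m c = (H *m c)^T *m C *m (H *m c).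
    by rewrite trmx_mul HT !mulmxA.
  exact: antisym_form.
have bCb : (b^T *m H *m C *m H *m b) 0 0 = 0.
  have -> : b^T *m H *m C *m H *m b = (H *m b)^T *m C *m (H *m b).
    by rewrite trmx_mul HT !mulmxA.
  exact: antisym_form.
have -> : (c - C *m (H *m c) - (t / 2) *: (F *m H *m b))^T =
    c^T + c^T *m H *m C + (t / 2) *: (b^T *m H *m F).
  rewrite !linearB linearZ /= !trmx_mul HT Ca Fa !mulmxN scalerN !opprK.
  by rewrite !mulmxA.
rewrite !(mulmxDr, mulmxDl) mulmxN -!scalemxAr -!scalemxAl !mulmxA.
move: cCc bCb; rewrite !mxE => -> ->.
by field.
Qed.

(** Project v orthogonally onto the span of X and I X, as v = y + u. On u, where
    dmu and dmu I vanish, J is I; the cross terms vanish because the span is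
    stable under J and I; and the part in y is given by frame_form and
    square_completion. When it vanishes, c and b are relations between the X_j,
    which forces a = c and y = 0. *)
Lemma tamed_Jmx (v : 'cV[R]_m) : v != 0 -> 0 < (v^T *m w *m (J *m v)) 0 0.
Proof.
move=> v0.
(* y = X a + I X b is the orthogonal projection of v. *)
have [a aE] := gram_range v; have [b bE] := gram_range (- (I *m v)).
pose y := X *m a + I *m X *m b; pose u := v - y.
have dy : d *m y = - (H *m b) := frame_dmu a b.
have dIy : d *m I *m y = - (H *m a) := frame_dmuI a b.
have Gd (x : 'cV[R]_m) : X^T *m (w *m I) *m x = - (d *m I *m x).
  by rewrite mulmxA Xw !mulNmx.
have du : d *m u = 0.
  rewrite /u mulmxBr dy opprK /H bE Gd mulmxN opprK -mulmxA (mulmxA I) II.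
  by rewrite mulNmx mul1mx mulmxN subrr.
have dIu : d *m I *m u = 0 by rewrite /u mulmxBr dIy opprK /H aE Gd subrr.
have Ju : J *m u = I *m u.
  have Du : dmuJ C F t X I d *m u = 0.
    rewrite /dmuJ -(mulmxA (invmx _)) mulmxDl dIu -scalemxAl -(mulmxA _ d) du.
    by rewrite mulmx0 scaler0 addr0 mulmx0.
  have Eu : (C *m d *m I + (t / 2) *: (F *m d)) *m u = 0.
    rewrite mulmxDl -scalemxAl -(mulmxA C) -(mulmxA C) dIu -(mulmxA F) du.
    by rewrite !mulmx0 scaler0 addr0.
  rewrite /J /Jmx mulmxBl -(mulmxA _ (C *m d *m I + _)) Eu mulmx0 subr0 mulmxDl mulmxBl.
  by rewrite -scalemxAl -(mulmxA _ d) du -(mulmxA (X *m F)) Du !mulmx0 scaler0 subr0 addr0.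
have Xwu : X^T *m w *m u = 0 by rewrite Xw mulNmx du oppr0.
have uwX : u^T *m w *m X = 0.
  by apply: trmx_inj; rewrite !trmx_mul trmxK wa trmx0 mulNmx mulmxN mulmxA Xwu oppr0.
have uwIX : u^T *m w *m I *m X = 0.
  have -> : u^T *m w *m I *m X = (X^T *m (w *m I) *m u)^T.
    by rewrite [RHS]trmx_mul (trmx_mul X^T) metric_sym trmxK !mulmxA.
  by rewrite Gd dIu oppr0 trmx0.
have uspan (p q : 'cV[R]_n) : u^T *m w *m (X *m p + I *m X *m q) = 0.
  by rewrite mulmxDr !mulmxA uwX uwIX !mul0mx addr0.
have [p [q Jy]] : exists p q : 'cV[R]_n, J *m y = X *m p + I *m X *m q.
  pose E := C *m d *m I + (t / 2) *: (F *m d).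
  pose K := invmx (1%:M - C *m H).
  exists (- b - C *m (d *m y) + (t / 2) *: (F *m (dmuJ C F t X I d *m y))),
    (a - K *m (E *m y)).
  rewrite /J /Jmx -/H -/K -/E; move: E K (dmuJ C F t X I d) => E K D.
  have Iy : I *m y = I *m X *m a - X *m b.
    by rewrite /y mulmxDr !mulmxA II mulNmx mul1mx mulNmx.
  rewrite mulmxBl mulmxDl mulmxBl -scalemxAl Iy; move: (y : 'cV[R]_m) => y'.
  rewrite !(mulmxDr X) !(mulmxDr (I *m X)) !mulmxN -scalemxAr !mulmxA.
  by rewrite [RHS]addrCA !addrA.
have uwIy : (y^T *m w *m (I *m u)) 0 0 = 0.
  have -> : y^T *m w *m (I *m u) = (u^T *m w *m (I *m y))^T.
    by rewrite !mulmxA -!(mulmxA _ w I) [RHS]trmx_mul (trmx_mul u^T) metric_sym trmxK !mulmxA.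
  have -> : I *m y = X *m (- b) + I *m X *m a.
    by rewrite /y mulmxDr !mulmxA II mulNmx mul1mx mulNmx mulmxN addrC.
  by rewrite uspan trmx0 mxE.
have vE : v = y + u by rewrite /u addrC subrK.
have qE : (v^T *m w *m (J *m v)) 0 0 = (y^T *m w *m (J *m y)) 0 0 + (u^T *m w *m (I *m u)) 0 0.
  have -> : v^T *m w *m (J *m v) = y^T *m w *m (J *m y) + y^T *m w *m (I *m u) +
      (u^T *m w *m (J *m y) + u^T *m w *m (I *m u)).
    rewrite vE; move: Ju; clearbody u; move: (y : 'cV[R]_m) => y' Ju.
    have -> : (y' + u)^T = y'^T + u^T by rewrite linearD.
    by rewrite (mulmxDr J) Ju !mulmxDl !mulmxDr.
  by rewrite Jy uspan add0r -Jy !mxE; move: uwIy; rewrite !mxE => ->; rewrite addr0.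
rewrite qE.
have u_ge0 : 0 <= (u^T *m w *m (I *m u)) 0 0.
  by have := metric_ge0 u; rewrite -!mulmxA.
have := frame_form a b; rewrite -/y; set c := _ *m (a + _) => yE.
have SH : S *m S = H := SS.
have yE' : (y^T *m w *m (J *m y)) 0 0 = ((S *m c)^T *m (S *m c)) 0 0 +
   ((S *m b)^T *m (S *m b)) 0 0 + t * ((S *m b)^T *m G *m (S *m c)) 0 0.
  by rewrite yE -SH /G !(trmx_mul S) ST !mulmxA.
have [q_ge0 q_eq0] := square_completion (S *m c) (S *m b).
rewrite -yE' in q_ge0 q_eq0.
rewrite lt_def addr_ge0 // andbT paddr_eq0 //; apply/negP => /andP[/eqP y0 /eqP u0].
have {}u0 : u = 0 by apply: metric_eq0; rewrite -!mulmxA in u0 *.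
have [Sc0 Sb0] := q_eq0 y0.
have Hb0 : H *m b = 0 by rewrite -SH -mulmxA Sb0 mulmx0.
have Hc0 : H *m c = 0 by rewrite -SH -mulmxA Sc0 mulmx0.
have Xb0 := gram_kernel Hb0; have Xc0 := gram_kernel Hc0.
have ac : a = c.
  have : (1%:M - C *m H) *m c = a + (t / 2) *: (F *m H *m b).
    by rewrite /c mulKVmx //; exact: unit_subCH.
  by rewrite mulmxBl mul1mx -!mulmxA Hc0 Hb0 !mulmx0 scaler0 addr0 subr0.
have y00 : y = 0 by rewrite /y ac Xc0 -mulmxA Xb0 mulmx0 addr0.
by move/eqP: v0; apply; rewrite vE u0 y00 addr0.
Qed.

End Tamed.

End Kahler.
End PointwiseAlgebra.

(** * Closed coframes and the Nijenhuis tensor *)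

Lemma derive_comp (R : realType) m n (f : 'rV[R]_m -> 'rV[R]_n) (g : 'rV[R]_n -> R) x v :
  differentiable f x -> differentiable g (f x) ->
  'D_v (fun y => g (f y)) x = \sum_l 'D_v (fun y => f y 0 l) x * pd l g (f x).
Proof.
move=> df dg.
have dgf : differentiable (g \o f) x by exact: differentiable_comp.
rewrite (deriveE v dgf) (diff_comp df dg) /= -(deriveE _ dg) (derive_pd _ dg).
apply: eq_bigr => l _; congr (_ * _).
by rewrite -(deriveE v df) derive_mx ?mxE //; exact: diff_derivable.
Qed.

Lemma pd_sum (R : realType) m k j (F : 'I_k -> 'rV[R]_m -> R) x :
  (forall l, differentiable (F l) x) ->
  pd j (fun y => \sum_l F l y) x = \sum_l pd j (F l) x.
Proof.
move=> dF; have -> : (fun y => \sum_l F l y) = \sum_l F l.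
  by apply/funext => y; rewrite fct_sumE.
by rewrite /pd derive_sum // => l; exact: diff_derivable.
Qed.

Lemma pdM (R : realType) m j (f g : 'rV[R]_m -> R) x :
  differentiable f x -> differentiable g x ->
  pd j (fun y => f y * g y) x = f x * pd j g x + g x * pd j f x.
Proof. by move=> df dg; rewrite /pd deriveM //; exact: diff_derivable. Qed.

Lemma pdN (R : realType) m j (f : 'rV[R]_m -> R) x :
  differentiable f x -> pd j (fun y => - f y) x = - pd j f x.
Proof. by move=> df; rewrite /pd deriveN //; exact: diff_derivable. Qed.

Lemma pdB (R : realType) m j (f g : 'rV[R]_m -> R) x :
  differentiable f x -> differentiable g x ->
  pd j (fun y => f y - g y) x = pd j f x - pd j g x.
Proof. by move=> df dg; rewrite /pd deriveB //; exact: diff_derivable. Qed.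

Lemma pd_cst (R : realType) m j (a : R) (x : 'rV[R]_m) : pd j (cst a) x = 0.
Proof. by rewrite /pd derive_cst. Qed.

Lemma pd_mulmx (R : realType) m n k l (A : 'rV[R]_m -> 'M[R]_(n, k))
    (B : 'rV[R]_m -> 'M[R]_(k, l)) x j r s :
  (forall p, differentiable (fun y => A y r p) x) ->
  (forall p, differentiable (fun y => B y p s) x) ->
  pd j (fun y => (A y *m B y) r s) x =
  \sum_p (pd j (fun y => A y r p) x * B x p s + A x r p * pd j (fun y => B y p s) x).
Proof.
move=> dA dB; have -> : (fun y => (A y *m B y) r s) = (fun y => \sum_p A y r p * B y p s).
  by apply/funext => y; rewrite mxE.
rewrite pd_sum; last by move=> p; exact: differentiableM.
by apply: eq_bigr => p _; rewrite pdM // addrC mulrC.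
Qed.

Section Nijenhuis.
Context {R : realType} {m n : nat}.
Implicit Types (A : 'rV[R]_m -> 'M[R]_m) (b g : 'rV[R]_m -> 'M[R]_(n, m)).

Lemma nijenhuis_coord A x i j k :
  nijenhuis A (cst (delta_mx i 0)) (cst (delta_mx j 0)) x k 0 =
  \sum_l (A x l i * pd l (fun y => A y k j) x - A x l j * pd l (fun y => A y k i) x)
  - \sum_p A x k p * (pd i (fun y => A y p j) x - pd j (fun y => A y p i) x).
Proof.
have Acol q r : (fun y => (A y *m delta_mx q 0 : 'cV_m) r 0) = (fun y => A y r q).
  by apply/funext => y; rewrite -colE mxE.
have Acol' y q r : (A y *m delta_mx q 0 : 'cV_m) r 0 = A y r q by rewrite -colE mxE.
have sum_delta (f : 'I_m -> R) q : \sum_l (delta_mx q 0 : 'cV[R]_m) l 0 * f l = f q.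
  rewrite (bigD1 q) //= !mxE !eqxx mul1r big1 ?addr0 // => l lq.
  by rewrite mxE (negPf lq) mul0r.
have c0 q r l : pd l (fun y => (cst (delta_mx q 0 : 'cV[R]_m) y) r 0) x = 0 by exact: pd_cst.
have b1 : lie_bracket (fun y => A y *m cst (delta_mx i 0) y) (cst (delta_mx j 0)) x =
    \col_k - pd j (fun y => A y k i) x.
  apply/colP => q; rewrite /lie_bracket [LHS]mxE [RHS]mxE.
  have <- := sum_delta (fun l => pd l (fun y => A y q i) x) j; rewrite -sumrN; apply: eq_bigr => l _.
  by rewrite c0 mulr0 sub0r Acol.
have b2 : lie_bracket (cst (delta_mx i 0)) (fun y => A y *m cst (delta_mx j 0) y) x =
    \col_k pd i (fun y => A y k j) x.
  apply/colP => q; rewrite /lie_bracket [LHS]mxE [RHS]mxE.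
  have <- := sum_delta (fun l => pd l (fun y => A y q j) x) i.
  by apply: eq_bigr => l _; rewrite c0 mulr0 subr0 Acol.
have b3 : lie_bracket (cst (delta_mx i 0 : 'cV[R]_m)) (cst (delta_mx j 0)) x = 0.
  by apply/colP => q; rewrite /lie_bracket [LHS]mxE [RHS]mxE big1 // => l _; rewrite !c0 !mulr0 subrr.
rewrite /nijenhuis b1 b2 b3 mulmx0 addr0 !mxE; congr (_ - _).
  by apply: eq_bigr => l _; rewrite !Acol !Acol'.
by apply: eq_bigr => l _; rewrite !mxE addrC.
Qed.

(** The matrix of the exterior derivative of the r-th row of 1-forms. *)
Definition curl b (r : 'I_n) x : 'M[R]_m :=
  \matrix_(l, k) (pd l (fun y => b y r k) x - pd k (fun y => b y r l) x).

(** For a form beta with beta A = gamma and gamma A = - beta, differentiating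
    these two identities expresses beta o N_A by the exterior derivatives of
    beta and gamma: when beta is closed, what remains is dgamma (A., .) + dgamma
    (., A.). *)
Lemma nijenhuis_form (A : 'rV[R]_m -> 'M[R]_m) b g x i j r :
  (forall k l, differentiable (fun y => A y k l) x) ->
  (forall k, differentiable (fun y => b y r k) x) ->
  (forall k, differentiable (fun y => g y r k) x) ->
  (\near x, b x *m A x = g x) -> (\near x, g x *m A x = - b x) ->
  curl b r x = 0 ->
  (b x *m nijenhuis A (cst (delta_mx i 0)) (cst (delta_mx j 0)) x) r 0 =
  ((A x)^T *m curl g r x + curl g r x *m A x) i j.
Proof.
move=> dA db dg bA gA b0.
have bs l k : pd l (fun y => b y r k) x = pd k (fun y => b y r l) x.
  apply/eqP; rewrite -subr_eq0; apply/eqP.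
  by have := congr1 (fun B : 'M[R]_m => B l k) b0; rewrite !mxE.
have E1 l s : \sum_k b x r k * pd l (fun y => A y k s) x =
   pd l (fun y => g y r s) x - \sum_k pd l (fun y => b y r k) x * A x k s.
  have -> : pd l (fun y => g y r s) x = pd l (fun y => (b y *m A y) r s) x.
    by apply: pd_near; apply: filterS bA => y ->.
  by rewrite pd_mulmx // big_split /= addrC addrK.
have E2 l s : \sum_k g x r k * pd l (fun y => A y k s) x =
   - pd l (fun y => b y r s) x - \sum_k pd l (fun y => g y r k) x * A x k s.
  have -> : - pd l (fun y => b y r s) x = pd l (fun y => (g y *m A y) r s) x.
    rewrite -pdN //; apply: pd_near; apply: filterS gA => y ->.
    by rewrite mxE.
  by rewrite pd_mulmx // big_split /= addrC addrK.
have gx : b x *m A x = g x := nbhs_singleton bA.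
have -> : (b x *m nijenhuis A (cst (delta_mx i 0)) (cst (delta_mx j 0)) x) r 0 =
  \sum_l (A x l i * \sum_k b x r k * pd l (fun y => A y k j) x
   - A x l j * \sum_k b x r k * pd l (fun y => A y k i) x)
  - (\sum_k g x r k * pd i (fun y => A y k j) x - \sum_k g x r k * pd j (fun y => A y k i) x).
  rewrite mxE; under eq_bigr do rewrite nijenhuis_coord mulrBr !mulr_sumr.
  rewrite big_split /= sumrN; congr (_ - _).
    rewrite exchange_big; apply: eq_bigr => l _.
    rewrite !mulr_sumr -sumrB; apply: eq_bigr => k _; ring.
  rewrite -sumrB exchange_big; apply: eq_bigr => p _.
  rewrite -gx mxE -mulrBr mulr_suml; apply: eq_bigr => k _; ring.
have -> : ((A x)^T *m curl g r x + curl g r x *m A x) i j =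
  \sum_l (A x l i * (pd l (fun y => g y r j) x - pd j (fun y => g y r l) x)) +
  \sum_l (pd i (fun y => g y r l) x - pd l (fun y => g y r i) x) * A x l j.
  by rewrite !mxE; congr (_ + _); apply: eq_bigr => l _; rewrite !mxE.
have bb : \sum_l (A x l i * \sum_k pd l (fun y => b y r k) x * A x k j) =
          \sum_l (A x l j * \sum_k pd l (fun y => b y r k) x * A x k i).
  under eq_bigr do rewrite mulr_sumr.
  rewrite exchange_big; apply: eq_bigr => l _.
  rewrite mulr_sumr; apply: eq_bigr => k _; rewrite bs; ring.
have h1 : \sum_l (A x l i * \sum_k b x r k * pd l (fun y => A y k j) x
   - A x l j * \sum_k b x r k * pd l (fun y => A y k i) x) =
   \sum_l A x l i * pd l (fun y => g y r j) x - \sum_l A x l j * pd l (fun y => g y r i) x.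
  rewrite sumrB; under eq_bigr do rewrite E1 mulrBr.
  under [X in _ - X]eq_bigr do rewrite E1 mulrBr.
  rewrite !sumrB bb opprB; set s1 := \sum_l _; set s2 := \sum_l _; set s3 := \sum_l _.
  ring.
have h2 : \sum_l (A x l i * (pd l (fun y => g y r j) x - pd j (fun y => g y r l) x)) =
  \sum_l A x l i * pd l (fun y => g y r j) x - \sum_l pd j (fun y => g y r l) x * A x l i.
  by rewrite -sumrB; apply: eq_bigr => l _; rewrite mulrBr [X in _ - X]mulrC.
have h3 : \sum_l (pd i (fun y => g y r l) x - pd l (fun y => g y r i) x) * A x l j =
  \sum_l pd i (fun y => g y r l) x * A x l j - \sum_l A x l j * pd l (fun y => g y r i) x.
  by rewrite -sumrB; apply: eq_bigr => l _; rewrite mulrBl [X in _ - X]mulrC.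
rewrite h1 h2 h3 (E2 i j) (E2 j i) (bs i j).
by move: (\sum_l _) (\sum_l _) (\sum_l _) (\sum_l _) (pd j _ _) => s1 s2 s3 s4 s5; ring.
Qed.

Corollary nijenhuis_closed (A : 'rV[R]_m -> 'M[R]_m) b g x i j r :
  (forall k l, differentiable (fun y => A y k l) x) ->
  (forall k, differentiable (fun y => b y r k) x) ->
  (forall k, differentiable (fun y => g y r k) x) ->
  (\near x, b x *m A x = g x) -> (\near x, g x *m A x = - b x) ->
  curl b r x = 0 -> curl g r x = 0 ->
  (b x *m nijenhuis A (cst (delta_mx i 0)) (cst (delta_mx j 0)) x) r 0 = 0.
Proof.
move=> dA db dg bA gA b0 g0.
by rewrite (nijenhuis_form _ _ dA db dg bA gA b0) g0 mulmx0 mul0mx addr0 mxE.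
Qed.

End Nijenhuis.

(** * The data of a toric Kaehler structure in charts *)

Lemma curl_gradient (R : realType) m n (U : set 'rV[R]_m) (f : 'rV[R]_m -> R)
    (b : 'rV[R]_m -> 'M[R]_(n, m)) x r :
  open U -> U x -> smooth_on U f -> (forall k y, U y -> b y r k = pd k f y) ->
  curl b r x = 0.
Proof.
move=> oU Ux sf bf; have nx : nbhs x U by exact: open_nbhs_nbhs.
have e l k : pd l (fun y => b y r k) x = pd l (pd k f) x.
  by apply: pd_near; apply: filterS nx => y Uy; exact: bf.
apply/matrixP => l k; rewrite mxE [RHS]mxE; apply/eqP; rewrite subr_eq0; apply/eqP.
apply: (etrans (e l k)); apply: (etrans _ (esym (e k l))).
exact: schwarz oU Ux sf.
Qed.

Lemma smooth_mx_in_chart (R : realType) m (M : manifold R m) k l (A : tensor M k l) c :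
  atlas c -> smooth_field setT A -> smooth_mx (U := cod c) (in_chart A c).
Proof.
by move=> ac sA i j; have := sA c ac i j; rewrite coord_image_setT.
Qed.

Section ToricCharts.
Context {R : realType} {n : nat} {M : toric R n}.
Implicit Types (c : chart R (2 * n) M) (p : M).

Lemma dim_double : (2 * n = n + n)%N.
Proof. by rewrite mul2n addnn. Qed.

Definition open_chart c : set 'rV[R]_(2 * n) :=
  [set x | cod c x /\ open_part (param c x)].

Lemma continuous_mu c x : atlas c -> cod c x -> {for x, continuous (mu M \o param c)}.
Proof.
move=> ac cx; apply: differentiable_continuous; apply: differentiable_rV => i.
exact: (@smooth_mu _ _ _ _ ac i [::] _ cx).
Qed.

Lemma open_open_chart c : atlas c -> open (open_chart c).
Proof.
move=> ac; rewrite openE => x [cx ox]; apply: filterI; first exact: nbhs_cod.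
apply: (continuous_mu ac cx); apply: open_nbhs_nbhs; split => //.
exact: open_interior.
Qed.

Lemma smooth_dense_eq c k l (A B : 'rV[R]_(2 * n) -> 'M[R]_(k, l)) :
  atlas c -> smooth_mx (U := cod c) A -> smooth_mx (U := cod c) B ->
  {in open_chart c, A =1 B} -> {in cod c, A =1 B}.
Proof.
move=> ac sA sB AB x; rewrite inE => cx; apply/matrixP => i j.
apply: (@dense_chart_eq R _ M c (@open_part R n M) R (fun y => A y i j)
  (fun y => B y i j)) => //.
- exact: open_part_dense.
- exact: differentiable_continuous (sA i j [::] x cx).
- exact: differentiable_continuous (sB i j [::] x cx).
- by move=> y cy oy; rewrite AB // inE.
Qed.

Lemma smooth_Omega c : atlas c -> smooth_mx (U := cod c) (in_chart (Omega M) c).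
Proof. by move=> ac; apply: smooth_mx_in_chart => //; have [] := Omega_symplectic M. Qed.

Lemma dmu_chartE c x i k : atlas c -> cod c x ->
  in_chart (dmu M) c x i k = pd k (fun y => mu M (param c y) 0 i) x.
Proof.
move=> ac cx; rewrite /in_chart /dmu /differential paramK //.
apply: (etrans (jacE _ _ _)) => //.
by apply: differentiable_rV => j; exact: (@smooth_mu _ _ _ _ ac j [::] _ cx).
Qed.

Lemma smooth_dmu c : atlas c -> smooth_mx (U := cod c) (in_chart (dmu M) c).
Proof.
move=> ac i k.
apply: (smooth_ext (f := pd k (fun y => mu M (param c y) 0 i))).
- exact: open_cod.
- by move=> x; rewrite inE => cx; rewrite dmu_chartE.
- exact: smooth_on_pd (smooth_mu ac i).
Qed.

(** The moment map equation solved for the fundamental fields, from which they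
    inherit the smoothness of Omega and dmu. *)
Lemma fundamentalE_Omega c p : around c p ->
  fundamental (act M) c p = - (dmu M c p *m invmx (Omega M c p))^T.
Proof.
move=> cp; apply: trmx_inj; rewrite linearN /= trmxK -mulNmx -fundamental_Omega //.
by rewrite mulmxK //; exact: Omega_unit.
Qed.

Lemma smooth_fundamental c : atlas c ->
  smooth_mx (U := cod c) (in_chart (fundamental (act M)) c).
Proof.
move=> ac; have oc := open_cod ac.
apply: (smooth_mx_ext oc (A := fun x => - (in_chart (dmu M) c x *m
    invmx (in_chart (Omega M) c x))^T)) => //.
  by move=> x; rewrite inE => cx; rewrite /in_chart -fundamentalE_Omega //; exact: around_param.
apply: (smooth_mxN oc) => //; apply: (smooth_mxT oc) => //; apply: (smooth_mxM oc) => //.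
  exact: smooth_dmu.
apply: (smooth_mx_inv oc) => //; last exact: smooth_Omega.
by move=> x cx; apply: Omega_unit; exact: around_param.
Qed.

Lemma curl_dmu c x r : atlas c -> cod c x -> curl (in_chart (dmu M) c) r x = 0.
Proof.
move=> ac cx; have nx := nbhs_cod ac cx.
apply: (@curl_gradient _ _ _ (cod c) (fun y => mu M (param c y) 0 r)) => //.
- exact: open_cod.
- exact: smooth_mu ac r.
- by move=> k y cy; rewrite dmu_chartE.
Qed.

End ToricCharts.

Section ToricKahler.
Context {R : realType} {n : nat} {M : toric R n}.
Variables (I0 : tensor M (2 * n) (2 * n)) (zeta vartheta : tensor M n (2 * n)).
Variable (tau : 'rV[R]_n -> R).
Hypotheses (kI0 : toric_kahler I0) (cI0 : dual_coframe I0 zeta vartheta).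
Hypothesis (pI0 : symplectic_potential I0 zeta tau).
Implicit Types (c : chart R (2 * n) M) (p : M).
Notation X := (fundamental (act M)).
Notation w := (Omega M).
Notation d := (dmu M).
Notation P p := (hessian tau (mu M p)).

Lemma I0_sqr c p : around c p -> I0 c p *m I0 c p = - 1%:M.
Proof. by have [[_ II _] _ _ _] := kI0 => cp; exact: II. Qed.

Lemma I0_compat c p : around c p -> (I0 c p)^T *m w c p *m I0 c p = w c p.
Proof. by have [_ _ _ h] := kI0 => cp; exact: h. Qed.

Lemma I0_pos c p : around c p -> forall v : 'cV[R]_(2 * n), v != 0 ->
  0 < (v^T *m w c p *m (I0 c p *m v)) 0 0.
Proof. by have [_ _ h _] := kI0 => cp; exact: h. Qed.

Lemma smooth_I0 c : atlas c -> smooth_mx (U := cod c) (in_chart I0 c).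
Proof. by have [[[sI _] _ _] _ _ _] := kI0 => ac; exact: smooth_mx_in_chart. Qed.

Lemma zeta_I0 c p : around c p -> open_part p -> zeta c p *m I0 c p = P p *m d c p.
Proof. by have [_ _ h] := pI0; exact: h. Qed.

Lemma dmuX_open c p : around c p -> open_part p -> d c p *m X c p = 0.
Proof.
move=> cp op; have [zX zIX _ _] := cI0 cp op.
have uP := hessian_gram (I0_sqr cp) zX (zeta_I0 cp op).
rewrite -[LHS]mul1mx -(mulmx1C uP) -mulmxA (mulmxA (P p)) -(zeta_I0 cp op).
by rewrite -(mulmxA (zeta c p)) zIX mulmx0.
Qed.

(** The orbits are isotropic: over the interior zeta I = P dmu and zeta (I X) =
    0, and density gives the rest. *)
Lemma dmuX c p : around c p -> d c p *m X c p = 0.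
Proof.
move=> cp; have ac := cp.1; have oc := open_cod ac.
have := @smooth_dense_eq R n M c _ _ (fun x => in_chart d c x *m in_chart X c x)
  (fun=> 0) ac.
move=> /(_ _ _ _ (coord c p)); rewrite /in_chart coordK //; apply.
- by apply: (smooth_mxM oc) => //; [exact: smooth_dmu|exact: smooth_fundamental].
- exact: (smooth_mx_cst oc).
- by move=> x; rewrite inE => -[cx ox]; apply: dmuX_open => //; exact: around_param.
- by rewrite inE; exact: cod_coord.
Qed.

Definition orbit_gram c p := gram (d c p) (I0 c p) (X c p).

Lemma smooth_orbit_gram c : atlas c -> smooth_mx (U := cod c) (in_chart orbit_gram c).
Proof.
move=> ac; have oc := open_cod ac.
apply: (smooth_mx_ext oc (A := fun x => - (in_chart d c x *m in_chart I0 c x *m in_chart X c x))) => //.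
  by move=> x _; rewrite /in_chart /orbit_gram gramN.
apply: (smooth_mxN oc) => //; apply: (smooth_mxM oc) => //; last exact: smooth_fundamental.
by apply: (smooth_mxM oc) => //; [exact: smooth_dmu|exact: smooth_I0].
Qed.

(** The extension of J_+^t to the whole manifold. *)
Definition Jext C F t : tensor M (2 * n) (2 * n) := fun c p =>
  Jmx C F t (X c p) (I0 c p) (d c p).

Lemma smooth_J C F t c : antisym C -> atlas c -> smooth_mx (U := cod c) (in_chart (Jext C F t) c).
Proof.
move=> Ca ac; have oc := open_cod ac.
have sX := smooth_fundamental ac; have sd := smooth_dmu ac; have sI := smooth_I0 ac.
have sH : smooth_mx (U := cod c) (fun x => gram (in_chart d c x) (in_chart I0 c x) (in_chart X c x)).
  exact: smooth_orbit_gram.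
have s1 : smooth_mx (U := cod c) (fun=> 1%:M : 'M[R]_n) by exact: (smooth_mx_cst oc).
have sC : smooth_mx (U := cod c) (fun=> C) by exact: (smooth_mx_cst oc).
have sF : smooth_mx (U := cod c) (fun=> F) by exact: (smooth_mx_cst oc).
have uK x : cod c x -> 1%:M - C *m gram (in_chart d c x) (in_chart I0 c x) (in_chart X c x) \in unitmx.
  move=> cx; have cp := around_param ac cx.
  exact: (unit_subCH (fundamental_Omega cp) (I0_pos cp) Ca).
have uL x : cod c x -> 1%:M - gram (in_chart d c x) (in_chart I0 c x) (in_chart X c x) *m C \in unitmx.
  move=> cx; have cp := around_param ac cx.
  exact: (unit_subHC (I0_sqr cp) (I0_compat cp) (Omega_antisym cp) (fundamental_Omega cp) (I0_pos cp) Ca).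
have sK := smooth_mx_inv oc uK (smooth_mxB oc s1 (smooth_mxM oc sC sH)).
have sL := smooth_mx_inv oc uL (smooth_mxB oc s1 (smooth_mxM oc sH sC)).
have sdI := smooth_mxM oc sd sI.
have sD := smooth_mxM oc sL (smooth_mxD oc sdI
  (smooth_mxZ oc (t / 2) (smooth_mxM oc (smooth_mxM oc sH sF) sd))).
have sE := smooth_mxD oc (smooth_mxM oc (smooth_mxM oc sC sd) sI)
  (smooth_mxZ oc (t / 2) (smooth_mxM oc sF sd)).
have sXF := smooth_mxM oc sX sF.
exact: (smooth_mxB oc (smooth_mxD oc (smooth_mxB oc sI (smooth_mxM oc (smooth_mxM oc sX sC) sd))
  (smooth_mxZ oc (t / 2) (smooth_mxM oc sXF sD)))
  (smooth_mxM oc (smooth_mxM oc (smooth_mxM oc sI sX) sK) sE)).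
Qed.

Lemma gram_hess c p : around c p -> open_part p -> orbit_gram c p *m P p = 1%:M.
Proof.
move=> cp op; have [zX _ _ _] := cI0 cp op.
exact: (gram_hessian (I0_sqr cp) zX (zeta_I0 cp op)).
Qed.

Lemma hess_sym c p : around c p -> open_part p -> (P p)^T = P p.
Proof.
move=> cp op; have [zX _ _ _] := cI0 cp op.
exact: (hessian_sym (I0_sqr cp) (I0_compat cp) (Omega_antisym cp)
  (fundamental_Omega cp) zX (zeta_I0 cp op)).
Qed.

Lemma hessE c p : around c p -> open_part p -> P p = invmx (orbit_gram c p).
Proof.
move=> cp op; have HP := gram_hess cp op.
have uH : orbit_gram c p \in unitmx by have /mulmx1_unit[] := HP.
by rewrite -[LHS]mul1mx -(mulVmx uH) -mulmxA HP mulmx1.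
Qed.

Lemma zetaE c p : around c p -> open_part p ->
  zeta c p = - (P p *m d c p *m I0 c p).
Proof.
move=> cp op; rewrite -(zeta_I0 cp op) -mulmxA I0_sqr // mulmxN mulmx1.
by rewrite opprK.
Qed.

Lemma smooth_open_chart c k l (A : 'rV[R]_(2 * n) -> 'M[R]_(k, l)) :
  smooth_mx (U := cod c) A -> smooth_mx (U := open_chart c) A.
Proof. by move=> sA i j s x [cx _]; exact: sA. Qed.

Definition hess_chart c : 'rV[R]_(2 * n) -> 'M[R]_n := fun x => P (param c x).

Lemma smooth_hess c : atlas c -> smooth_mx (U := open_chart c) (hess_chart c).
Proof.
move=> ac; have oc := open_open_chart ac.
apply: (smooth_mx_ext oc (A := fun x => invmx (in_chart orbit_gram c x))).
  by move=> x; rewrite inE => -[cx ox]; rewrite /hess_chart (hessE (around_param ac cx)).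
apply: (smooth_mx_inv oc); last by apply: smooth_open_chart; exact: smooth_orbit_gram.
move=> x [cx ox]; have := gram_hess (around_param ac cx) ox.
by move=> /mulmx1_unit[].
Qed.

Lemma smooth_hess_dmu c : atlas c ->
  smooth_mx (U := open_chart c) (fun x => hess_chart c x *m in_chart d c x).
Proof.
move=> ac; apply: (smooth_mxM (open_open_chart ac)); first exact: smooth_hess.
by apply: smooth_open_chart; exact: smooth_dmu.
Qed.

Lemma smooth_zeta c : atlas c -> smooth_mx (U := open_chart c) (in_chart zeta c).
Proof.
move=> ac; have oc := open_open_chart ac.
apply: (smooth_mx_ext oc (A := fun x => - (hess_chart c x *m in_chart d c x *m in_chart I0 c x))).
  by move=> x; rewrite inE => -[cx ox]; rewrite [in RHS]/in_chart (zetaE (around_param ac cx)).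
apply: (smooth_mxN oc); apply: (smooth_mxM oc); first exact: smooth_hess_dmu.
by apply: smooth_open_chart; exact: smooth_I0.
Qed.

Lemma differentiable_grad_tau c x i : atlas c -> open_chart c x ->
  differentiable (fun y => pd i tau (mu M (param c y))) x.
Proof.
move=> ac [cx ox]; have [st _ _] := pI0.
apply: (@differentiable_comp _ _ _ _ (mu M \o param c) (pd i tau)).
  by apply: differentiable_rV => j; exact: (@smooth_mu _ _ _ _ ac j [::] _ cx).
exact: (st [:: i]).
Qed.

(** The components of phi_s dmu are the differentials of the functions (d tau /
    d mu_i) o mu, hence closed. *)
Lemma pd_grad_tau c x i k : atlas c -> open_chart c x ->
  pd k (fun y => pd i tau (mu M (param c y))) x =
  (hess_chart c x *m in_chart d c x) i k.
Proof.
move=> ac [cx ox]; have cp := around_param ac cx; have [st _ _] := pI0.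
have dm : differentiable (mu M \o param c) x.
  by apply: differentiable_rV => j; exact: (@smooth_mu _ _ _ _ ac j [::] _ cx).
have dt : differentiable (pd i tau) ((mu M \o param c) x) by exact: (st [:: i]).
apply: (etrans (derive_comp (delta_mx 0 k) dm dt)).
rewrite mxE; apply: eq_bigr => l _.
rewrite dmu_chartE // mulrC; congr (_ * _).
by rewrite /hess_chart -(hess_sym cp ox) !mxE.
Qed.

Lemma curl_hess_dmu c x r : atlas c -> open_chart c x ->
  curl (fun y => hess_chart c y *m in_chart d c y) r x = 0.
Proof.
move=> ac ox; have oc := open_open_chart ac.
apply: (curl_gradient (f := fun y => pd r tau (mu M (param c y))) oc ox).
  (* The first partial derivatives of grad tau o mu are the entries of phi_s dmu,
     whose smoothness is known. *)
  apply/smooth_onP; split => [y oy|k].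
    exact: differentiable_grad_tau.
  apply: (smooth_ext oc _ (smooth_hess_dmu ac r k)) => y; rewrite inE => oy.
  by rewrite pd_grad_tau.
by move=> k y oy; rewrite pd_grad_tau.
Qed.

Lemma I0_act c c' p a : around c p -> around c' (act M a p) ->
  tangent (act M a) c c' p *m I0 c p = I0 c' (act M a p) *m tangent (act M a) c c' p.
Proof. by have [_ h _ _] := kI0 => cp cap; exact: h. Qed.

(** zeta = - phi_s dmu I_0 expresses zeta by invariant objects. *)
Lemma zeta_act c c' p a : around c p -> around c' (act M a p) -> open_part p ->
  zeta c p = zeta c' (act M a p) *m tangent (act M a) c c' p.
Proof.
move=> cp cap op; have oap : open_part (act M a p) by rewrite /open_part /= mu_act.
apply: (etrans (zetaE cp op)).
have dT : P p *m d c p *m I0 c p =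
    P p *m (d c' (act M a p) *m tangent (act M a) c c' p) *m I0 c p.
  by congr (_ *m _ *m _); exact: dmu_act.
have IT : tangent (act M a) c c' p *m I0 c p = _ := I0_act cp cap.
have zE : zeta c' (act M a p) = _ := zetaE cap oap.
by rewrite dT zE mu_act mulNmx -!mulmxA IT.
Qed.

End ToricKahler.

(** * Invariant 1-forms *)

Lemma derive_near_cst (R : realType) (V : normedModType R) (g : V -> R) (x v : V) :
  (\forall h \near (0 : R), g (h *: v + x) = g x) -> 'D_v g x = 0.
Proof.
move=> gc; rewrite /derive; apply: cvg_lim => //.
apply: cvg_near_cst; apply: cvg_within; apply: filterS gc => h /= ->.
by rewrite subrr scaler0.
Qed.

Lemma near_preimage (T S : topologicalType) (f : T -> S) (x : T) (P : set S) :
  {for x, continuous f} -> nbhs (f x) P -> nbhs x [set y | P (f y)].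
Proof. by move=> fc; exact: fc. Qed.

Section LieDerivative.
Context {R : realType} {n m : nat} {M : manifold R m} {act : 'rV[R]_n -> M -> M}.
Hypothesis sact : smooth_action act.
Implicit Types (c : chart R m M) (p : M).

Lemma tangent_flow c c' p a l k : around c p -> around c' (act a p) ->
  tangent (act a) c c' p l k =
  pd (rshift n k) (fun z => flow (act := act) c c' z 0 l) (row_mx a (coord c p)).
Proof.
move=> cp cap; rewrite /tangent.
apply: (etrans (jacE l k (differentiable_act sact cp cap))).
have fE : (fun y => flow (act := act) c c' (row_mx a y) 0 l) =
    (fun y => (coord c' \o act a \o param c) y 0 l).
  by apply/funext => y; rewrite flowE.
by rewrite -pd_slice fE.
Qed.

Lemma pd_flow0 c x l k : atlas c -> cod c x ->
  pd (rshift n k) (fun z => flow (act := act) c c z 0 l) (row_mx 0 x) = (l == k)%:R.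
Proof.
move=> ac cx; rewrite -pd_slice -(pd_coord x); apply: pd_near.
apply: filterS (nbhs_cod ac cx) => y cy.
by rewrite flowE act0 // paramK.
Qed.

(** The left side is the Lie derivative of b along the j-th fundamental field.
    Pulling b back by the flow gives a form g that is constant in time; in its
    time derivative, the symmetry of second derivatives turns the time
    derivative of the tangent map into the space derivative of the fundamental
    field. *)
Lemma lie_derivative_invariant c x (q : nat) (b : 'rV[R]_m -> 'M[R]_(q, m))
    (U : set 'rV[R]_m) r j k :
  atlas c -> open U -> U `<=` cod c -> U x -> smooth_mx (U := U) b ->
  (\forall a \near (0 : 'rV[R]_n), around c (act a (param c x)) /\
     b x = b (coord c (act a (param c x))) *m tangent (act a) c c (param c x)) ->
  \sum_l (in_chart (fundamental act) c x l j * pd l (fun y => b y r k) x) +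
  \sum_l b x r l * pd k (fun y => in_chart (fundamental act) c y l j) x = 0.
Proof.
move=> ac oU Uc Ux sb inv; have cx := Uc _ Ux; have cp := around_param ac cx.
pose z0 : 'rV[R]_(n + m) := row_mx 0 x.
pose G l z := flow (act := act) c c z 0 l.
pose W := flow_dom (act := act) c c.
have oW : open W by exact: open_flow_dom.
have Wz y : cod c y -> W (row_mx 0 y).
  by move=> cy; rewrite /W flow_domE act0 //; split=> //; exact: (around_param ac cy).2.
have sG l : smooth_on W (G l) by exact: smooth_flow.
have fz0 : flow (act := act) c c z0 = x by rewrite flowE act0 // paramK.
pose g z := \sum_l b (flow (act := act) c c z) r l * pd (rshift n k) (G l) z.
have gc : \forall h \near (0 : R), g (h *: delta_mx 0 (lshift m j) + z0) = g z0.
  have hl h : h *: delta_mx 0 (lshift m j) + z0 = row_mx (h *: delta_mx 0 j) x.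
    by rewrite delta_lshift scale_row_mx add_row_mx scaler0 add0r addr0.
  have gE a : around c (act a (param c x)) ->
     b x = b (coord c (act a (param c x))) *m tangent (act a) c c (param c x) ->
     g (row_mx a x) = b x r k.
    move=> cap bE; rewrite bE mxE /g; apply: eq_bigr => l _.
    by rewrite (tangent_flow _ _ cp cap) flowE paramK.
  have g0 : g z0 = b x r k.
    by have [ca be] := nbhs_singleton inv; exact: gE.
  have hc : {for (0 : R), continuous (fun h : R => h *: (delta_mx 0 j : 'rV[R]_n))}.
    exact: scalel_continuous.
  pose Q : set 'rV[R]_n := [set a | around c (act a (param c x)) /\
      b x = b (coord c (act a (param c x))) *m tangent (act a) c c (param c x)].
  have nQ : nbhs (0 *: (delta_mx 0 j : 'rV[R]_n)) Q by rewrite scale0r; exact: inv.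
  have QP h : Q (h *: delta_mx 0 j) -> g (h *: delta_mx 0 (lshift m j) + z0) = g z0.
    by move=> [ca be]; rewrite hl g0; exact: gE.
  have nh := near_preimage hc nQ.
  by apply: filterS nh.
have dflow : differentiable (flow (act := act) c c) z0.
  by apply: differentiable_rV => l; exact: (sG l [::] _ (Wz x cx)).
have db l : differentiable (fun y => b y r l) x by exact: (sb r l [::]).
have db' l : differentiable (fun y => b y r l) (flow (act := act) c c z0) by rewrite fz0.
have dbf l : differentiable (fun z => b (flow (act := act) c c z) r l) z0.
  exact: (@differentiable_comp _ _ _ _ (flow c c) (fun y => b y r l)).
have dpG l : differentiable (pd (rshift n k) (G l)) z0 by exact: (sG l [:: _] _ (Wz x cx)).
have pdg : pd (lshift m j) g z0 = 0 by rewrite /pd; exact: derive_near_cst.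
have XE y l : cod c y ->
    in_chart (fundamental act) c y l j = pd (lshift m j) (G l) (row_mx 0 y).
  move=> cy; rewrite /in_chart (fundamentalE l j (around_param ac cy)).
  by rewrite paramK.
have pE l : pd (lshift m j) (fun z => b (flow (act := act) c c z) r l) z0 =
    \sum_i in_chart (fundamental act) c x i j * pd i (fun y => b y r l) x.
  apply: (etrans (derive_comp (delta_mx 0 (lshift m j)) dflow (db' l))).
  rewrite fz0; apply: eq_bigr => i _; congr (_ * _).
  by rewrite XE.
have ppE l : pd (lshift m j) (pd (rshift n k) (G l)) z0 =
    pd k (fun y => in_chart (fundamental act) c y l j) x.
  apply: (etrans (schwarz _ _ oW (Wz x cx) (sG l))); rewrite -pd_slice.
  apply: pd_near; apply: filterS (nbhs_cod ac cx) => y cy.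
  by rewrite XE.
have pG l : pd (rshift n k) (G l) z0 = (l == k)%:R by exact: pd_flow0.
rewrite -[RHS]pdg /g pd_sum; last by move=> l; exact: differentiableM.
have -> : \sum_l in_chart (fundamental act) c x l j * pd l (fun y => b y r k) x =
   \sum_l pd (rshift n k) (G l) z0 * pd (lshift m j) (fun z => b (flow (act := act) c c z) r l) z0.
  under [RHS]eq_bigr do rewrite pG.
  rewrite [RHS](bigD1 k) //= eqxx mul1r pE [X in _ + X]big1 ?addr0 // => l lk.
  by rewrite (negPf lk) mul0r.
rewrite -big_split; apply: eq_bigr => l _ /=.
by rewrite (pdM _ (dbf l) (dpG l)) ppE fz0 addrC.
Qed.

End LieDerivative.

(** * The flat connection is closed *)

Section Curl.
Context {R : realType} {m n : nat}.
Implicit Types (b g : 'rV[R]_m -> 'M[R]_(n, m)).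

Lemma curlB b g r x :
  (forall k, differentiable (fun y => b y r k) x) ->
  (forall k, differentiable (fun y => g y r k) x) ->
  curl (fun y => b y - g y) r x = curl b r x - curl g r x.
Proof.
move=> db dg.
have e l k : pd l (fun y => (b y - g y) r k) x =
    pd l (fun y => b y r k) x - pd l (fun y => g y r k) x.
  rewrite -pdB //; congr (pd l _ x); apply/funext => y; by rewrite !mxE.
apply/matrixP => l k; rewrite [LHS]mxE e e !mxE.
by move: (pd l _ x) (pd k _ x) (pd l _ x) (pd k _ x) => *; ring.
Qed.

Lemma curlN b r x : (forall k, differentiable (fun y => b y r k) x) ->
  curl (fun y => - b y) r x = - curl b r x.
Proof.
move=> db.
have e l k : pd l (fun y => (- b y) r k) x = - pd l (fun y => b y r k) x.
  rewrite -pdN //; congr (pd l _ x); apply/funext => y; by rewrite !mxE.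
apply/matrixP => l k; rewrite [LHS]mxE e e !mxE.
by move: (pd l _ x) (pd k _ x) => *; ring.
Qed.

Lemma curl_cst_mulmx b (F : 'M[R]_n) r x :
  (forall s k, differentiable (fun y => b y s k) x) ->
  (forall s, curl b s x = 0) -> curl (fun y => F *m b y) r x = 0.
Proof.
move=> db b0.
have bs s l k : pd l (fun y => b y s k) x = pd k (fun y => b y s l) x.
  apply/eqP; rewrite -subr_eq0; apply/eqP.
  by have := congr1 (fun B : 'M[R]_m => B l k) (b0 s); rewrite !mxE.
have e l k : pd l (fun y => (F *m b y) r k) x = \sum_s F r s * pd l (fun y => b y s k) x.
  rewrite (pd_mulmx (A := fun=> F)) //; apply: eq_bigr => s _.
  by rewrite [pd l _ x](pd_cst l (F r s) x) mul0r add0r.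
apply/matrixP => l k; rewrite [LHS]mxE e e [RHS]mxE -sumrB big1 // => s _.
by rewrite bs subrr.
Qed.

Lemma nijenhuis_near (A B : 'rV[R]_m -> 'M[R]_m) i j x :
  (\near x, A x = B x) ->
  nijenhuis A (cst (delta_mx i 0)) (cst (delta_mx j 0)) x =
  nijenhuis B (cst (delta_mx i 0)) (cst (delta_mx j 0)) x.
Proof.
move=> AB; have AxB : A x = B x := nbhs_singleton AB.
have e l p q : pd l (fun y => A y p q) x = pd l (fun y => B y p q) x.
  by apply: pd_near; apply: filterS AB => y ->.
apply/colP => k; rewrite !nijenhuis_coord AxB.
by congr (_ - _); apply: eq_bigr => l _; rewrite !e.
Qed.

Lemma smooth_nijenhuis (U : set 'rV[R]_m) (A : 'rV[R]_m -> 'M[R]_m) i j :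
  open U -> smooth_mx (U := U) A ->
  smooth_mx (U := U) (nijenhuis A (cst (delta_mx i 0)) (cst (delta_mx j 0))).
Proof.
move=> oU sA k z; rewrite [z]ord1.
apply: (smooth_ext (f := fun x =>
  \sum_l (A x l i * pd l (fun y => A y k j) x - A x l j * pd l (fun y => A y k i) x)
  - \sum_p A x k p * (pd i (fun y => A y p j) x - pd j (fun y => A y p i) x)) oU).
  by move=> x _; rewrite nijenhuis_coord.
apply: (smooth_onD oU); last apply: (smooth_onN oU).
  apply: (smooth_on_sum oU) => l _; apply: (smooth_onD oU); last apply: (smooth_onN oU).
    by apply: (smooth_onM oU) => //; apply: smooth_on_pd.
  by apply: (smooth_onM oU) => //; apply: smooth_on_pd.
apply: (smooth_on_sum oU) => p _; apply: (smooth_onM oU) => //.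
apply: (smooth_onD oU); last apply: (smooth_onN oU); exact: smooth_on_pd.
Qed.

End Curl.

Section Integrability.
Context {R : realType} {n : nat} {M : toric R n}.
Variables (I0 : tensor M (2 * n) (2 * n)) (zeta vartheta : tensor M n (2 * n)).
Variable (tau : 'rV[R]_n -> R).
Hypotheses (kI0 : toric_kahler I0) (cI0 : dual_coframe I0 zeta vartheta).
Hypothesis (pI0 : symplectic_potential I0 zeta tau).
Implicit Types (c : chart R (2 * n) M) (p : M).
Notation X := (fundamental (act M)).
Notation w := (Omega M).
Notation d := (dmu M).
Notation P p := (hessian tau (mu M p)).

Lemma near_open_chart c x : atlas c -> open_chart c x -> nbhs x (open_chart c).
Proof. by move=> ac ox; apply: open_nbhs_nbhs; split => //; exact: open_open_chart. Qed.

(** Cartan's formula: the Lie derivative of zeta along X_j vanishes by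
    invariance, and zeta (X_j) is constant, so the contraction of dzeta with X_j
    vanishes. *)
Lemma fundamental_curl_zeta c x r : atlas c -> open_chart c x ->
  (in_chart X c x)^T *m curl (in_chart zeta c) r x = 0.
Proof.
move=> ac ox; have [cx opx] := ox; have cp := around_param ac cx.
have oV := open_open_chart ac; have nV := near_open_chart ac ox.
have sz := smooth_zeta kI0 cI0 pI0 ac.
have sX := smooth_open_chart (smooth_fundamental (M := M) ac).
have sact := toric_smooth_action (M := M).
have inv : \forall a \near (0 : 'rV[R]_n), around c (act M a (param c x)) /\
     in_chart zeta c x = in_chart zeta c (coord c (act M a (param c x))) *m
       tangent (act M a) c c (param c x).
  have oc : {for (0 : 'rV[R]_n), continuous ((act M)^~ (param c x))} by exact: continuous_orbit.
  have nd : nbhs (0 : 'rV[R]_n) [set a | dom c (act M a (param c x))].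
    by apply: oc; rewrite act0 //; exact: nbhs_dom.
  apply: filterS nd => a da; have ca : around c (act M a (param c x)) by split.
  split=> //.
  have zT := zeta_act kI0 pI0 cp ca opx.
  rewrite /in_chart coordK //; exact: zT.
have Uc : open_chart c `<=` cod c by move=> y [].
apply/matrixP => j k; rewrite mxE [RHS]mxE.
have lie := lie_derivative_invariant sact r j k ac oV Uc ox sz inv.
have cst : \sum_l (pd k (fun y => in_chart zeta c y r l) x * in_chart X c x l j +
    in_chart zeta c x r l * pd k (fun y => in_chart X c y l j) x) = 0.
  rewrite -(pd_mulmx (A := in_chart zeta c) (B := in_chart X c)).
  - rewrite -[RHS](pd_cst k ((1%:M : 'M[R]_n) r j) x); apply: pd_near.
    apply: filterS nV => y [cy oy]; have [zX _ _ _] := cI0 (around_param ac cy) oy.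
    by rewrite /in_chart zX.
  - by move=> l; exact: (sz r l [::] x ox).
  - by move=> l; exact: (sX l j [::] x ox).
move: lie; rewrite -[RHS]cst big_split /= => /addIr lie.
under eq_bigr do rewrite [X in X * _]mxE [X in _ * X]mxE mulrBr.
rewrite sumrB lie; apply/eqP; rewrite subr_eq0; apply/eqP.
by apply: eq_bigr => l _; rewrite mulrC.
Qed.

(** Apply nijenhuis_form to beta = phi_s dmu, which is closed, and gamma = -
    zeta: as I_0 is integrable, dzeta (I_0., .) + dzeta (., I_0.) = 0. The
    contraction of dzeta with X vanishes, hence so does the one with I_0 X, and
    the two span the tangent space. *)
Lemma curl_zeta c x r : atlas c -> open_chart c x -> curl (in_chart zeta c) r x = 0.
Proof.
move=> ac ox; have [cx opx] := ox; have cp := around_param ac cx.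
have oV := open_open_chart ac; have nV := near_open_chart ac ox.
have sz := smooth_zeta kI0 cI0 pI0 ac.
have sb := smooth_hess_dmu kI0 cI0 pI0 ac.
have sI := smooth_open_chart (smooth_I0 kI0 ac).
set Z := curl _ _ _.
have dz k : differentiable (fun y => in_chart zeta c y r k) x by exact: (sz r k [::] x ox).
have IZ : (in_chart I0 c x)^T *m Z + Z *m in_chart I0 c x = 0.
  apply/matrixP => i j.
  have := @nijenhuis_form R _ _ (in_chart I0 c)
    (fun y => hess_chart tau c y *m in_chart d c y) (fun y => - in_chart zeta c y) x i j r.
  rewrite (curlN dz) mulmxN mulNmx -opprD.
  have [[_ _ N0] _ _ _] := kI0.
  have := N0 c (param c x) cp I i j; rewrite paramK // => ->.
  rewrite mulmx0 mxE => h; apply: oppr_inj; rewrite [in RHS]mxE oppr0 [RHS]h ?mxE //.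
  - by move=> k l; exact: (sI k l [::] x ox).
  - by move=> k; exact: (sb r k [::] x ox).
  - by move=> k; rewrite (_ : (fun y => _) = - (fun y => in_chart zeta c y r k));
      [exact: differentiableN|apply/funext => y; rewrite !mxE].
  - apply: filterS nV => y [cy oy]; have cq := around_param ac cy.
    rewrite /hess_chart /in_chart -(zeta_I0 pI0 cq oy) -mulmxA (I0_sqr kI0 cq).
    by rewrite mulmxN mulmx1.
  - apply: filterS nV => y [cy oy]; have cq := around_param ac cy.
    by rewrite mulNmx /in_chart (zeta_I0 pI0 cq oy).
  - exact: (curl_hess_dmu kI0 cI0 pI0 _ ac ox).
have XZ : (in_chart X c x)^T *m Z = 0 := fundamental_curl_zeta r ac ox.
have [zX zIX vX vIX] := cI0 cp opx.
have res := coframe_resolution dim_double zX zIX vX vIX.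
rewrite -[LHS]mul1mx -trmx1 -res linearD /= !trmx_mul mulmxDl -!mulmxA XZ.
have -> : (I0 c (param c x))^T *m Z = - (Z *m I0 c (param c x)).
  by apply/eqP; rewrite -addr_eq0; apply/eqP.
by rewrite mulmxN (mulmxA _ Z) XZ mul0mx oppr0 !mulmx0 addr0.
Qed.

End Integrability.

(** * The extension over the whole manifold *)

Lemma complex_structure_ext (R : realType) m (M : manifold R m) (A B : tensor M m m) :
  (forall c p, around c p -> A c p = B c p) ->
  complex_structure setT A -> complex_structure setT B.
Proof.
move=> AB [[sA iA] sqA nA].
have ABc c : atlas c -> {in cod c, in_chart A c =1 in_chart B c}.
  by move=> ac x; rewrite inE => cx; rewrite /in_chart AB //; exact: around_param.
split; first split.
- move=> c ac i j; rewrite coord_image_setT.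
  have := smooth_mx_in_chart ac sA i j; apply: smooth_ext; first exact: open_cod.
  by move=> x xc; rewrite ABc.
- move=> c c' p Up cp cp'; have := iA c c' p Up cp cp'.
  by rewrite (AB c p) // (AB c' _).
- by move=> c p cp _; rewrite -AB //; exact: sqA.
- move=> c p cp _ i j; rewrite -(nA c p cp I i j); apply: nijenhuis_near.
  apply: filterS (nbhs_cod cp.1 (cod_coord cp)) => x cx.
  by rewrite ABc ?inE //; exact: cp.1.
Qed.

(** The moment map equation determines X from Omega and dmu, so that X
    transforms as a vector field under any map that preserves both. This covers
    changes of charts and the torus action alike. *)
Lemma fundamental_transform (R : fieldType) m n (T w w' : 'M[R]_m) (X X' : 'M[R]_(m, n))
    (d d' : 'M[R]_(n, m)) :
  w = T^T *m w' *m T -> d = d' *m T -> X^T *m w = - d -> X'^T *m w' = - d' ->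
  w \in unitmx -> X' = T *m X.
Proof.
move=> wT dT Xw Xw' uw.
have : w \in unitmx by []; rewrite {1}wT !unitmx_mul => /andP[/andP[_ uw'] uT].
apply: trmx_inj; apply: (can_inj (mulmxK uw')); apply: (can_inj (mulmxK uT)).
by rewrite Xw' mulNmx -dT -Xw wT trmx_mul !mulmxA.
Qed.

Section Extension.
Context {R : realType} {n : nat} {M : toric R n}.
Variables (I0 : tensor M (2 * n) (2 * n)) (zeta vartheta : tensor M n (2 * n)).
Variable (tau : 'rV[R]_n -> R).
Hypotheses (kI0 : toric_kahler I0) (cI0 : dual_coframe I0 zeta vartheta).
Hypothesis (pI0 : symplectic_potential I0 zeta tau).
Implicit Types (c : chart R (2 * n) M) (p : M).
Notation X := (fundamental (act M)).
Notation w := (Omega M).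
Notation d := (dmu M).
Notation P p := (hessian tau (mu M p)).

Section Fixed.
Variables (C F : 'M[R]_n) (t : R).
Hypotheses (Ca : antisym C) (Fa : antisym F).
Notation J := (Jext I0 C F t).

Lemma J_transform (f : M -> M) c c' p :
  form2_invariant setT f w -> endo_invariant setT f I0 ->
  d c p = d c' (f p) *m tangent f c c' p -> around c p -> around c' (f p) ->
  tangent f c c' p *m J c p = J c' (f p) *m tangent f c c' p.
Proof.
move=> fw fI dT cp cfp; apply: Jmx_transform => //; first exact: fI.
exact: (fundamental_transform (fw c c' p I cp cfp) dT (fundamental_Omega cp)
  (fundamental_Omega cfp) (Omega_unit cp)).
Qed.

Lemma J_invariant_id : endo_invariant setT id J.
Proof.
move=> c c' p _ cp cp'.
have [_ iw _ _ _] := Omega_symplectic M.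
have [[[_ iI] _ _] _ _ _] := kI0.
apply: J_transform => //.
apply: (@differential_pullback R _ M n (mu M) id c c' p) => //.
  exact: smooth_mu.
exact: differentiable_transition.
Qed.

Lemma J_invariant_act : torus_invariant setT J.
Proof.
move=> a c c' p _ cp cap; apply: J_transform => //.
- exact: act_symplectic.
- by have [_ h _ _] := kI0; exact: h.
- exact: dmu_act.
Qed.

Lemma J_sqr c p : around c p -> J c p *m J c p = - 1%:M.
Proof.
move=> cp; have ac := cp.1; have oc := open_cod ac.
have sJ := smooth_J kI0 F t Ca ac.
have := smooth_dense_eq ac (smooth_mxM oc sJ sJ) (smooth_mx_cst oc (- 1%:M)).
move=> /(_ _ (coord c p)); rewrite inE /in_chart coordK //; apply; last exact: cod_coord.
move=> x; rewrite inE => -[cx ox]; have cq := around_param ac cx.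
have [zX zIX vX vIX] := cI0 cq ox.
exact: (Jmx_sqr (I0_sqr kI0 cq) (I0_compat kI0 cq) (Omega_antisym cq) (fundamental_Omega cq)
  (dmuX kI0 cI0 pI0 cq) (I0_pos kI0 cq) F t Ca dim_double zX zIX vX vIX (zeta_I0 pI0 cq ox)).
Qed.

Lemma zplus_J c p : around c p -> open_part p ->
  zplus (d c p) F t (zeta c p) *m J c p = (P p - C) *m d c p.
Proof.
move=> cq ox; have [zX zIX vX vIX] := cI0 cq ox.
exact: (zplus_Jmx (I0_sqr kI0 cq) (I0_compat kI0 cq) (Omega_antisym cq) (fundamental_Omega cq)
  (dmuX kI0 cI0 pI0 cq) (I0_pos kI0 cq) F t Ca zX zIX (zeta_I0 pI0 cq ox)).
Qed.

Lemma hess_J c p : around c p -> open_part p ->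
  (P p - C) *m d c p *m J c p = - zplus (d c p) F t (zeta c p).
Proof.
move=> cp op; rewrite -(zplus_J cp op) -mulmxA J_sqr // mulmxN mulmx1.
by [].
Qed.

(** The rows of zeta^+ and (phi_s - C) dmu are closed, J exchanges them up to
    sign, and together they form a coframe that annihilates the Nijenhuis
    tensor. *)
Lemma nijenhuis_J_open c x i j : atlas c -> open_chart c x ->
  nijenhuis (in_chart J c) (cst (delta_mx i 0)) (cst (delta_mx j 0)) x = 0.
Proof.
move=> ac ox; have [cx opx] := ox; have cp := around_param ac cx.
have oV := open_open_chart ac; have nV := near_open_chart ac ox.
have sz := smooth_zeta kI0 cI0 pI0 ac.
have sb := smooth_hess_dmu kI0 cI0 pI0 ac.
have sd := smooth_open_chart (smooth_dmu (M := M) ac).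
have sJ := smooth_open_chart (smooth_J kI0 F t Ca ac).
have diff k l (A : 'rV[R]_(2 * n) -> 'M[R]_(k, l)) :
    smooth_mx (U := open_chart c) A -> forall r s, differentiable (fun y => A y r s) x.
  by move=> sA r s; exact: (sA r s [::] x ox).
pose b y := in_chart zeta c y - (t / 2) *: F *m in_chart d c y.
pose g y := hess_chart tau c y *m in_chart d c y - C *m in_chart d c y.
have bE y : b y = zplus (in_chart d c y) F t (in_chart zeta c y).
  by rewrite /b /zplus -scalemxAl.
have gE y : g y = (hess_chart tau c y - C) *m in_chart d c y.
  by rewrite /g mulmxBl.
have sFd (G : 'M[R]_n) := smooth_mxM oV (smooth_mx_cst oV G) sd.
have sB := smooth_mxB oV sz (sFd ((t / 2) *: F)).
have sG := smooth_mxB oV sb (sFd C).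
have cd r : curl (in_chart d c) r x = 0 by exact: curl_dmu.
have cFd (G : 'M[R]_n) r : curl (fun y => G *m in_chart d c y) r x = 0.
  by apply: curl_cst_mulmx => //; exact: diff.
have cb r : curl b r x = 0.
  rewrite (curlB (diff _ _ _ sz r) (diff _ _ _ (sFd _) r)) cFd subr0.
  exact: (curl_zeta kI0 cI0 pI0 r ac ox).
have cg r : curl g r x = 0.
  rewrite (curlB (diff _ _ _ sb r) (diff _ _ _ (sFd _) r)) cFd subr0.
  exact: (curl_hess_dmu kI0 cI0 pI0 r ac ox).
have bJ : \near x, b x *m in_chart J c x = g x.
  apply: filterS nV => y [cy oy]; rewrite bE gE.
  exact: (zplus_J (around_param ac cy) oy).
have gJ : \near x, g x *m in_chart J c x = - b x.
  apply: filterS nV => y [cy oy]; rewrite bE gE.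
  exact: (hess_J (around_param ac cy) oy).
set N := nijenhuis _ _ _ _.
have bN : b x *m N = 0.
  apply/matrixP => r s; rewrite [s]ord1 [RHS]mxE.
  exact: (nijenhuis_closed i j (diff _ _ _ sJ) (diff _ _ _ sB r) (diff _ _ _ sG r) bJ gJ (cb r) (cg r)).
have gN : g x *m N = 0.
  apply/matrixP => r s; rewrite [s]ord1 [RHS]mxE.
  have sB' := smooth_mxN oV sB.
  have gJ' : \near x, - b x *m in_chart J c x = - g x.
    by apply: filterS bJ => y; rewrite mulNmx => ->.
  have cb' : curl (fun y => - b y) r x = 0.
    by rewrite (curlN (diff _ _ _ sB r)) cb oppr0.
  exact: (nijenhuis_closed i j (diff _ _ _ sJ) (diff _ _ _ sG r) (diff _ _ _ sB' r) gJ gJ' (cg r) cb').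
have [zX zIX vX vIX] := cI0 cp opx.
apply: (coframe_plus_inj (I0_sqr kI0 cp) (dmuX kI0 cI0 pI0 cp) dim_double zX zIX vX vIX
  (zeta_I0 pI0 cp opx) (F := F) (t := t)).
  by rewrite mulmx0 -[RHS]bN bE.
have LH := LH_inv (I0_sqr kI0 cp) (I0_compat kI0 cp) (Omega_antisym cp) (fundamental_Omega cp)
  (I0_pos kI0 cp) Ca zX (zeta_I0 pI0 cp opx).
rewrite mulmx0 -[LHS]mul1mx -LH -!mulmxA (mulmxA (_ - C)).
have -> : (hessian tau (mu M (param c x)) - C) *m (d c (param c x)) *m N = 0.
  by rewrite -[RHS]gN gE.
by rewrite !mulmx0.
Qed.

Lemma complex_structure_J : complex_structure setT J.
Proof.
split; first split.
- move=> c ac i j; rewrite coord_image_setT; exact: (smooth_J kI0 F t Ca ac).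
- exact: J_invariant_id.
- by move=> c p cp _; exact: J_sqr.
- move=> c p cp _ i j; have ac := cp.1; have oc := open_cod ac.
  have sN := smooth_nijenhuis i j oc (smooth_J kI0 F t Ca ac).
  have := smooth_dense_eq ac sN (smooth_mx_cst oc (0 : 'cV[R]_(2 * n))).
  move=> /(_ _ (coord c p)); rewrite inE; apply; last exact: cod_coord.
  by move=> x; rewrite inE => ox; exact: nijenhuis_J_open.
Qed.

Lemma J_plus_unique Jplus c p : is_J_plus zeta tau C F t Jplus ->
  around c p -> open_part p -> J c p = Jplus c p.
Proof.
move=> isJ cp op; have [zX zIX vX vIX] := cI0 cp op.
have [zJ dJ] := isJ c p cp op.
have PT := hess_sym kI0 cI0 pI0 cp op.
have phiT : (P p + C)^T = P p - C by rewrite linearD /= PT Ca.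
have LH := LH_inv (I0_sqr kI0 cp) (I0_compat kI0 cp) (Omega_antisym cp) (fundamental_Omega cp)
  (I0_pos kI0 cp) Ca zX (zeta_I0 pI0 cp op).
apply/esym; apply: (Jmx_unique (I0_sqr kI0 cp) (I0_compat kI0 cp) (Omega_antisym cp)
  (fundamental_Omega cp) (dmuX kI0 cI0 pI0 cp) (I0_pos kI0 cp) Ca dim_double zX zIX vX vIX
  (zeta_I0 pI0 cp op)); first by rewrite -phiT; exact: zJ.
rewrite dJ trmx_inv phiT; congr (- (_ *m _)).
have uP : P p - C \in unitmx by have /mulmx1_unit[] := LH.
by rewrite -[RHS](mulmxK uP) LH mul1mx.
Qed.

End Fixed.

Lemma adjoint_J C F t c p : antisym C -> antisym F -> around c p ->
  Jext I0 (- C) (- F) t c p = symplectic_adjoint (Jext I0 C F t) c p.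
Proof.
move=> Ca Fa cp; have ac := cp.1; have oc := open_cod ac.
have Ca' : antisym (- C) by rewrite /antisym linearN /= Ca.
have sJ := smooth_J kI0 F t Ca ac; have sJ' := smooth_J kI0 (- F) t Ca' ac.
have sw := smooth_Omega (M := M) ac.
have e : w c p *m Jext I0 (- C) (- F) t c p = - ((Jext I0 C F t c p)^T *m w c p).
  have := smooth_dense_eq ac (smooth_mxM oc sw sJ') (smooth_mxN oc (smooth_mxM oc (smooth_mxT oc sJ) sw)).
  move=> /(_ _ (coord c p)); rewrite inE /in_chart coordK //; apply; last exact: cod_coord.
  move=> x; rewrite inE => -[cx ox]; have cq := around_param ac cx.
  have [zX zIX vX vIX] := cI0 cq ox.
  exact: (Omega_Jmx (I0_sqr kI0 cq) (I0_compat kI0 cq) (Omega_antisym cq) (fundamental_Omega cq)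
  (dmuX kI0 cI0 pI0 cq) (I0_pos kI0 cq) t Ca Fa dim_double zX zIX vX vIX (zeta_I0 pI0 cq ox)).
have uw : flat M c p \in unitmx by rewrite unitmx_tr; exact: Omega_unit.
rewrite /symplectic_adjoint -mulmxA -mulmxN -[LHS](mulKmx uw); congr (_ *m _).
by rewrite /flat Omega_antisym // mulNmx e opprK mulmxN opprK.
Qed.

End Extension.

(** * Tameness and conclusion *)

Section Tamed.
Context {R : realType} {n : nat} {M : toric R n}.
Variables (I0 : tensor M (2 * n) (2 * n)) (zeta vartheta : tensor M n (2 * n)).
Variable (tau : 'rV[R]_n -> R).
Hypotheses (kI0 : toric_kahler I0) (cI0 : dual_coframe I0 zeta vartheta).
Hypothesis (pI0 : symplectic_potential I0 zeta tau).
Variable S : 'rV[R]_n -> 'M[R]_n.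
Hypothesis rootS : inverse_sqrt (moment_polytope M) (hessian tau) S.

Lemma continuous_root_mu c x i j : atlas c -> cod c x ->
  {for x, continuous (fun y => S (mu M (param c y)) i j)}.
Proof.
move=> ac cx; have [/subspace_continuousP cS _ _] := rootS.
have cSmu : {for x, continuous (fun y => S (mu M (param c y)))}.
  move=> A nA; have D y : moment_polytope M (mu M (param c y)) by exists (param c y).
  have nS : nbhs (mu M (param c x)) [set z | moment_polytope M z -> A (S z)].
    exact: (cS _ (D x) A nA).
  have nmu : nbhs x [set y | moment_polytope M (mu M (param c y)) -> A (S (mu M (param c y)))].
    exact: (continuous_mu ac cx nS).
  by apply: filterS nmu => y /= h; exact: h (D y).
move=> A nA; exact: (cSmu _ (@coord_continuous R n n i j (S (mu M (param c x))) A nA)).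
Qed.

(** The two sides agree over the interior, where both are the inverse of the
    Hessian, and are continuous up to the boundary. *)
Lemma root_sqr_mu c p : around c p -> S (mu M p) *m S (mu M p) = orbit_gram I0 c p.
Proof.
move=> cp; have ac := cp.1; apply/matrixP => i j.
have := @dense_chart_eq R _ M c (@open_part R n M) R
  (fun y => \sum_k S (mu M (param c y)) i k * S (mu M (param c y)) k j)
  (fun y => in_chart (orbit_gram I0) c y i j) (coord c p).
rewrite /in_chart coordK // mxE; apply => //.
- exact: open_part_dense.
- exact: cod_coord.
- apply: cvg_big => [||k _]; [exact: add_continuous|exact: nbhs_filter|].
  by apply: continuousM; apply: continuous_root_mu => //; exact: cod_coord.
- exact: differentiable_continuous (smooth_orbit_gram kI0 ac i j [::] (cod_coord cp)).
- move=> y cy oy; have [_ _ /(_ _ oy) [SS uP]] := rootS.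
  have cq := around_param ac cy.
  have <- : invmx (hessian tau (mu M (param c y))) = orbit_gram I0 c (param c y).
    by rewrite (hessE kI0 cI0 pI0 cq oy) invmxK.
  by rewrite -SS mxE.
Qed.

Lemma tamed_J C F t : antisym C -> antisym F -> 0 <= t <= 1 ->
  (forall x, moment_polytope M x ->
     posdef (1%:M + 4^-1 *: ((S x *m F *m S x) *m (S x *m F *m S x)))) ->
  tamed setT (Jext I0 C F t).
Proof.
move=> Ca Fa t01 pos c p cp _ v v0.
have Dp : moment_polytope M (mu M p) by exists p.
have [_ /(_ _ Dp) [ST _] _] := rootS.
have [_ Gpos] := pos _ Dp.
exact: (tamed_Jmx (I0_sqr kI0 cp) (I0_compat kI0 cp) (Omega_antisym cp)
  (fundamental_Omega cp) (dmuX kI0 cI0 pI0 cp) (I0_pos kI0 cp) Ca Fa ST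
  (root_sqr_mu cp) t01 Gpos v0).
Qed.

End Tamed.

Theorem theorem6p2 (R : realType) (n : nat) (M : toric R n)
    (I0 : tensor M (2 * n) (2 * n)) (zeta vartheta : tensor M n (2 * n))
    (tau : 'rV[R]_n -> R) (C F : 'M[R]_n) :
  toric_kahler I0 ->
  dual_coframe I0 zeta vartheta ->
  symplectic_potential I0 zeta tau ->
  antisym C -> antisym F -> A_tau M tau F ->
  forall t : R, 0 <= t <= 1 ->
  forall Jplus : tensor M (2 * n) (2 * n), is_J_plus zeta tau C F t Jplus ->
  exists J : tensor M (2 * n) (2 * n),
    (forall c p, around c p -> open_part p -> J c p = Jplus c p) /\
    toric_gen_kahler setT J.
Proof.
move=> kI0 cI0 pI0 Ca Fa [_ [S rootS pos]] t t01 Jplus isJ.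
exists (Jext I0 C F t); split.
  by move=> c p; exact: (J_plus_unique kI0 cI0 pI0 Ca isJ).
split.
- exact: (complex_structure_J kI0 cI0 pI0).
- exact: (J_invariant_act kI0).
- exact: (tamed_J kI0 cI0 pI0 rootS).
- have Ca' : antisym (- C) by rewrite /antisym linearN /= Ca.
  apply: (complex_structure_ext (A := Jext I0 (- C) (- F) t)).
    by move=> c p cp; exact: (adjoint_J kI0 cI0 pI0).
  exact: (complex_structure_J kI0 cI0 pI0).
Qed.
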